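(* Let $k_1,k_2\in C^2(\mathbb T)$, let $Y=L^2(\mathbb T)\times L^2(\mathbb T)$, let $K:M(\mathbb T)\times M(\mathbb T)\to Y$ be $K(\mu,\nu)(s)=\big(\int_{\mathbb T}k_1(x-s)\,d\mu(x),\int_{\mathbb T}k_2(x-s)\,d\nu(x)\big)$, and let $G$ be the Wasserstein-type regularizer defined in the context. For $\mathbf x=(x,\bar x)\in\mathbb T\times\mathbb T$ put $D_{\mathbf x}=\Big(\frac{\delta_x}{2+d_{\mathbb T}(x,\bar x)},\frac{\delta_{\bar x}}{2+d_{\mathbb T}(x,\bar x)}\Big)$. Let $u_0=(\mu_0,\nu_0)=\sum_{i=1}^nc_0^iD_{\mathbf x_0^i}$ with $c_0^i>0$, $\mathbf x_0^i=(x_0^i,\bar x_0^i)\in\mathbb T\times\mathbb T$, and let $(y_0,z_0)=K(\mu_0,\nu_0)$. Let $\eta_0=(\varphi_0,\psi_0)$ be the minimal-norm dual certificate. Suppose that 1. $\mathrm{Im}\,K_*\cap\partial G(u_0)\neq\emptyset$; 2. for $\mathbf x=(x,\bar x)\in\mathbb T\times\mathbb T$, one has $\langle\eta_0,D_{\mathbf x}\rangle=\frac{\varphi_0(x)+\psi_0(\bar x)}{2+d_{\mathbb T}(x,\bar x)}=1$ if and only if $\mathbf x=\mathbf x_0^i$ for some $i\in\{1,\dots,n\}$; 3. $(\varphi_0,\psi_0)\in C^2(\mathbb T)\times C^2(\mathbb T)$ and the Hessian $\mathcal HF(\mathbf x_0^i)$ of $F(\mathbf x)=\frac{\varphi_0(x)+\psi_0(\bar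 x)}{2+d_{\mathbb T}(x,\bar x)}$ (with the convention given in the context) is negative definite for all $i=1,\dots,n$. Assume moreover that $K(D_{\mathbf x_0^1}),\dots,K(D_{\mathbf x_0^n})$ are linearly independent in $Y$. Then, for every sufficiently small $\varepsilon>0$, there exist $\alpha>0$ and $\lambda_0>0$ such that, for all $(\lambda,\mathbf w)\in N_{\alpha,\lambda_0}$ with $\lambda>0$, the problem $\min_{u\in M(\mathbb T)\times M(\mathbb T)}\frac12\|Ku-(y_0,z_0)-\mathbf w\|_Y^2+\lambda G(u)$ has a unique solution $\tilde u_\lambda=(\tilde\mu_\lambda,\tilde\nu_\lambda)$, and it admits a unique representation $$\tilde u_\lambda=\sum_{i=1}^n\tilde c_\lambda^iD_{\tilde{\mathbf x}_\lambda^i},$$ where $D_{\tilde{\mathbf x}_\lambda^i}\in B_\varepsilon(D_{\mathbf x_0^i})$, $\langle\tilde\eta_\lambda,D_{\tilde{\mathbf x}_\lambda^i}\rangle=1$, $\tilde c_\lambda^i>0$ and $|\tilde c_\lambda^i-c_0^i|\le\varepsilon$ for all $i=1,\dots,n$.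
   Context: $\mathbb T$ is the one-dimensional torus with canonical (geodesic) metric $d_{\mathbb T}$; $M(\mathbb T)$ is the space of finite signed Radon measures, $M^+(\mathbb T)$ the positive ones. $X=M(\mathbb T)\times M(\mathbb T)$ with norm $\|\mu\|_{M}+\|\nu\|_{M}$ is the dual of $X_*=C(\mathbb T)\times C(\mathbb T)$, with pairing $\langle(\phi,\psi),(\mu,\nu)\rangle=\int\phi\,d\mu+\int\psi\,d\nu$. Regularizer: $G(\mu,\nu)=\overline W_1(\mu,\nu)+\|\mu\|_M+\|\nu\|_M$ if $\mu,\nu\in M^+(\mathbb T)$ and $\|\mu\|_M=\|\nu\|_M$, and $G(\mu,\nu)=+\infty$ otherwise; here $\overline W_1(\mu,\nu)=c\,W_1(\mu/c,\nu/c)$ for $\|\mu\|_M=\|\nu\|_M=c>0$, $\overline W_1(0,0)=0$, and $W_1$ is the 1-Wasserstein distance for the cost $d_{\mathbb T}$. Pre-adjoint $K_*:Y\to X_*$, $K_*(y,z)(s)=\big(\int_{\mathbb T}k_1(s-x)y(x)dx,\int_{\mathbb T}k_2(s-x)z(x)dx\big)$. For $G(u)<\infty$, $\partial G(u)=\{\eta\in X_*:G(u)+\langle\eta,v-u\rangle\le G(v)\ \forall v\in X\}$. Minimal-norm dual certificate: $\eta_0=K_*p_0$, where $p_0$ is the solution of minimal $Y$-norm of $\sup\{((y_0,z_0),p)_Y:p\in Y,\ K_*p\in\partial G(0)\}$ (a solution exists under hypothesis 1). For $\lambda>0$, $\mathbf w\in Y$, $\tilde\eta_\lambda=K_*\tilde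 p_\lambda$ with $\tilde p_\lambda$ the unique maximizer of $\lambda((y_0,z_0)+\mathbf w,p)_Y-\frac{\lambda^2}2\|p\|_Y^2$ over $\{p\in Y:K_*p\in\partial G(0)\}$. Convention for $\mathcal HF(\mathbf x_0^i)$: near $\mathbf x_0^i$ the torus is identified with $\mathbb R$ by choosing real representatives with $d_{\mathbb T}(x_0^i,\bar x_0^i)=|x_0^i-\bar x_0^i|$; if $x_0^i\ge\bar x_0^i$, then $F$ is understood as the smooth function $F(x,\bar x)=\frac{\varphi_0(x)+\psi_0(\bar x)}{2+x-\bar x}$, and if $\bar x_0^i> x_0^i$ analogously with $2+\bar x-x$ in the denominator. $N_{\alpha,\lambda_0}=\{(\lambda,\mathbf w)\in\mathbb R_+\times Y:0\le\lambda\le\lambda_0,\ \|\mathbf w\|_Y\le\alpha\lambda\}$. $\mathcal B$ is the weak* closure of the set of extreme points of $\{(\mu,\nu)\in X:G(\mu,\nu)\le1\}$, $d_{\mathcal B}$ is a metric on $\mathcal B$ metrizing weak* convergence, $B_\varepsilon(v)=\{u\in\mathcal B:d_{\mathcal B}(u,v)\le\varepsilon\}$. *)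

(* Defs.v *)
From HB Require Import structures.
From mathcomp Require Import all_boot all_order all_algebra.
From mathcomp Require Import all_classical all_reals all_analysis.
From mathcomp Require Import measurable_realfun.
From mathcomp Require Import lra.

Set Implicit Arguments.
Unset Strict Implicit.
Unset Printing Implicit Defensive.

Import Order.TTheory GRing.Theory Num.Theory.
Import numFieldNormedType.Exports.

Local Open Scope classical_set_scope.
Local Open Scope ring_scope.

(* The torus R/Z, each class being given by its representative in [0, 1[. *)
Record torus (R : realType) :=
  Torus { trep : R; trepP : (0 <= trep) && (trep < 1) }.

Section torus_structures.
Context {R : realType}.
Local Notation T := (torus R).
Implicit Types (x y z : T) (a b : R).

HB.instance Definition _ := [isSub for @trep R].
HB.instance Definition _ := [Choice of torus R by <:].

Lemma frac_itv a : (0 <= a - (Num.floor a)%:~R) && (a - (Num.floor a)%:~R < 1).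
Proof.
by have := real_floor_itv (num_real a) => /andP[h1 h2];
  rewrite subr_ge0 h1 /= ltrBlDl -intrD1.
Qed.

Definition tproj a : T := Torus (frac_itv a).

Lemma trepK x : tproj (trep x) = x.
Proof.
apply: val_inj; case: x => a /= ha; rewrite (_ : Num.floor a = 0) ?subr0//.
exact/floor_def.
Qed.

Lemma tprojDz a (k : int) : tproj (a + k%:~R) = tproj a.
Proof.
apply: val_inj => /=.
rewrite floorDrz ?intr_int// intrKfloor intrD opprD addrACA subrr addr0 //.
Qed.

Lemma trep_proj a : exists k : int, trep (tproj a) = a + k%:~R.
Proof. by exists (- Num.floor a); rewrite /= intrN. Qed.

Definition tadd x y := tproj (trep x + trep y).
Definition topp x := tproj (- trep x).

Fact taddA : associative tadd.
Proof.
move=> x y z; rewrite /tadd.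
have [k ->] := trep_proj (trep y + trep z).
have [l ->] := trep_proj (trep x + trep y).
by rewrite addrA tprojDz addrAC tprojDz addrA.
Qed.

Fact taddC : commutative tadd.
Proof. by move=> x y; rewrite /tadd addrC. Qed.

Fact tadd0 : left_id (tproj 0) tadd.
Proof.
move=> x; rewrite /tadd; have [k ->] := trep_proj 0.
by rewrite add0r addrC tprojDz trepK.
Qed.

Fact taddN : left_inverse (tproj 0) topp tadd.
Proof.
move=> x; rewrite /tadd /topp; have [k ->] := trep_proj (- trep x).
by rewrite addrAC addNr tprojDz.
Qed.

HB.instance Definition _ := GRing.isZmodule.Build T taddA taddC tadd0 taddN.

HB.instance Definition _ := isPointed.Build T 0.

Definition tdist x y : R :=
  Num.min `|trep x - trep y| (1 - `|trep x - trep y|).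

Lemma tdist_le x y (k : int) : tdist x y <= `|trep x - trep y + k%:~R|.
Proof.
rewrite /tdist ge_min.
have [->|k0] := eqVneq k 0; first by rewrite addr0 lexx.
apply/orP; right; rewrite lerBlDr.
apply: (@le_trans _ _ `|k%:~R : R|).
  by rewrite -intr_norm -[1]/(1%:~R) ler_int; case: k k0 => [[]|].
have := ler_normB (trep x - trep y + k%:~R) (trep x - trep y).
by rewrite addrAC subrr add0r.
Qed.

Lemma tdist_ex x y : exists k : int, tdist x y = `|trep x - trep y + k%:~R|.
Proof.
rewrite /tdist; case: x y => [a /= /andP[a0 a1]] [b /= /andP[b0 b1]].
have [_|_] := leP; first by exists 0; rewrite addr0.
have [ab|ab] := leP 0 (a - b).
  exists (-1); rewrite ger0_norm// ler0_norm; lra.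
exists 1; rewrite ltr0_norm// ger0_norm; lra.
Qed.

Lemma tdist_proj a b : tdist (tproj a) (tproj b) <= `|a - b|.
Proof.
have [k hk] := trep_proj a; have [l hl] := trep_proj b.
have := tdist_le (tproj a) (tproj b) (l - k); rewrite hk hl.
by rewrite intrB (_ : _ + _ - _ + _ = a - b)//; lra.
Qed.

Fact tdistxx x : tdist x x = 0.
Proof. by rewrite /tdist subrr normr0 subr0 min_l. Qed.

Fact tdist_eq0 x y : tdist x y = 0 -> x = y.
Proof.
move=> h; have [k] := tdist_ex x y; rewrite h => /esym/normr0P/eqP hk.
rewrite -(trepK x) -(trepK y) -(tprojDz (trep x) k).
by congr tproj; lra.
Qed.

Fact tdist_sym x y : tdist x y = tdist y x.
Proof. by rewrite /tdist distrC. Qed.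

Fact tdist_triangle y x z : tdist x z <= tdist x y + tdist y z.
Proof.
have [k ->] := tdist_ex x y; have [l ->] := tdist_ex y z.
apply: le_trans (ler_normD _ _).
have := tdist_le x z (k + l); rewrite intrD.
by rewrite (_ : trep x - trep z + _ =
  trep x - trep y + k%:~R + (trep y - trep z + l%:~R))//; lra.
Qed.

HB.instance Definition _ :=
  @isMetric.Build R T tdist tdistxx tdist_eq0 tdist_sym tdist_triangle.

End torus_structures.

Section torus_measure.
Context {R : realType}.
Local Notation T := (torus R).

HB.instance Definition _ :=
  Measurable.copy T (g_sigma_algebraType (@open T)).

Fact measurable_tproj : measurable_fun (setT : set (measurableTypeR R)) (@tproj R).
Proof.
apply: (@measurability _ _ _ _ _ _ (@open T)) => // _ [A oA <-]; rewrite setTI.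
apply: open_measurable.
rewrite openE => a /= Aa; rewrite /interior.
have /nbhs_ballP[e /= e0 eA] : nbhs (tproj a) A by exact: open_nbhs_nbhs.
apply/nbhs_ballP; exists e => //= b ab; apply: eA.
rewrite ballEmdist /=; apply: le_lt_trans ab; exact: tdist_proj.
Qed.

HB.instance Definition _ :=
  @isMeasurableFun.Build _ _ _ _ (@tproj R) measurable_tproj.

Fact measurable_itv01 : measurable (`[0%R, 1%R[%classic : set R).
Proof. exact: measurable_itv. Qed.

(* Lebesgue (normalized Haar) measure on R/Z. *)
Definition tleb : set T -> \bar R :=
  pushforward (mrestr (@lebesgue_measure R) measurable_itv01) (@tproj R).

Fact tleb0 : tleb set0 = 0%E.
Proof. by rewrite /tleb /pushforward preimage_set0 measure0. Qed.

Fact tleb_ge0 A : (0 <= tleb A)%E.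
Proof. exact: (measure_ge0 (mrestr (@lebesgue_measure R) measurable_itv01)). Qed.

Fact tleb_sigma_additive : semi_sigma_additive tleb.
Proof.
exact: (@measure_semi_sigma_additive _ _ _
  (measure_function_pushforward__canonical__measure_function_Measure
    (mrestr (@lebesgue_measure R) measurable_itv01) measurable_tproj)).
Qed.

HB.instance Definition _ :=
  isMeasure.Build _ T R tleb tleb0 tleb_ge0 tleb_sigma_additive.

End torus_measure.

(* Finite signed measures, i.e. charges; they are made extensional by a zero
   value on non-measurable sets, so that Leibniz equality is equality of
   measures. *)
Record signed_measure d (T : measurableType d) (R : realType) := SignedMeasure {
  smcharge :> {charge set T -> \bar R};
  smcharge_out : forall A, ~ measurable A -> smcharge A = 0%E }.

Section signed_measure.
Context d (T : measurableType d) (R : realType).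
Local Notation M := (signed_measure T R).
Implicit Types mu nu : M.

HB.instance Definition _ := gen_eqMixin M.
HB.instance Definition _ := gen_choiceMixin M.

Lemma signed_measure_eqP mu nu : (mu : set T -> \bar R) =1 nu -> mu = nu.
Proof.
case: mu nu => [mu mu0] [nu nu0] /= /funext munu.
have e : mu = nu.
  case: mu nu munu {mu0 nu0} => [f [[f1] [f2] [f3]]] [g [[g1] [g2] [g3]]] /= fg.
  subst g; rewrite (Prop_irrelevance f1 g1) (Prop_irrelevance f2 g2).
  by rewrite (Prop_irrelevance f3 g3).
by subst nu; congr SignedMeasure; exact: Prop_irrelevance.
Qed.

Fact signed_measure_of_subproof (nu : {charge set T -> \bar R}) A :
  ~ measurable A -> crestr0 nu measurableT A = 0%E.
Proof. by move=> mA; rewrite /crestr0 memNset. Qed.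

Definition signed_measure_of (nu : {charge set T -> \bar R}) : M :=
  SignedMeasure (signed_measure_of_subproof nu).

Definition smdirac (x : T) : M :=
  signed_measure_of (charge_of_finite_measure (dirac x)).

Fact sm0_subproof (A : set T) : ~ measurable A -> @czero _ T R A = 0%E.
Proof. by []. Qed.
Definition sm0 : M := SignedMeasure sm0_subproof.

Fact smadd_subproof mu nu (A : set T) : ~ measurable A -> cadd mu nu A = 0%E.
Proof. by move=> mA; rewrite /cadd /= !smcharge_out// adde0. Qed.
Definition smadd mu nu : M := SignedMeasure (@smadd_subproof mu nu).

Fact smopp_subproof mu (A : set T) : ~ measurable A -> copp mu A = 0%E.
Proof. by move=> mA; rewrite /copp /= smcharge_out// oppe0. Qed.
Definition smopp mu : M := SignedMeasure (@smopp_subproof mu).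

Fact smscale_subproof (r : R) mu (A : set T) :
  ~ measurable A -> cscale r mu A = 0%E.
Proof. by move=> mA; rewrite /cscale /= smcharge_out// mule0. Qed.
Definition smscale r mu : M := SignedMeasure (@smscale_subproof r mu).

Lemma sm_fin_num mu A : mu A \is a fin_num.
Proof.
have [mA|mA] := pselect (measurable A); last by rewrite smcharge_out.
exact: fin_num_measure.
Qed.

Fact smaddA : associative smadd.
Proof. by move=> ? ? ?; apply: signed_measure_eqP => A; exact: addeA. Qed.
Fact smaddC : commutative smadd.
Proof. by move=> ? ?; apply: signed_measure_eqP => A; exact: addeC. Qed.
Fact smadd0 : left_id sm0 smadd.
Proof. by move=> ?; apply: signed_measure_eqP => A; exact: add0e. Qed.
Fact smaddN : left_inverse sm0 smopp smadd.
Proof.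
move=> mu; apply: signed_measure_eqP => A /=.
by rewrite /cadd /= /copp addeC subee// sm_fin_num.
Qed.

HB.instance Definition _ := GRing.isZmodule.Build M smaddA smaddC smadd0 smaddN.

Fact smscaleA a b mu : smscale a (smscale b mu) = smscale (a * b) mu.
Proof.
by apply: signed_measure_eqP => A /=; rewrite /cscale /= /cscale EFinM muleA.
Qed.
Fact smscale1 : left_id 1 smscale.
Proof. by move=> ?; apply: signed_measure_eqP => A; exact: mul1e. Qed.
Fact smscaleDr : right_distributive smscale +%R.
Proof.
move=> a mu nu; apply: signed_measure_eqP => A /=.
by rewrite /cscale /= /cadd /= muleDr// ?fin_num_adde_defl// sm_fin_num.
Qed.
Fact smscaleDl mu : {morph smscale^~ mu : a b / a + b}.
Proof.
move=> a b; apply: signed_measure_eqP => A /=.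
by rewrite /cscale /= /cadd /= /cscale EFinD muleDl// sm_fin_num.
Qed.

HB.instance Definition _ := GRing.Zmodule_isLmodule.Build R M
  smscaleA smscale1 smscaleDr smscaleDl.

Fact hahn_subproof mu :
  exists PN : set T * set T, hahn_decomposition mu PN.1 PN.2.
Proof. by have [P [N PN]] := Hahn_decomposition mu; exists (P, N). Qed.

Definition hahnP mu := svalP (cid (hahn_subproof mu)).

(* |mu|(T), independent of the chosen Hahn decomposition. *)
Definition tvnorm mu : R := fine (charge_variation (hahnP mu) setT).

(* Integral against a signed measure, through its Jordan decomposition. *)
Definition smint mu (f : T -> R) : R :=
  \int[jordan_pos (hahnP mu)]_x f x - \int[jordan_neg (hahnP mu)]_x f x.

Definition smpositive mu := forall A, (0 <= mu A)%E.

End signed_measure.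

Section wasserstein.
Context {R : realType}.
Local Notation T := (torus R).
Local Notation M := (signed_measure T R).
Implicit Types mu nu : M.

Definition coupling mu nu : set {measure set (T * T) -> \bar R} :=
  [set gamma | forall A, measurable A ->
    gamma (A `*` setT) = mu A /\ gamma (setT `*` A) = nu A].

Definition W1 mu nu : \bar R :=
  ereal_inf [set (\int[gamma]_z (tdist z.1 z.2)%:E)%E | gamma in coupling mu nu].

Definition W1bar mu nu : \bar R :=
  let c := tvnorm mu in
  if c == 0 then 0%E else (c%:E * W1 (c^-1 *: mu) (c^-1 *: nu))%E.

Definition Greg (u : M * M) : \bar R :=
  if `[< [/\ smpositive u.1, smpositive u.2 & tvnorm u.1 = tvnorm u.2] >]
  then (W1bar u.1 u.2 + (tvnorm u.1)%:E + (tvnorm u.2)%:E)%E else +oo%E.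

End wasserstein.

Section duality.
Context {R : realType}.
Local Notation T := (torus R).
Local Notation X := (signed_measure T R * signed_measure T R)%type.
Local Notation F2 := ((T -> R) * (T -> R))%type.
Implicit Types (u v : X) (eta p q : F2).

Definition inXpre : set F2 := [set eta | continuous eta.1 /\ continuous eta.2].

Definition pairing eta u : R := smint u.1 eta.1 + smint u.2 eta.2.

Definition weakstar_eval u : {ptws {eta | inXpre eta} -> R} :=
  fun e => pairing (sval e) u.

(* The initial topology of u |-> (eta |-> <eta, u>) into pointwise convergence
   over X_* is the weak* topology. *)
Local Notation weakstar := (initial_topology weakstar_eval).

Definition subdiff (G : X -> \bar R) u : set F2 :=
  [set eta | [/\ inXpre eta, (G u < +oo)%E &
    forall v, (G u + (pairing eta (v - u))%:E <= G v)%E]].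

Definition extreme_points (C : set X) : set X :=
  [set u | C u /\ forall v w t, C v -> C w -> 0 < t < 1 ->
    u = t *: v + (1 - t) *: w -> v = u /\ w = u].

Definition Bset : set X :=
  closure (extreme_points [set u | (Greg u <= 1)%E] : set weakstar).

Definition metrizes_weakstar (B : set X) (d : X -> X -> R) :=
  [/\ forall u v, B u -> B v -> 0 <= d u v /\ (d u v = 0 <-> u = v),
      forall u v, B u -> B v -> d u v = d v u,
      forall u v w, B u -> B v -> B w -> d u w <= d u v + d v w &
      forall (u_ : nat -> X) v, (forall k, B (u_ k)) -> B v ->
        (d (u_ k) v @[k --> \oo] --> (0 : R)) <->
        ((u_ : nat -> weakstar) @ \oo --> (v : weakstar))].

Definition Bball (d : X -> X -> R) (v : X) (eps : R) : set X :=
  [set u | Bset u /\ d u v <= eps].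

Definition Datom (x : T * T) : X :=
  ((2 + tdist x.1 x.2)^-1 *: smdirac R x.1,
   (2 + tdist x.1 x.2)^-1 *: smdirac R x.2).

(* Y is the set of pairs p such that inY p, with eqY as equality. *)
Definition inY : set F2 :=
  [set p | p.1 \in Lfun (@tleb R) 2 /\ p.2 \in Lfun (@tleb R) 2].

Definition eqY p q := p.1 = q.1 %[ae @tleb R] /\ p.2 = q.2 %[ae @tleb R].

Definition dotY p q : R :=
  \int[@tleb R]_x (p.1 x * q.1 x) + \int[@tleb R]_x (p.2 x * q.2 x).

Definition normY p : R := Num.sqrt (dotY p p).

Section kernels.
Variables k1 k2 : T -> R.

Definition Kop u : F2 :=
  (fun s => smint u.1 (fun x => k1 (x - s)),
   fun s => smint u.2 (fun x => k2 (x - s))).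

Definition Kpre p : F2 :=
  (fun s => \int[@tleb R]_x (k1 (s - x) * p.1 x),
   fun s => \int[@tleb R]_x (k2 (s - x) * p.2 x)).

Definition dual_feasible : set F2 :=
  [set p | inY p /\ subdiff Greg 0 (Kpre p)].

Definition dual_solution y0 : set F2 :=
  [set p | dual_feasible p /\
    forall q, dual_feasible q -> dotY y0 q <= dotY y0 p].

Definition min_norm_dual_solution y0 : set F2 :=
  [set p | dual_solution y0 p /\
    forall q, dual_solution y0 q -> normY p <= normY q].

Definition dual_objective (lambda : R) y0 w p : R :=
  lambda * dotY (y0 + w) p - lambda ^+ 2 / 2 * normY p ^+ 2.

Definition dual_maximizer lambda y0 w : set F2 :=
  [set p | dual_feasible p /\ forall q, dual_feasible q ->
    dual_objective lambda y0 w q <= dual_objective lambda y0 w p].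

Definition primal_objective (lambda : R) y0 w u : \bar R :=
  ((2^-1 * normY (Kop u - y0 - w) ^+ 2)%:E + lambda%:E * Greg u)%E.

Definition primal_solution lambda y0 w : set X :=
  [set u | forall v, (primal_objective lambda y0 w u <=
                      primal_objective lambda y0 w v)%E].

End kernels.

Definition linearly_independentY n (y : 'I_n -> F2) :=
  forall a : 'I_n -> R, eqY (\sum_i a i *: y i) 0 -> forall i, a i = 0.

Definition Nset (alpha lambda0 : R) : set (R * F2) :=
  [set lw | [/\ 0 <= lw.1 <= lambda0, inY lw.2 &
                normY lw.2 <= alpha * lw.1]].

End duality.

Section smoothness.
Context {R : realType}.
Local Notation T := (torus R).

(* C^2 on the torus: the 1-periodic lift to the real line is C^2. *)
Definition torusC2 (phi : T -> R) :=
  let f : R -> R := phi \o @tproj R in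
  [/\ forall x, derivable f x 1, forall x, derivable (derive1 f) x 1 &
      continuous (derive1 (derive1 f))].

Definition hessian n (f : 'rV[R]_n.+1 -> R) (a : 'rV[R]_n.+1) : 'M[R]_n.+1 :=
  \matrix_(i, j) 'D_(delta_mx 0 i) (fun b => 'D_(delta_mx 0 j) f b) a.

Definition negative_definite n (H : 'M[R]_n) :=
  forall v : 'rV[R]_n, v != 0 -> (v *m H *m v^T) 0 0 < 0.

Definition row2 (a b : R) : 'rV[R]_2 := \row_j [:: a; b]`_j.

(* F in real coordinates, smoothed across the kink of the distance on the
   diagonal: |a - b| is replaced by a - b if ge holds and by b - a otherwise. *)
Definition Flocal (phi psi : T -> R) (ge : bool) (z : 'rV[R]_2) : R :=
  let a := z 0 ord0 in let b := z 0 ord_max in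
  (phi (tproj a) + psi (tproj b)) / (2 + (if ge then a - b else b - a)).

(* a and b are representatives at distance d_T; they are unique up to a common
   integer shift, except for antipodal points. *)
Definition hessianF_negative_definite (phi psi : T -> R) (x : T * T) :=
  exists a b : R, [/\ tproj a = x.1, tproj b = x.2,
    tdist x.1 x.2 = `|a - b| &
    negative_definite (hessian (Flocal phi psi (b <= a)) (row2 a b))].

End smoothness.

(* Main.v *)
(* Write the dual problem as the projection of (y0 + w) / lambda onto the convex
   set of all p with <p, K D_x> <= 1 for every x. Projections are 1-Lipschitz,
   and without noise they converge to p0 as lambda -> 0, so K_* p_(lambda, w) is
   close to eta0 together with its second differences. By compactness contact
   points can then only occur near the x0_i, and by strict concavity of the
   potentials at most one near each x0_i.
   Optimality of the projection and Farkas' lemma put the residual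
   y0 + w - lambda p in the cone generated by the atoms K D_x at the contact
   points; as K D_(x0_1), ..., K D_(x0_n) are independent, its coefficients are
   close to the c0_i, hence positive, and each x0_i has a contact point nearby.
   The measure with these atoms and coefficients is optimal by weak duality.
   Any other solution v has the same K v and satisfies G(v) = <eta, v>;
   complementary slackness expresses its pairing with every Lipschitz pair
   through K v alone, so it is the same measure. *)

Require Import Defs.
From HB Require Import structures.
From mathcomp Require Import all_boot all_order all_algebra.
From mathcomp Require Import all_classical all_reals all_analysis.
From mathcomp Require Import measurable_realfun.
From mathcomp Require Import ring lra.

Set Implicit Arguments.
Unset Strict Implicit.
Unset Printing Implicit Defensive.

Import Order.TTheory GRing.Theory Num.Theory.
Import numFieldNormedType.Exports.

Local Open Scope classical_set_scope.
Local Open Scope ring_scope.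

(** * Semi-inner products and projections *)

(** Functions in [Lfun] are not identified almost everywhere, so the scalar product is only
    semi-definite: vectors are compared by [nrm (p - q) = 0], and freeness, duality and uniqueness
    are all stated modulo null vectors. The distance is smooth neither on the diagonal nor at
    antipodal pairs, and the perturbed certificates are controlled through second differences
    instead of Hessians. A second difference of [K_* p] is a scalar product of [p] with a second
    difference of the kernel, so Cauchy-Schwarz bounds it by a multiple of |p| h^2 without
    differentiating under the integral. Negative definiteness gives strict concavity of each
    potential separately; this survives such perturbations, and the distance then enters only
    through its local convexity, valid away from antipodal pairs. Strong convergence of the
    projections comes from monotonicity of their norms, which takes the place of weak
    compactness. *)

Record semi_inner (R : realType) (V : lmodType R) := SemiInner {
  dot :> V -> V -> R;
  dotC : forall x y, dot x y = dot y x;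
  dotDl : forall x y z, dot (x + y) z = dot x z + dot y z;
  dotZl : forall a x y, dot (a *: x) y = a * dot x y;
  dot_ge0 : forall x, 0 <= dot x x }.

Section semi_inner_theory.
Context {R : realType} {V : lmodType R} (B : semi_inner V).
Implicit Types (x y z p q : V) (a e t : R).

Lemma dotDr x y z : B x (y + z) = B x y + B x z.
Proof. by rewrite dotC dotDl !(dotC _ x). Qed.

Lemma dotZr a x y : B x (a *: y) = a * B x y.
Proof. by rewrite dotC dotZl dotC. Qed.

Lemma dotNl x y : B (- x) y = - B x y.
Proof. by rewrite -scaleN1r dotZl mulN1r. Qed.

Lemma dotNr x y : B x (- y) = - B x y.
Proof. by rewrite dotC dotNl dotC. Qed.

Lemma dot0l x : B 0 x = 0.
Proof. by rewrite -(scale0r 0) dotZl mul0r. Qed.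

Definition dotE := (dotDl, dotDr, dotNl, dotNr, dotZl, dotZr).

Lemma dot_suml (I : Type) (r : seq I) (P : pred I) (F : I -> V) y :
  B (\sum_(i <- r | P i) F i) y = \sum_(i <- r | P i) B (F i) y.
Proof. by elim/big_rec2: _ => [|i _ x _ <-]; rewrite ?dot0l ?dotDl. Qed.

Lemma dot_sumr (I : Type) (r : seq I) (P : pred I) (F : I -> V) y :
  B y (\sum_(i <- r | P i) F i) = \sum_(i <- r | P i) B y (F i).
Proof. by rewrite dotC dot_suml; apply: eq_bigr => i _; rewrite dotC. Qed.

Definition nrm x := Num.sqrt (B x x).

Lemma nrm_ge0 x : 0 <= nrm x.
Proof. exact: sqrtr_ge0. Qed.

Lemma sqr_nrm x : nrm x ^+ 2 = B x x.
Proof. by rewrite sqr_sqrtr// dot_ge0. Qed.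

(** The discriminant argument splits because [B y y] may vanish for a nonzero [y]: an affine
    function of [t] then stays nonnegative, which forces its slope to vanish. *)
Lemma dot_cauchy x y : `|B x y| <= nrm x * nrm y.
Proof.
rewrite -[leLHS]ger0_norm// -sqrtr_sqr real_normK ?num_real//.
rewrite -sqrtrM ?dot_ge0// ler_wsqrtr//.
have P t : 0 <= B x x + 2 * t * B x y + t ^+ 2 * B y y.
  have := dot_ge0 B (x + t *: y); rewrite !dotE (dotC B y x); lra.
have := dot_ge0 B x; have := dot_ge0 B y.
set a := B x x in P *; set b := B y y in P *; set c := B x y in P * => b0 a0.
have [b00|bn] := eqVneq b 0; last first.
  have bp : 0 < b by rewrite lt_def bn.
  have := P (- (c / b)); set r := c / b => Pr.
  have cE : c = r * b by rewrite divfK.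
  by move: Pr; rewrite cE => Pr; nra.
have [->|cn] := eqVneq c 0; first by rewrite expr0n b00 mulr0.
have := P (- (a + 1) / (2 * c)); rewrite b00 mulr0 addr0.
rewrite (_ : 2 * _ * c = - (a + 1)); [lra | by field].
Qed.

Lemma dot_le x y : B x y <= nrm x * nrm y.
Proof. exact: le_trans (ler_norm _) (dot_cauchy _ _). Qed.

Lemma nrmD x y : nrm (x + y) <= nrm x + nrm y.
Proof.
rewrite -(@ler_pXn2r _ 2)// ?nnegrE ?addr_ge0 ?nrm_ge0// sqr_nrm sqrrD !sqr_nrm.
by rewrite !dotE (dotC B y x); have := dot_le x y; lra.
Qed.

Lemma nrmZ a x : nrm (a *: x) = `|a| * nrm x.
Proof.
by rewrite /nrm !dotE mulrA -expr2 sqrtrM ?sqr_ge0// sqrtr_sqr.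
Qed.

Lemma nrmN x : nrm (- x) = nrm x.
Proof. by rewrite -scaleN1r nrmZ normrN1 mul1r. Qed.

Lemma nrm0 : nrm 0 = 0.
Proof. by rewrite /nrm dot0l sqrtr0. Qed.

Lemma nrmB x y : nrm (x - y) = nrm (y - x).
Proof. by rewrite -opprB nrmN. Qed.

Lemma nrm_triangle z x y : nrm (x - y) <= nrm (x - z) + nrm (z - y).
Proof. by apply: le_trans (nrmD _ _); rewrite addrA subrK. Qed.

Lemma nrm_sum (I : Type) (r : seq I) (P : pred I) (F : I -> V) :
  nrm (\sum_(i <- r | P i) F i) <= \sum_(i <- r | P i) nrm (F i).
Proof.
elim/big_rec2: _ => [|i y x _ h]; first by rewrite nrm0.
by apply: le_trans (nrmD _ _) _; rewrite lerD2l.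
Qed.

Lemma nrm_eq0 x : B x x = 0 <-> nrm x = 0.
Proof.
by split=> [h|h]; [rewrite /nrm h sqrtr0 | rewrite -sqr_nrm h expr0n].
Qed.

Lemma dot_null x y : nrm x = 0 -> B x y = 0.
Proof.
by move=> x0; apply/normr0_eq0/le_anti; rewrite normr_ge0 andbT
  (le_trans (dot_cauchy _ _))// x0 mul0r.
Qed.

Definition nrm_cvg (u : nat -> V) l :=
  forall e, 0 < e -> exists N, forall k, (N <= k)%N -> nrm (u k - l) <= e.

Definition nrm_cauchy (u : nat -> V) :=
  forall e, 0 < e -> exists N, forall k m, (N <= k)%N -> (N <= m)%N ->
    nrm (u k - u m) <= e.

Definition nrm_complete := forall u, nrm_cauchy u -> exists l, nrm_cvg u l.

Definition nrm_closed (C : set V) :=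
  forall u l, (forall k, C (u k)) -> nrm_cvg u l -> C l.

Definition segment_closed (C : set V) :=
  forall x y t, C x -> C y -> 0 <= t <= 1 -> C (x + t *: (y - x)).

Definition is_proj (C : set V) z p :=
  C p /\ forall q, C q -> B (z - p) (q - p) <= 0.

Lemma archi_inv e : 0 < e -> exists N : nat, forall k, (N <= k)%N ->
  k.+1%:R^-1 <= e.
Proof.
move=> e0; exists (Num.truncn e^-1) => k Nk.
rewrite -[leRHS]invrK lef_pV2 ?posrE ?invr_gt0 ?ltr0n//.
apply: ltW; apply: lt_le_trans (truncnS_gt _) _; by rewrite ler_nat.
Qed.

(** A minimizing sequence is Cauchy by the parallelogram identity at midpoints. The variational
    inequality at the limit comes from comparison with [p + t *: (q - p)] for a small [t]. *)
Lemma proj_exists (C : set V) z : nrm_complete -> nrm_closed C ->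
  segment_closed C -> C !=set0 -> exists p, is_proj C z p.
Proof.
move=> cpl clo cvx [c0 Cc0].
pose D := [set B (z - q) (z - q) | q in C].
have hD : has_inf D.
  split; first by exists (B (z - c0) (z - c0)); exists c0.
  by exists 0 => _ [q _ <-]; exact: dot_ge0.
pose d := inf D.
have dle q : C q -> d <= B (z - q) (z - q).
  by move=> Cq; apply: (ge_inf hD.2); exists q.
have d0 : 0 <= d.
  by apply: lb_le_inf => [|_ [q _ <-]]; [exact: hD.1 | exact: dot_ge0].
have /choice[u uP] : forall k : nat, exists q, C q /\
    B (z - q) (z - q) <= d + k.+1%:R^-1.
  move=> k; have k0 : 0 < k.+1%:R^-1 :> R by rewrite invr_gt0 ltr0n.
  by have [_ [q Cq <-] /ltW h] := inf_adherent k0 hD; exists q.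
have par k m : nrm (u k - u m) ^+ 2 <= 2 * k.+1%:R^-1 + 2 * m.+1%:R^-1.
  have [Ck hk] := uP k; have [Cm hm] := uP m.
  have h12 : 0 <= (2^-1 : R) <= 1 by lra.
  have := dle _ (cvx _ _ _ Ck Cm h12); move: hk hm.
  set a := k.+1%:R^-1; set b := m.+1%:R^-1.
  rewrite sqr_nrm !dotE (dotC B (u m) z) (dotC B (u k) z) (dotC B (u m) (u k)).
  lra.
have small e : 0 < e -> exists N, forall k, (N <= k)%N ->
    4 * k.+1%:R^-1 <= e ^+ 2.
  move=> e0; have e4 : 0 < e ^+ 2 / 4 by rewrite divr_gt0// exprn_gt0.
  have [N hN] := archi_inv e4; exists N => k /hN; set a := k.+1%:R^-1; lra.
have [p up] : exists l, nrm_cvg u l.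
  apply: cpl => e e0; have [N hN] := small _ e0; exists N => k m /hN hk /hN hm.
  rewrite -(@ler_pXn2r _ 2)// ?nnegrE ?nrm_ge0 ?(ltW e0)//.
  apply: le_trans (par k m) _; move: hk hm.
  set a := k.+1%:R^-1; set b := m.+1%:R^-1; lra.
have Cp : C p by apply: clo up => k; case: (uP k).
have pmin : nrm (z - p) <= Num.sqrt d.
  apply/ler_addgt0Pr => e e0; have e2 : 0 < e / 2 by lra.
  have [N hN] := up _ e2; have [M hM] := small _ e2.
  have [_ hk] := uP (maxn N M); have := hM _ (leq_maxr N M).
  have := hN _ (leq_maxl N M); set k := maxn N M in hk * => h1 h2.
  have ek : nrm (z - u k) <= Num.sqrt d + e / 2.
    rewrite -(@ler_pXn2r _ 2)// ?nnegrE ?nrm_ge0// ?addr_ge0 ?sqrtr_ge0 ?(ltW e2)//.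
    rewrite sqr_nrm sqrrD sqr_sqrtr//.
    have : 0 <= Num.sqrt d * (e / 2) *+ 2.
      by rewrite mulrn_wge0// mulr_ge0 ?sqrtr_ge0 ?ltW.
    have : 0 <= k.+1%:R^-1 :> R by rewrite invr_ge0.
    move: hk h2; set a := k.+1%:R^-1; lra.
  by apply: le_trans (nrm_triangle (u k) _ _) _; lra.
exists p; split=> // q Cq.
set b := B (z - p) (q - p); rewrite leNgt; apply/negP => b0.
pose Q := B (q - p) (q - p).
have Q0 : 0 <= Q by exact: dot_ge0.
have key t : 0 <= t <= 1 -> 2 * t * b <= t ^+ 2 * Q.
  move=> t01; have := dle _ (cvx _ _ _ Cp Cq t01).
  have : B (z - p) (z - p) <= d.
    by rewrite -sqr_nrm -(sqr_sqrtr d0) ler_pXn2r// ?nnegrE ?sqrtr_ge0.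
  rewrite /b /Q !dotE (dotC B p z) (dotC B q z) (dotC B q p); lra.
(* This [t] is at most 1 and satisfies t Q <= b even when Q = 0, so that [key] would give 2 b <=
   b. *)
have t0 : 0 < b / (b + Q) by rewrite divr_gt0//; lra.
have t1 : b / (b + Q) <= 1 by rewrite ler_pdivrMr; lra.
have bQ : b / (b + Q) * (b + Q) = b by rewrite divfK// gt_eqF//; lra.
have := key (b / (b + Q)); rewrite (ltW t0) t1 => /(_ isT).
set t := b / (b + Q) in t0 t1 bQ * => h.
have h2 : 2 * b <= t * Q by nra.
have : t * Q <= b by nra.
lra.
Qed.

Lemma proj_nonexpansive (C : set V) z z' p p' :
  is_proj C z p -> is_proj C z' p' -> nrm (p - p') <= nrm (z - z').
Proof.
move=> [Cp hp] [Cp' hp']; have h1 := hp _ Cp'; have h2 := hp' _ Cp.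
have h3 : nrm (p - p') ^+ 2 <= nrm (z - z') * nrm (p - p').
  apply: le_trans (dot_le _ _); move: h1 h2.
  rewrite sqr_nrm !dotE !(dotC B p' p); lra.
have := nrm_ge0 (p - p'); rewrite le_eqVlt => /predU1P[<-|p0].
  exact: nrm_ge0.
by rewrite -(ler_pM2r p0) -expr2.
Qed.

(** This is the variational inequality multiplied by [lam ^+ 2] and expanded. The extra square on
    the left later makes the maximizer unique up to null vectors. *)
Lemma proj_maximizer (C : set V) y (lam : R) p q : 0 < lam ->
  is_proj C (lam^-1 *: y) p -> C q ->
  lam * B y q - lam ^+ 2 / 2 * B q q + lam ^+ 2 / 2 * nrm (q - p) ^+ 2 <=
  lam * B y p - lam ^+ 2 / 2 * B p p.
Proof.
move=> l0 [Cp hp] Cq; have := hp _ Cq.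
set z := lam^-1 *: y => h; have -> : y = lam *: z.
  by rewrite scalerA divff ?scale1r// gt_eqF.
have h2 : lam ^+ 2 * B (z - p) (q - p) <= 0.
  by rewrite mulr_ge0_le0// sqr_ge0.
move: h2; rewrite sqr_nrm !dotE !(dotC B q p); lra.
Qed.

(* If a = P(y/s) and b = P(y/t) then ||a-b||^2 <= ||a||^2 - ||b||^2: norms
   increase as s decreases, and bounded norms make the path Cauchy. *)
Lemma proj_path (C : set V) y (s t : R) (a b : V) : 0 < s -> s <= t ->
  is_proj C (s^-1 *: y) a -> is_proj C (t^-1 *: y) b ->
  nrm (a - b) ^+ 2 <= nrm a ^+ 2 - nrm b ^+ 2.
Proof.
move=> s0 st [Ca ha] [Cb hb]; have t0 := lt_le_trans s0 st.
have h1 : B (y - s *: a) (b - a) <= 0.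
  have -> : y - s *: a = s *: (s^-1 *: y - a).
    by rewrite scalerBr scalerA divff ?scale1r// gt_eqF.
  by rewrite dotZl pmulr_rle0// ha.
have h2 : B (y - t *: b) (a - b) <= 0.
  have -> : y - t *: b = t *: (t^-1 *: y - b).
    by rewrite scalerBr scalerA divff ?scale1r// gt_eqF.
  by rewrite dotZl pmulr_rle0// hb.
have h3 : (t - s) * B b (b - a) + s * B (b - a) (b - a) <= 0.
  move: h1 h2; rewrite !dotE !(dotC B b a); lra.
have p3 := dot_ge0 B (b - a).
have h4 : B b (b - a) <= 0.
  (* For t = s only nrm (b - a) = 0 is available, not a = b, hence the detour through [dot_null]. *)
  have [e|ne] := eqVneq t s.
    rewrite e subrr mul0r add0r pmulr_rle0// in h3.
    have -> := dotC B b; rewrite (@dot_null (b - a))//.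
    by apply/nrm_eq0/le_anti; rewrite h3 p3.
  have ts : 0 < t - s by rewrite subr_gt0 lt_neqAle eq_sym ne.
  rewrite -(pmulr_rle0 _ ts); have : 0 <= s * B (b - a) (b - a).
    by rewrite mulr_ge0// ltW.
  lra.
move: h4; rewrite !sqr_nrm !dotE !(dotC B b a); lra.
Qed.

Lemma nrm_cvg_dot u l y e : nrm_cvg u l -> 0 < e ->
  exists N, forall k, (N <= k)%N -> `|B y (u k) - B y l| <= e.
Proof.
move=> ul e0; have y1 : 0 < nrm y + 1 by rewrite ltr_wpDl ?nrm_ge0.
have [N hN] := ul (e / (nrm y + 1)) (divr_gt0 e0 y1).
exists N => k /hN; rewrite ler_pdivlMr// => h.
rewrite -dotNr -dotDr; apply: le_trans (dot_cauchy _ _) _.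
by have := nrm_ge0 (u k - l); lra.
Qed.

(** [p0] is a maximizer of [B y] over [C] of minimal norm. The projections have norm at most that of
    [p0], so along s_k = 1/(k+1) their norms, monotone by [proj_path], converge and the projections
    form a Cauchy sequence. The limit maximizes [B y]; minimality of [p0] and [near0] identify it
    with [p0] up to a null vector. Finally [proj_path] extends the estimate from s_k to every [l]
    below it. *)
Lemma proj_path_cvg (C : set V) y p0 : nrm_complete -> nrm_closed C ->
  segment_closed C -> C p0 -> (forall q, C q -> B y q <= B y p0) ->
  (forall q, C q -> (forall r, C r -> B y r <= B y q) -> nrm p0 <= nrm q) ->
  forall e, 0 < e -> exists2 l0, 0 < l0 & forall l p, 0 < l <= l0 ->
    is_proj C (l^-1 *: y) p -> nrm (p - p0) <= e.
Proof.
move=> cpl clo cvx Cp0 p0max p0min e e0.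
(* Maximality of [p0] turns the variational inequality tested at [p0] into <p, p> <= <p, p0>;
   expanding the square gives the bound. *)
have near0 l p : 0 < l -> is_proj C (l^-1 *: y) p ->
    nrm (p - p0) ^+ 2 <= nrm p0 ^+ 2 - nrm p ^+ 2.
  move=> l0 [Cp hp].
  have h1 : B (y - l *: p) (p0 - p) <= 0.
    have -> : y - l *: p = l *: (l^-1 *: y - p).
      by rewrite scalerBr scalerA divff ?scale1r// gt_eqF.
    by rewrite dotZl pmulr_rle0// hp.
  have h2 : l * (B p p - B p p0) <= 0.
    by have := p0max _ Cp; move: h1; rewrite !dotE; lra.
  move: h2; rewrite pmulr_rle0// !sqr_nrm !dotE (dotC B p0 p); lra.
have nle l p : 0 < l -> is_proj C (l^-1 *: y) p -> nrm p <= nrm p0.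
  move=> l0 /(near0 _ _ l0) h.
  rewrite -(@ler_pXn2r _ 2)// ?nnegrE ?nrm_ge0//.
  by have := sqr_ge0 (nrm (p - p0)); lra.
pose s k : R := k.+1%:R^-1.
have s0 k : 0 < s k by rewrite invr_gt0 ltr0n.
have /choice[u uP] k : exists p, is_proj C ((s k)^-1 *: y) p.
  by apply: proj_exists => //; exists p0.
have mono k m : (k <= m)%N -> nrm (u m - u k) ^+ 2 <=
    nrm (u m) ^+ 2 - nrm (u k) ^+ 2.
  move=> km; apply: proj_path (uP m) (uP k) => //.
  by rewrite lef_pV2 ?posrE ?ltr0n// ler_nat ltnS.
pose A := range (fun k => nrm (u k) ^+ 2).
have hA : has_sup A.
  split; first by exists (nrm (u 0%N) ^+ 2); exists 0%N.
  exists (nrm p0 ^+ 2) => _ [k _ <-].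
  by rewrite ler_pXn2r// ?nnegrE ?nrm_ge0//; exact: nle (uP k).
have [p up] : exists l, nrm_cvg u l.
  apply: cpl => d d0; have d2 : 0 < d ^+ 2 by rewrite exprn_gt0.
  have [_ [N _ <-] hN] := sup_adherent d2 hA; exists N => k m Nk Nm.
  have fin i j : (N <= i)%N -> (i <= j)%N -> nrm (u j - u i) <= d.
    move=> Ni ij; rewrite -(@ler_pXn2r _ 2)// ?nnegrE ?nrm_ge0 ?(ltW d0)//.
    have : nrm (u j) ^+ 2 <= sup A by apply: (ub_le_sup hA.2); exists j.
    have := mono _ _ ij; have := mono _ _ Ni; have := sqr_ge0 (nrm (u i - u N)).
    lra.
  by case/orP: (leq_total k m) => km; [rewrite nrmB|]; exact: fin.
have Cp : C p by apply: clo up => k; case: (uP k).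
(* Dividing [proj_maximizer] by s_k leaves an error s_k |q|^2 / 2, which vanishes in the limit. *)
have pmax q : C q -> B y q <= B y p.
  move=> Cq; apply/ler_addgt0Pr => d d0; have d2 : 0 < d / 2 by lra.
  have [N hN] := nrm_cvg_dot y up d2.
  have M0 : 0 < d / (B q q + 1).
    by rewrite divr_gt0// ltr_wpDl ?dot_ge0.
  have [M hM] := archi_inv M0; pose k := maxn N M.
  have := hN k (leq_maxl _ _); have := hM k (leq_maxr _ _).
  rewrite ler_pdivlMr ?ltr_wpDl ?dot_ge0// => h1.
  rewrite ler_distl => /andP[_ h2].
  have h3 := @proj_maximizer C y (s k) (u k) q (s0 k) (uP k) Cq.
  have h4 : s k * (B y q - B y (u k)) <= s k * (s k / 2 * B q q).
    have := sqr_ge0 (nrm (q - u k)); have := dot_ge0 B (u k).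
    have := sqr_ge0 (s k); rewrite !expr2 in h3 * => a1 a2 a3.
    have b1 := mulr_ge0 a1 a2; have b2 := mulr_ge0 a1 a3; lra.
  move: h4; rewrite ler_pM2l// => h4.
  have := s0 k; have : s k * (B q q + 1) <= d by []; lra.
have pp0 : nrm p0 <= nrm p by exact: p0min.
have up0 : nrm_cvg u p0.
  move=> d d0; have d2 : 0 < d / 2 by lra.
  have hp : nrm (p - p0) <= 0.
    apply/ler_addgt0Pr => c c0; rewrite add0r.
    have c1 : 0 < c ^+ 2 by rewrite exprn_gt0.
    have K0 : 0 < 2 * nrm p0 + 1 by have := nrm_ge0 p0; lra.
    (* From |p0| <= |p| <= |u_N| + b the difference |p0|^2 - |u_N|^2 is at most b (2 |p0| + 1),
       which this [b] keeps below (c / 2)^2. *)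
    pose b := Num.min (c / 2) ((c / 2) ^+ 2 / (2 * nrm p0 + 1)).
    have b0 : 0 < b by rewrite lt_min !divr_gt0 ?exprn_gt0 ?divr_gt0.
    have [N hN] := up _ b0; have {}hN := hN N (leqnn _).
    have h1 : nrm p <= nrm (u N) + b.
      rewrite -{1}(subrK (u N) p) addrC; apply: le_trans (nrmD _ _) _.
      by rewrite lerD2l nrmB.
    have h2 : nrm (u N - p0) <= c / 2.
      rewrite -(@ler_pXn2r _ 2)// ?nnegrE ?nrm_ge0 ?divr_ge0 ?(ltW c0)//.
      apply: le_trans (near0 _ _ (s0 N) (uP N)) _.
      have h3 := nle _ _ (s0 N) (uP N).
      have h4 : b * (2 * nrm p0 + 1) <= (c / 2) ^+ 2.
        by rewrite -ler_pdivlMr// /b ge_min lexx orbT.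
      have := nrm_ge0 (u N); have := nrm_ge0 p0; nra.
    have h5 : b <= c / 2 by rewrite /b ge_min lexx.
    apply: le_trans (nrm_triangle (u N) _ _) _; rewrite nrmB; lra.
  have [N hN] := up _ d2; exists N => k /hN h.
  by apply: le_trans (nrm_triangle p _ _) _; lra.
have [N hN] : exists N, forall k, (N <= k)%N ->
    nrm p0 ^+ 2 - nrm (u k) ^+ 2 <= (e / 2) ^+ 2.
  have K0 : 0 < 2 * nrm p0 + 1 by have := nrm_ge0 p0; lra.
  have b0 : 0 < (e / 2) ^+ 2 / (2 * nrm p0 + 1).
    by rewrite divr_gt0// exprn_gt0// divr_gt0.
  have [N hN] := up0 _ b0; exists N => k /hN.
  rewrite ler_pdivlMr// => h; have := nle _ _ (s0 k) (uP k).
  have : nrm p0 <= nrm (u k) + nrm (u k - p0).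
    rewrite nrmB -{1}(subrK (u k) p0) addrC; exact: nrmD.
  have := nrm_ge0 (u k - p0); have := nrm_ge0 p0; have := nrm_ge0 (u k); nra.
have e2 : 0 < e / 2 by lra.
have [M hM] := up0 _ e2; pose k := maxn N M.
exists (s k) => // l q /andP[l0 lk] hq.
have h1 := hM k (leq_maxr _ _); have h2 := hN k (leq_maxl _ _).
have h3 : nrm (q - u k) <= e / 2.
  rewrite -(@ler_pXn2r _ 2)// ?nnegrE ?nrm_ge0 ?(ltW e2)//.
  apply: le_trans (proj_path l0 lk hq (uP k)) _; apply: le_trans h2.
  by rewrite lerD2r ler_pXn2r// ?nnegrE ?nrm_ge0//; exact: nle hq.
by apply: le_trans (nrm_triangle (u k) _ _) _; lra.
Qed.

(** * Linear independence modulo null vectors *)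

Definition free_family n (v : 'I_n -> V) :=
  forall a : 'I_n -> R, nrm (\sum_i a i *: v i) = 0 -> forall i, a i = 0.

(** The Gram matrix of a free family is invertible: a row in its kernel gives a combination
    orthogonal to all the [v i], hence null. The rows of the inverse are the coefficients of the
    dual vectors. *)
Lemma dual_basis n (v : 'I_n -> V) : free_family v ->
  exists p : 'I_n -> V, forall i j, B (p i) (v j) = (i == j)%:R.
Proof.
move=> fv; pose G := \matrix_(i, j) B (v i) (v j).
have Gu : G \in unitmx.
  rewrite -row_free_unit; apply/row_freeP; apply/row_freeP.
  rewrite -kermx_eq0; apply/rowV0P => a /sub_kermxP aG0.
  have : nrm (\sum_i a 0 i *: v i) = 0.
    apply/nrm_eq0; rewrite dot_sumr big1// => j _; rewrite dotZr dot_suml.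
    have := congr1 (fun M : 'rV[R]_n => M 0 j) aG0; rewrite !mxE => h.
    rewrite (_ : \sum_i _ = 0) ?mulr0// -[RHS]h.
    by apply: eq_bigr => i _; rewrite dotZl mxE.
  by move=> /fv a0; apply/rowP => i; rewrite a0 mxE.
exists (fun i => \sum_k invmx G i k *: v k) => i j.
have := congr1 (fun M : 'M[R]_n => M i j) (mulVmx Gu); rewrite !mxE => <-.
by rewrite dot_suml; apply: eq_bigr => k _; rewrite dotZl mxE.
Qed.

(** The dual vectors of [v] read the coefficients off a combination of the [v' i] up to an error
    proportional to [t * A], where [A] is the sum of the |a_i|. The choice of [t] makes the total
    error at most A / 2, so it is absorbed on the left at the price of a factor 2. *)
Lemma free_perturbation n (v p : 'I_n -> V) :
  (forall i j, B (p i) (v j) = (i == j)%:R) ->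
  exists D t, [/\ 0 < D, 0 < t & forall v' : 'I_n -> V,
    (forall i, nrm (v' i - v i) <= t) ->
    forall a : 'I_n -> R, \sum_i `|a i| <= D * nrm (\sum_i a i *: v' i)].
Proof.
move=> pv; pose D := \sum_i nrm (p i).
have D0 : 0 <= D by apply: sumr_ge0 => i _; exact: nrm_ge0.
exists (2 * (D + 1)), (2 * (D + 1))^-1; split=> [||v' hv a]; first by lra.
  by rewrite invr_gt0; lra.
set A := \sum_i `|a i|; set N := nrm _; set t := _^-1 in hv.
have A0 : 0 <= A by apply: sumr_ge0 => i _.
have N0 : 0 <= N by exact: nrm_ge0.
have key i : `|a i| <= nrm (p i) * (N + t * A).
  have -> : a i = B (p i) (\sum_j a j *: v j).
    rewrite dot_sumr (bigD1 i)//= dotZr pv eqxx mulr1 big1 ?addr0// => j ji.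
    by rewrite dotZr pv eq_sym (negbTE ji) mulr0.
  apply: le_trans (dot_cauchy _ _) _; apply: ler_wpM2l; first exact: nrm_ge0.
  rewrite -[X in nrm X](subrK (\sum_j a j *: v' j)) addrC.
  apply: le_trans (nrmD _ _) _; rewrite lerD2l -sumrB mulr_sumr.
  apply: le_trans (nrm_sum _ _ _) _; apply: ler_sum => j _.
  by rewrite -scalerBr nrmZ nrmB mulrC ler_wpM2r.
have : A <= D * (N + t * A) by rewrite mulr_suml; apply: ler_sum.
have tE : t * (2 * (D + 1)) = 1 by rewrite mulVf// gt_eqF//; lra.
have t0 : 0 < t by rewrite invr_gt0; lra.
have : t * D * A <= A / 2 by rewrite mulrC ler_wpM2l//; lra.
nra.
Qed.

(** Farkas' lemma, explicit for a free family: testing with [- p i] gives a_i >= 0, testing with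
    [p i] for [i] outside [P] gives a_i <= 0, and one more test vector excludes a remainder. *)
Lemma cone_generated n (v : 'I_n -> V) (q : V) (P : pred 'I_n) :
  free_family v ->
  (forall d, (forall i, P i -> B d (v i) <= 0) -> B d q <= 0) ->
  exists a : 'I_n -> R, [/\ forall i, 0 <= a i, forall i, ~~ P i -> a i = 0 &
    nrm (q - \sum_i a i *: v i) = 0].
Proof.
move=> fv hq; have [p pv] := dual_basis fv.
pose a i := B (p i) q; pose r := q - \sum_i a i *: v i.
have a0 i : 0 <= a i.
  rewrite /a -oppr_le0 -dotNl; apply: hq => j _; rewrite dotNl pv oppr_le0.
  exact: ler0n.
have aP i : ~~ P i -> a i = 0.
  move=> Pi; apply/le_anti; rewrite a0 andbT; apply: hq => j Pj; rewrite pv.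
  by rewrite (_ : i == j = false)//; apply: contraNF Pi => /eqP ->.
have pr i : B (p i) r = 0.
  rewrite /r !dotE dot_sumr (bigD1 i)//= dotZr pv eqxx mulr1 big1 ?addr0 ?subrr//.
  by move=> j ji; rewrite dotZr pv eq_sym (negbTE ji) mulr0.
exists a; split => //.
(* the part of r orthogonal to all v i annihilates q and the v i *)
pose s := r - \sum_i B r (v i) *: p i.
have sv j : B s (v j) = 0.
  rewrite /s dotDl dotNl dot_suml (bigD1 j)//= dotZl pv eqxx mulr1 big1 ?addr0 ?subrr//.
  by move=> i ij; rewrite dotZl pv (negbTE ij) mulr0.
have sq : B s q <= 0 by apply: hq => j _; rewrite sv.
apply/nrm_eq0/le_anti; rewrite dot_ge0 andbT -/r.
have -> : B r r = B s r.
  rewrite {1}/s dotDl dotNl dot_suml big1 ?subr0// => i _.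
  by rewrite dotZl pr mulr0.
rewrite {1}/r dotDr dotNr dot_sumr big1 ?subr0// => i _.
by rewrite dotZr sv mulr0.
Qed.

End semi_inner_theory.

(** * Functions on the torus *)

Section second_difference.
Context {R : realType}.
Implicit Types (f g : R -> R) (a b m h A : R).

Lemma is_derive1_continuous f df : (forall x : R, is_derive x 1 f (df x)) ->
  continuous f.
Proof.
move=> fd x; apply: differentiable_continuous; apply/derivable1_diffP.
exact: ex_derive.
Qed.

(** The function g(t) = f(m + t) + f(m - t) - A t^2 is compared at 0 and [h]: its derivative f1(m +
    t) - f1(m - t) - 2 A t is nonpositive by the mean value theorem for [f1]. *)
Lemma second_difference_le f f1 f2 m h A :
  (forall x : R, is_derive x 1 f (f1 x)) -> (forall x : R, is_derive x 1 f1 (f2 x)) ->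
  0 <= h -> (forall x, m - h <= x <= m + h -> f2 x <= A) ->
  f (m + h) + f (m - h) - 2 * f m <= A * h ^+ 2.
Proof.
move=> fd f1d h0 f2A.
pose g t := f (m + t) + f (m - t) - A * t ^+ 2.
pose dg t := f1 (m + t) - f1 (m - t) - A * (2 * t).
have gd (t : R) : is_derive t 1 g (dg t).
  have d1 : is_derive t 1 (fun t : R => m + t) 1.
    rewrite -[1 in X in is_derive _ _ _ X]add0r.
    exact: (is_deriveD (is_derive_cst m t 1) (is_derive_id t 1)).
  have d2 : is_derive t 1 (fun t : R => m - t) (-1).
    rewrite -[-1]sub0r.
    exact: (is_deriveB (is_derive_cst m t 1) (is_derive_id t 1)).
  have d3 := @is_derive1_comp _ f (fun t => m + t) t _ _ (fd (m + t)) d1.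
  have d4 := @is_derive1_comp _ f (fun t => m - t) t _ _ (fd (m - t)) d2.
  have d5 : is_derive t 1 (fun t : R => A * t ^+ 2) (A * (2 * t)).
    rewrite (_ : A * (2 * t) = A *: ((2%:R * t ^+ 1) *: 1)).
      rewrite (_ : (fun u : R => A * u ^+ 2) = A *: (id : R -> R) ^+ 2).
        exact: (is_deriveZ A (is_deriveX 2 (is_derive_id t 1))).
      by apply/funext => u; rewrite scalrfctE exprfctE.
    by rewrite expr1 /GRing.scale/= mulr1.
  have := is_deriveB (is_deriveD d3 d4) d5.
  by rewrite mulr1 mulrN1.
have gc : {within `[0, h], continuous g}.
  exact/continuous_subspaceT/(is_derive1_continuous gd).
have [c] := MVT_segment h0 (fun x _ => gd x) gc.
rewrite in_itv/= => /andP[c0 ch]; rewrite subr0 => gE.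
have dg0 : dg c <= 0.
  have cc : m - c <= m + c by lra.
  have fc : {within `[m - c, m + c], continuous f1}.
    exact/continuous_subspaceT/(is_derive1_continuous f1d).
  have [d] := MVT_segment cc (fun x _ => f1d x) fc.
  rewrite in_itv/= => /andP[d1 d2] fE; rewrite /dg fE.
  have : f2 d <= A by apply: f2A; apply/andP; split; lra.
  move=> fA; have : f2 d * (2 * c) <= A * (2 * c) by rewrite ler_wpM2r//; lra.
  lra.
have : dg c * h <= 0 by rewrite mulr_le0_ge0.
rewrite -gE /g !addr0 subr0 expr0n/= mulr0; lra.
Qed.

Lemma lipschitz_is_derive f f1 A :
  (forall x : R, is_derive x 1 f (f1 x)) -> (forall x : R, `|f1 x| <= A) ->
  forall a b, `|f a - f b| <= A * `|a - b|.
Proof.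
move=> fd fA a b; wlog ab : a b / b <= a => [H|].
  have [/H//|/ltW /H] := leP b a; by rewrite distrC (distrC a).
have fc : {within `[b, a], continuous f}.
  exact/continuous_subspaceT/(is_derive1_continuous fd).
by have [c _ ->] := MVT_segment ab (fun x _ => fd x) fc; rewrite normrM ler_wpM2r.
Qed.

Lemma periodic_bounded f : continuous f ->
  (forall x (k : int), f (x + k%:~R) = f x) -> exists2 A, 0 <= A &
  forall x, `|f x| <= A.
Proof.
move=> fc fp.
have nc : {within `[0, 1], continuous (fun x : R => `|f x|)}.
  apply: continuous_subspaceT => x; apply: continuous_comp; first exact: fc.
  exact: norm_continuous.
have [c _ hc] := EVT_max (@ler01 R) nc.
exists `|f c| => // x; have := hc (x - (Num.floor x)%:~R).
rewrite -intrN fp; apply.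
have /andP[h1 h2] := frac_itv x.
by rewrite in_itv/= intrN h1/= ltW.
Qed.

End second_difference.

(** * Metric geometry of the torus, compactness, bounds for C^2 functions *)

Section torus_lipschitz.
Context {R : realType}.
Local Notation T := (torus R).
Implicit Types (x y : T) (a b m h e : R) (f g : T -> R).

Definition tlip L f := forall x y, `|f x - f y| <= L * tdist x y.

(** C^2 bounds are carried by these symmetric differences, which are linear in [f] and commute with
    convolution. *)
Definition second_diff f m h :=
  f (tproj (m + h)) + f (tproj (m - h)) - 2 * f (tproj m).

Lemma tball x y e : ball x e y <-> tdist x y < e.
Proof. by rewrite ballEmdist. Qed.

Lemma tdist_ge0 x y : 0 <= tdist x y.
Proof. by have [k ->] := tdist_ex x y. Qed.

Lemma tdist_le1 x y : tdist x y <= 2^-1.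
Proof.
rewrite /tdist ge_min; set t := `|_|.
by apply/orP; have [h|h] := leP t 2^-1; [left | right; lra].
Qed.

Lemma tdist_lip x y x' y' :
  `|tdist x y - tdist x' y'| <= tdist x x' + tdist y y'.
Proof.
have h1 := tdist_triangle x' x y; have h2 := tdist_triangle y' x' y.
have h3 := tdist_triangle x x' y'; have h4 := tdist_triangle y x y'.
rewrite ler_distl (tdist_sym y' y) (tdist_sym x' x) in h1 h2 h3 h4 *.
by apply/andP; split; lra.
Qed.

Lemma tdist_rep x y : exists a b, [/\ tproj a = x, tproj b = y &
  tdist x y = `|a - b|].
Proof.
have [k kE] := tdist_ex x y; exists (trep x + k%:~R), (trep y).
by rewrite tprojDz !trepK kE; split=> //; rewrite addrAC.
Qed.

(** A nonzero integer shift takes [a - b], of modulus at most 1/2, to modulus at least 1/2. *)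
Lemma tdist_half a b : `|a - b| <= 2^-1 -> tdist (tproj a) (tproj b) = `|a - b|.
Proof.
move=> ab; apply/le_anti; rewrite tdist_proj/=.
have [k ->] := tdist_ex (tproj a) (tproj b).
have [j ->] := trep_proj a; have [l ->] := trep_proj b.
have -> : a + j%:~R - (b + l%:~R) + k%:~R = a - b + (j - l + k)%:~R.
  by rewrite intrD intrB; ring.
have [->|n0] := eqVneq (j - l + k) 0; first by rewrite addr0.
have : 1 <= `|(j - l + k)%:~R : R|.
  rewrite -intr_norm -[1]/(1%:~R) ler_int.
  by case: (j - l + k) n0 => [[]|].
have := ler_normB (a - b + (j - l + k)%:~R) (a - b).
rewrite addrAC subrr add0r; lra.
Qed.

Lemma tsubE x y : x - y = tproj (trep x - trep y).
Proof.
rewrite -[x - y]/(tadd x (topp y)) /tadd /topp.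
by have [k ->] := trep_proj (- trep y); rewrite addrA tprojDz.
Qed.

Lemma tproj_sub a b : tproj a - tproj b = tproj (a - b).
Proof.
rewrite tsubE; have [k ->] := trep_proj a; have [l ->] := trep_proj b.
by rewrite opprD addrACA -intrN -intrD tprojDz.
Qed.

Lemma tdist_sub2r x y s : tdist (x - s) (y - s) <= tdist x y.
Proof.
have [a [b [<- <- ->]]] := tdist_rep x y.
rewrite -(trepK s) !tproj_sub; apply: le_trans (tdist_proj _ _) _.
by rewrite opprB addrA subrK.
Qed.

Lemma tdist_sub2l x y s : tdist (s - x) (s - y) <= tdist x y.
Proof.
have [a [b [<- <- ->]]] := tdist_rep x y.
rewrite -(trepK s) !tproj_sub; apply: le_trans (tdist_proj _ _) _.
by rewrite distrC (_ : _ - _ = a - b)//; ring.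
Qed.

Lemma continuous_tproj : continuous (@tproj R).
Proof.
move=> a; apply/cvg_ballP => e e0; near=> b.
apply/tball; apply: le_lt_trans (tdist_proj _ _) _.
near: b; apply/nbhs_ballP; exists e => //= b; exact.
Unshelve. all: by end_near. Qed.

Lemma tcompact : compact [set: T].
Proof.
rewrite (_ : [set: T] = (@tproj R) @` `[0, 1]).
  apply: continuous_compact; last exact: segment_compact.
  exact/continuous_subspaceT/continuous_tproj.
apply/seteqP; split=> // x _; exists (trep x); last exact: trepK.
by case: x => a /= /andP[a0 a1]; rewrite in_itv/= a0 ltW.
Qed.

Lemma lip2_continuous L (F : T * T -> R) : 0 <= L ->
  (forall z w, `|F z - F w| <= L * (tdist z.1 w.1 + tdist z.2 w.2)) ->
  continuous F.
Proof.
move=> L0 FL z A /nbhs_ballP[e /= e0 eA].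
have d0 : 0 < e / (2 * (L + 1)) by rewrite divr_gt0//; lra.
exists (ball z.1 (e / (2 * (L + 1))), ball z.2 (e / (2 * (L + 1)))).
  by split; exact: nbhsx_ballx.
move=> w [/tball w1 /tball w2]; apply: eA.
rewrite /ball/=; apply: le_lt_trans (FL _ _) _.
have : tdist z.1 w.1 + tdist z.2 w.2 < e / (L + 1).
  rewrite (_ : e / (L + 1) = e / (2 * (L + 1)) + e / (2 * (L + 1))).
    exact: ltrD.
  by field; lra.
rewrite ltr_pdivlMr; last lra.
have := tdist_ge0 z.1 w.1; have := tdist_ge0 z.2 w.2; nra.
Qed.

Lemma tlip_continuous L f : tlip L f -> continuous f.
Proof.
move=> fL z A /nbhs_ballP[e /= e0 eA].
have d0 : 0 < e / (`|L| + 1) by rewrite divr_gt0// ltr_wpDl.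
apply/nbhs_ballP; exists (e / (`|L| + 1)) => //= w /tball.
rewrite ltr_pdivlMr ?ltr_wpDl// => zw; apply: eA.
rewrite /ball/=; apply: le_lt_trans (fL _ _) _.
have := tdist_ge0 z w; have := ler_norm L; nra.
Qed.

(** The closed set is encoded as {0 <= G}, so that both data enter through continuity alone; on the
    empty set any constant serves, here 1. *)
Lemma compact_lower_bound (F G : T * T -> R) : continuous F -> continuous G ->
  (forall z, 0 <= G z -> 0 < F z) ->
  exists2 c, 0 < c & forall z, 0 <= G z -> c <= F z.
Proof.
move=> Fc Gc GF.
have [A0|/set0P/negP/negPn/eqP A0] := pselect ([set z | 0 <= G z] !=set0); last first.
  exists 1 => // z Gz; have : [set z | 0 <= G z] z by [].
  by rewrite A0.
have cA : compact [set z | 0 <= G z].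
  apply: (@subclosed_compact _ _ ([set: T] `*` [set: T])) => //.
    rewrite (_ : [set _ | _] = G @^-1` [set x | 0 <= x])//.
    apply: closed_comp; first by move=> x _; exact: Gc.
    exact: closed_ge.
  exact: compact_setX tcompact tcompact.
have [z Az hz] := compact_EVT_min A0 cA (continuous_subspaceT Fc).
exists (F z); first by apply: GF; rewrite inE in Az.
by move=> w Gw; apply: hz; rewrite inE.
Qed.

Lemma tcontinuous_bounded f : continuous f -> exists2 A, 0 <= A &
  forall x, `|f x| <= A.
Proof.
move=> fc; have nc : continuous (fun x => `|f x|).
  by move=> x; apply: continuous_comp; [exact: fc | exact: norm_continuous].
have [z _ hz] := compact_EVT_max (ex_intro _ (0 : T) I) tcompact
  (continuous_subspaceT nc).
by exists `|f z| => // x; apply: hz; rewrite inE.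
Qed.

Lemma torusC2_derive f : torusC2 f -> exists f1 f2 : R -> R,
  [/\ forall x : R, is_derive x 1 (f \o @tproj R) (f1 x),
      forall x : R, is_derive x 1 f1 (f2 x), continuous f2 &
      forall (x : R) (k : int), f1 (x + k%:~R) = f1 x /\ f2 (x + k%:~R) = f2 x].
Proof.
move=> [h1 h2 h3]; exists (derive1 (f \o @tproj R)), (derive1 (derive1 (f \o @tproj R))).
split=> [x|x||x k]; rewrite -?derive1E.
- by rewrite derive1E; apply: derivableP; exact: h1.
- by rewrite derive1E; apply: derivableP; exact: h2.
- exact: h3.
have per (g : R -> R) : (forall x : R, g (x + k%:~R) = g x) ->
    forall x : R, derive1 g (x + k%:~R) = derive1 g x.
  move=> gp y; rewrite /derive1; set F := fun h : R => _.
  rewrite (_ : F = fun h : R => h^-1 *: (g (h + y) - g y))//.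
  by apply/funext => t; rewrite /F addrA !gp.
have p1 (y : R) : derive1 (f \o @tproj R) (y + k%:~R) =
    derive1 (f \o @tproj R) y.
  by apply: per => z /=; rewrite tprojDz.
by split; [exact: p1 | exact: (per _ p1)].
Qed.

(** One constant serves all three estimates: the sum of bounds for the lift and its first two
    derivatives, which are finite by periodicity. *)
Lemma torusC2_bound f : torusC2 f -> exists C, [/\ 0 <= C,
  forall x, `|f x| <= C, tlip C f &
  forall m h, `|second_diff f m h| <= C * h ^+ 2].
Proof.
move=> /torusC2_derive[f1 [f2 [d1 d2 c2 per]]].
have [A0 A00 hA0] : exists2 A, 0 <= A &
    forall x : R, `|(f \o @tproj R) x| <= A.
  apply: periodic_bounded; first exact: is_derive1_continuous d1.
  by move=> x k /=; rewrite tprojDz.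
have [A1 A10 hA1] : exists2 A, 0 <= A & forall x : R, `|f1 x| <= A.
  apply: periodic_bounded; first exact: is_derive1_continuous d2.
  by move=> x k; case: (per x k).
have [A2 A20 hA2] : exists2 A, 0 <= A & forall x : R, `|f2 x| <= A.
  by apply: periodic_bounded => // x k; case: (per x k).
exists (A0 + A1 + A2); split; first lra.
- by move=> x; rewrite -(trepK x); have := hA0 (trep x) => /=; lra.
- move=> x y; have [a [b [<- <- ->]]] := tdist_rep x y.
  have := lipschitz_is_derive d1 hA1 a b => /= h; have := normr_ge0 (a - b).
  nra.
move=> m h0; pose h := `|h0|.
have -> : second_diff f m h0 = second_diff f m h.
  rewrite /second_diff /h; have [h1|h1] := leP 0 h0; first by rewrite ger0_norm.
  by rewrite ltr0_norm// opprK [X in _ = X - _]addrC.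
have -> : h0 ^+ 2 = h ^+ 2 by rewrite -normrX ger0_norm ?sqr_ge0.
have h00 : 0 <= h by exact: normr_ge0.
have sd (f' f1' f2' : R -> R) : (forall x : R, is_derive x 1 f' (f1' x)) ->
   (forall x : R, is_derive x 1 f1' (f2' x)) -> (forall x : R, `|f2' x| <= A2) ->
   f' (m + h) + f' (m - h) - 2 * f' m <= (A0 + A1 + A2) * h ^+ 2.
  move=> e1 e2 e3; apply: le_trans (second_difference_le (A := A2) e1 e2 h00 _) _.
    by move=> x _; exact: le_trans (ler_norm _) (e3 x).
  by rewrite ler_wpM2r ?sqr_ge0//; lra.
rewrite ler_norml; apply/andP; split; last exact: sd d1 d2 hA2.
(* The lower bound is the upper bound for [- f]. *)
have /= := sd (- (f \o @tproj R)) (- f1) (- f2)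
  (fun x : R => is_deriveN (d1 x)) (fun x : R => is_deriveN (d2 x)).
rewrite /second_diff /GRing.opp/= => H.
have : forall x : R, `|- f2 x| <= A2 by move=> x; rewrite normrN.
move=> /H; rewrite -!/(GRing.opp _); lra.
Qed.

End torus_lipschitz.

(** * Measurability on the torus and its square *)

Section torus_measurability.
Context {R : realType}.
Local Notation T := (torus R).

Lemma measurable_tcontinuous (f : T -> R) : continuous f ->
  measurable_fun setT f.
Proof.
move=> fc; apply: (measurability _ (RGenOpens.measurableE R)).
move=> _ [_ [a [b ->]] <-]; rewrite setTI.
apply: sub_sigma_algebra.
by move/continuousP: fc; apply; exact: interval_open.
Qed.

(** [trep] jumps only at the class of 0, where it takes the value 0: for c >= 0 the set {trep > c}
    avoids that class and is open, and for c < 0 it is everything. *)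
Lemma measurable_trep : measurable_fun setT (@trep R : T -> R).
Proof.
apply: (measurability _ (RGenOInfty.measurableE R)).
move=> _ [_ [c ->] <-]; rewrite setTI.
have [c0|c0] := leP 0 c; last first.
  rewrite (_ : _ @^-1` _ = setT)//; apply/seteqP; split=> // -[a /= /andP[a0 _]] _.
  by rewrite in_itv/= andbT; exact: lt_le_trans a0.
suff : open (@trep R @^-1` `]c, +oo[) by exact: sub_sigma_algebra.
rewrite openE => x /=; rewrite in_itv/= andbT => cx.
rewrite /interior; apply/nbhs_ballP.
have x1 : trep x < 1 by case: (x) => a /= /andP[].
exists (Num.min (trep x - c) (1 - trep x)) => /=.
  by rewrite lt_min !subr_gt0 cx.
move=> y /tball; rewrite lt_min /= in_itv/= andbT => /andP[].
have : 0 <= trep y by case: (y) => b /= /andP[].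
rewrite /tdist => y0; rewrite !gt_min.
by case: (ler0P (trep x - trep y)) => ? /orP[?|?] /orP[?|?]; lra.
Qed.

(** Fubini and the couplings live on the product sigma-algebra, so measurability is derived
    coordinatewise from [trep] rather than from continuity on T x T. *)
Lemma measurable_tsub : measurable_fun setT (fun z : T * T => z.1 - z.2).
Proof.
under eq_fun do rewrite tsubE.
apply: measurableT_comp; first exact: measurable_tproj.
apply: measurable_funB; apply: measurableT_comp => //; exact: measurable_trep.
Qed.

Lemma measurable_tdist : measurable_fun setT (fun z : T * T => tdist z.1 z.2).
Proof.
have m : measurable_fun setT (fun z : T * T => `|trep z.1 - trep z.2|).
  apply: measurableT_comp => //.
  apply: measurable_funB; apply: measurableT_comp => //; exact: measurable_trep.
by apply: measurable_minr => //; exact: measurable_funB.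
Qed.

Lemma tleb_setT : @tleb R setT = 1%E.
Proof.
rewrite /tleb /pushforward preimage_setT /mrestr setTI.
by rewrite lebesgue_measure_itv/= lte_fin ltr01 oppr0 adde0.
Qed.

End torus_measurability.

(** * Positive signed measures *)

Section bounded_measurable.
Context d (T : measurableType d) {R : realType}.
Implicit Types (f g : T -> R) (m : {finite_measure set T -> \bar R}).

(** A class stable under the operations below and integrable for every finite measure, so that one
    predicate discharges the integrability conditions. *)
Definition bmeas f := measurable_fun setT f /\ exists C, forall x, `|f x| <= C.

Lemma bmeas_integrable_lty (m : {measure set T -> \bar R}) f :
  (m setT < +oo)%E -> bmeas f -> m.-integrable setT (EFin \o f).
Proof.
move=> mT [mf [C hC]]; apply/integrableP; split; first exact/measurable_EFinP.
apply: (@le_lt_trans _ _ (\int[m]_x `|C|%:E)%E).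
  apply: ge0_le_integral => //=.
  - exact/measurable_EFinP/measurableT_comp.
  - by move=> x _; rewrite lee_fin; apply: le_trans (hC x) (ler_norm _).
by rewrite integral_cst// lte_mul_pinfty// lee_fin.
Qed.

Lemma bmeas_integrable m f : bmeas f -> m.-integrable setT (EFin \o f).
Proof.
by apply: bmeas_integrable_lty; rewrite ltey_eq fin_num_measure.
Qed.

Lemma bmeas_cst (r : R) : bmeas (fun _ => r).
Proof. by split=> //; exists `|r|. Qed.

Lemma bmeasD f g : bmeas f -> bmeas g -> bmeas (fun x => f x + g x).
Proof.
move=> [mf [C hC]] [mg [D hD]]; split; first exact: measurable_funD.
by exists (C + D) => x; apply: le_trans (ler_normD _ _) _; exact: lerD.
Qed.

Lemma bmeasM f g : bmeas f -> bmeas g -> bmeas (fun x => f x * g x).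
Proof.
move=> [mf [C hC]] [mg [D hD]]; split; first exact: measurable_funM.
by exists (C * D) => x; rewrite normrM ler_pM.
Qed.

Lemma bmeasN f : bmeas f -> bmeas (fun x => - f x).
Proof.
move=> [mf [C hC]]; split; first exact: measurable_funN.
by exists C => x; rewrite normrN.
Qed.

Lemma bmeas_norm f : bmeas f -> bmeas (fun x => `|f x|).
Proof.
move=> [mf [C hC]]; split; first exact: measurableT_comp.
by exists C => x; rewrite normr_id.
Qed.

Lemma Rintegral_mscale m (k : {nonneg R}) f : bmeas f ->
  \int[mscale k m]_x f x = k%:num * \int[m]_x f x.
Proof.
move=> bf; have fi := bmeas_integrable m bf; have [mf _] := bf.
have mEf : measurable_fun setT (EFin \o f) by exact/measurable_EFinP.
rewrite /Rintegral integralE ge0_integral_mscale//; last first.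
  exact: measurable_funepos.
rewrite ge0_integral_mscale//; last exact: measurable_funeneg.
have fp : (\int[m]_x ((fun t => (f t)%:E)^\+)%E x \is a fin_num)%E.
  exact: integrable_pos_fin_num.
have fn : (\int[m]_x ((fun t => (f t)%:E)^\-)%E x \is a fin_num)%E.
  exact: integrable_neg_fin_num.
rewrite [in RHS]integralE fineB//; last 2 first.
- by rewrite fin_numM.
- by rewrite fin_numM.
by rewrite -(fineK fp) -(fineK fn)/= mulrBr.
Qed.

Lemma Rintegral_measure_add (m1 m2 : {finite_measure set T -> \bar R}) f :
  bmeas f ->
  \int[measure_add m1 m2]_x f x = \int[m1]_x f x + \int[m2]_x f x.
Proof.
move=> bf; have [mf _] := bf.
rewrite /Rintegral integral_measure_add//; last 2 first.
- exact: bmeas_integrable.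
- exact: bmeas_integrable.
by rewrite fineD//; apply: integrable_fin_num => //; exact: bmeas_integrable.
Qed.

End bounded_measurable.

Section positive_signed_measure.
Context d (T : measurableType d) {R : realType}.
Local Notation M := (signed_measure T R).
Implicit Types (mu nu : M) (f g : T -> R) (A : set T).

(** The negative set of any Hahn decomposition is null for a positive charge. On non-measurable sets
    both sides are 0 by convention. *)
Lemma jordan_pos_smpositive mu A : smpositive mu ->
  jordan_pos (hahnP mu) A = mu A.
Proof.
move=> mu0; have [mA|nA] := pselect (measurable A); last first.
  by rewrite jordan_posE cjordan_posE /crestr0 memNset// smcharge_out.
have [[mP _] [mN hN] PN PN0] := hahnP mu.
have muN : mu (A `&` (projT1 (cid (hahn_subproof mu))).2) = 0%E.
  by apply/le_anti; rewrite mu0 andbT; apply: hN => //; exact: measurableI.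
rewrite jordan_posE cjordan_posE /crestr0 mem_set//= /crestr.
rewrite -[in RHS](setIT A) -PN setIUr chargeU//.
- by rewrite muN adde0.
- exact: measurableI.
- exact: measurableI.
- by rewrite setIACA PN0 setI0.
Qed.

Lemma jordan_neg_smpositive mu A : smpositive mu ->
  jordan_neg (hahnP mu) A = 0%E.
Proof.
move=> mu0; rewrite jordan_negE cjordan_negE /crestr0.
case: ifPn; rewrite ?oppe0// inE => mA.
have [_ [mN hN] _ _] := hahnP mu; rewrite /crestr.
rewrite (_ : mu _ = 0%E) ?oppe0//.
by apply/le_anti; rewrite mu0 andbT; apply: hN => //; exact: measurableI.
Qed.

Lemma smint_pos mu f : smpositive mu ->
  smint mu f = \int[jordan_pos (hahnP mu)]_x f x.
Proof.
move=> mu0; rewrite /smint [X in _ - X](_ : _ = 0) ?subr0//.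
rewrite /Rintegral (@eq_measure_integral _ _ _ _ mzero) ?integral_measure_zero//.
by move=> A _ _; exact: jordan_neg_smpositive.
Qed.

(** Linearity of [smint] in the measure is derived for positive measures, where [Greg] can be
    finite: [mu] is replaced by any measure with the same values, such as a sum, a multiple or a
    pushforward. *)
Lemma smint_measureE (m : {measure set T -> \bar R}) mu f : smpositive mu ->
  (forall A, measurable A -> mu A = m A) -> smint mu f = \int[m]_x f x.
Proof.
move=> mu0 mum; rewrite smint_pos// /Rintegral.
rewrite (@eq_measure_integral _ _ _ _ m)// => A mA _.
by rewrite -mum//; exact: jordan_pos_smpositive.
Qed.

Lemma tvnorm_pos mu : smpositive mu -> tvnorm mu = fine (mu setT).
Proof.
move=> mu0; rewrite /tvnorm /charge_variation.
by rewrite jordan_pos_smpositive// jordan_neg_smpositive// adde0.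
Qed.

Lemma smpositiveD mu nu : smpositive mu -> smpositive nu ->
  smpositive (mu + nu).
Proof. by move=> mu0 nu0 A; exact: adde_ge0. Qed.

Lemma smpositiveZ (a : R) mu : 0 <= a -> smpositive mu -> smpositive (a *: mu).
Proof. by move=> a0 mu0 A; exact: mule_ge0. Qed.

Lemma smpositive0 : smpositive (0 : M).
Proof. by move=> A; exact: lexx. Qed.

Lemma smpositive_sum (I : Type) (r : seq I) (F : I -> M) :
  (forall i, smpositive (F i)) -> smpositive (\sum_(i <- r) F i).
Proof.
by move=> F0; elim/big_ind: _ => // x y; exact: smpositiveD.
Qed.

Lemma smint0 f : smint (0 : M) f = 0.
Proof.
rewrite (@smint_measureE mzero)// /Rintegral ?integral_measure_zero//.
Qed.

Lemma smintD mu nu f : smpositive mu -> smpositive nu -> bmeas f ->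
  smint (mu + nu) f = smint mu f + smint nu f.
Proof.
move=> mu0 nu0 bf; rewrite (smint_pos _ mu0) (smint_pos _ nu0).
rewrite -Rintegral_measure_add//; apply: smint_measureE.
  exact: smpositiveD.
move=> A mA; rewrite [RHS]measure_addE; congr (_ + _)%E;
  exact/esym/jordan_pos_smpositive.
Qed.

Lemma smintZ (a : R) mu f : 0 <= a -> smpositive mu -> bmeas f ->
  smint (a *: mu) f = a * smint mu f.
Proof.
move=> a0 mu0 bf; rewrite (smint_pos _ mu0).
rewrite -(Rintegral_mscale _ (NngNum a0))//; apply: smint_measureE.
  exact: smpositiveZ.
by move=> A mA; rewrite /mscale/=; congr (_ * _)%E;
  exact/esym/jordan_pos_smpositive.
Qed.

Lemma smint_sum (I : Type) (r : seq I) (F : I -> M) f :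
  (forall i, smpositive (F i)) -> bmeas f ->
  smint (\sum_(i <- r) F i) f = \sum_(i <- r) smint (F i) f.
Proof.
move=> F0 bf; elim: r => [|i r ih]; first by rewrite !big_nil smint0.
by rewrite !big_cons smintD// ?ih//; exact: smpositive_sum.
Qed.

Lemma smdiracE (x : T) A : measurable A -> smdirac R x A = \d_x A.
Proof.
by move=> mA; rewrite /smdirac /= /crestr0 mem_set// /crestr setIT.
Qed.

Lemma smdirac_pos (x : T) : smpositive (smdirac R x).
Proof.
move=> A; have [mA|nA] := pselect (measurable A); first by rewrite smdiracE.
by rewrite smcharge_out.
Qed.

Lemma smint_dirac (x : T) f : measurable_fun setT f -> smint (smdirac R x) f = f x.
Proof.
move=> mf; rewrite (@smint_measureE (dirac x))//.
- by rewrite /Rintegral integral_dirac ?diracT ?mul1e//; exact/measurable_EFinP.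
- exact: smdirac_pos.
- by move=> A mA; exact: smdiracE.
Qed.

Lemma smintDr mu f g : smpositive mu -> bmeas f -> bmeas g ->
  smint mu (fun x => f x + g x) = smint mu f + smint mu g.
Proof.
by move=> mu0 bf bg; rewrite !smint_pos// RintegralD//; exact: bmeas_integrable.
Qed.

Lemma smintZr mu f (r : R) : smpositive mu -> bmeas f ->
  smint mu (fun x => r * f x) = r * smint mu f.
Proof.
by move=> mu0 bf; rewrite !smint_pos// RintegralZl//; exact: bmeas_integrable.
Qed.

End positive_signed_measure.

Section torus_measure_uniqueness.
Context {R : realType}.
Local Notation T := (torus R).
Local Notation M := (signed_measure T R).

Lemma tcontinuous_bmeas (f : T -> R) : continuous f -> bmeas f.
Proof.
move=> fc; split; first exact: measurable_tcontinuous.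
by have [C _ hC] := tcontinuous_bounded fc; exists C.
Qed.

Lemma tlip_bmeas L (f : T -> R) : tlip L f -> bmeas f.
Proof. by move=> /tlip_continuous; exact: tcontinuous_bmeas. Qed.

Definition tdistset (A : set T) (x : T) : R := inf [set tdist x y | y in A].

Lemma tdistset_lip A : A !=set0 -> tlip 1 (tdistset A).
Proof.
move=> [a0 Aa0] x y; rewrite mul1r.
have P z : has_lbound [set tdist z y | y in A].
  by exists 0 => _ [t _ <-]; exact: tdist_ge0.
have key u v : tdistset A u <= tdist u v + tdistset A v.
  rewrite -lerBlDl; apply: lb_le_inf; first by exists (tdist v a0); exists a0.
  move=> _ [t At <-]; rewrite lerBlDl; apply: le_trans (tdist_triangle v _ _).
  by apply: ge_inf => //; exists t.
rewrite ler_distl; apply/andP; split; last first.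
  by rewrite addrC; exact: key.
by rewrite lerBlDl tdist_sym; exact: key.
Qed.

(* The distance to the complement of an open set, scaled and cut off at
   height 1, increases to the indicator function. *)
Definition tbump (U : set T) (n : nat) (x : T) : R :=
  Num.min 1 (n%:R * tdistset (~` U) x).

Lemma tbump_lip U n : ~` U !=set0 -> tlip n%:R (tbump U n).
Proof.
move=> /tdistset_lip dl x y; rewrite /tbump.
have mm (a b : R) : `|Num.min 1 a - Num.min 1 b| <= `|a - b|.
  by case: (leP 1 a) => ?; case: (leP 1 b) => ?; case: (ler0P (a - b)) => ?;
    rewrite ?ler_norml ?lexx//; try (apply/andP; split); lra.
apply: le_trans (mm _ _) _; rewrite -mulrBr normrM ger0_norm//.
by rewrite ler_wpM2l//; have := dl x y; rewrite mul1r.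
Qed.

Lemma tbump_cvg (mu : M) U : smpositive mu -> open U -> ~` U !=set0 ->
  ((smint mu (tbump U n))%:E @[n --> \oo] --> mu U)%E.
Proof.
move=> mu0 oU U0.
have mU : measurable U by exact: sub_sigma_algebra.
have d0 x : 0 <= tdistset (~` U) x.
  case: U0 => y0 Uy0; apply: lb_le_inf; first by exists (tdist x y0); exists y0.
  by move=> _ [t _ <-]; exact: tdist_ge0.
have mb n : measurable_fun setT (tbump U n).
  exact: (measurable_tcontinuous (tlip_continuous (tbump_lip n U0))).
set m := jordan_pos (hahnP mu).
have := @dominated_convergence _ _ _ m setT measurableT
  (fun n x => (tbump U n x)%:E) (fun x => (\1_U x)%:E) (cst 1%E).
case.
- by move=> n; exact/measurable_EFinP.
- exact/measurable_EFinP.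
(* The bumps are eventually constant at each point: 0 outside [U], and 1 in [U] once n e >= 1 for a
   ball of radius [e] inside [U]. *)
- apply: aeW => x _; apply: cvg_near_cst.
  have [Ux|Ux] := pselect (U x); last first.
    near=> n; rewrite indicE memNset// /tbump (_ : tdistset _ _ = 0).
      by rewrite mulr0 min_r.
    apply/le_anti; rewrite d0 andbT -(tdistxx x).
    apply: ge_inf; last by exists x.
    by exists 0 => _ [t _ <-]; exact: tdist_ge0.
  have /nbhs_ballP[e /= e0 eU] : nbhs x U by exact: open_nbhs_nbhs.
  have ed : e <= tdistset (~` U) x.
    case: U0 => y0 Uy0; apply: lb_le_inf; first by exists (tdist x y0); exists y0.
    move=> _ [t nUt <-]; rewrite leNgt; apply/negP => te; apply: nUt.
    by apply: eU; exact/tball.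
  near=> n; rewrite indicE mem_set// /tbump min_l//.
  have : 1 <= n%:R * e.
    rewrite -ler_pdivrMr// div1r; apply: le_trans (ltW (truncnS_gt _)) _.
    by rewrite ler_nat; near: n; exact: nbhs_infty_ge.
  by move=> h; apply: le_trans h _; rewrite ler_wpM2l.
- exact: finite_measure_integrable_cst.
- apply: aeW => x n _ /=; rewrite lee_fin ger0_norm.
    by rewrite /tbump ge_min lexx.
  by rewrite /tbump le_min ler01 mulr_ge0.
move=> _ _ /=; rewrite integral_indic// setIT.
have e1 : m U = mu U := jordan_pos_smpositive U mu0.
rewrite -e1 => h; rewrite (_ : (fun n => (smint mu (tbump U n))%:E) =
  (fun n => \int[m]_x (tbump U n x)%:E)%E)//.
apply/funext => n; rewrite smint_pos// /Rintegral fineK//.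
apply: integrable_fin_num => //; apply: bmeas_integrable.
exact: (tlip_bmeas (tbump_lip _ U0)).
Unshelve. all: by end_near. Qed.

(** Open sets form a generating pi-system. Lipschitz bumps recover the mass of each open set with
    nonempty complement, and the constant 1 gives the total mass. *)
Lemma smpositive_eq (mu nu : M) : smpositive mu -> smpositive nu ->
  (forall L (f : T -> R), tlip L f -> smint mu f = smint nu f) -> mu = nu.
Proof.
move=> mu0 nu0 H; apply: signed_measure_eqP => A.
have [mA|nA] := pselect (measurable A); last by rewrite !smcharge_out.
have HT : mu setT = nu setT.
  have h0 : tlip 0 (fun _ : T => 1 : R) by move=> x y; rewrite subrr normr0 mul0r.
  have := H _ _ h0; rewrite !smint_pos// /Rintegral !integral_cst// !mul1e.
  move=> h; have {}h : fine (mu setT) = fine (nu setT).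
    by rewrite -(jordan_pos_smpositive setT mu0) -(jordan_pos_smpositive setT nu0).
  by rewrite -(fineK (sm_fin_num mu _)) -(fineK (sm_fin_num nu _)) h.
rewrite -(jordan_pos_smpositive _ mu0) -(jordan_pos_smpositive _ nu0).
apply: (@measure_unique _ _ _ (@open T) (fun=> setT)) => //.
- exact: openI.
- by move=> _; exact: openT.
- by rewrite bigcup_const//; exists 0%N.
- move=> U oU; rewrite /= !jordan_pos_smpositive//.
  have [U0|/set0P U0] := eqVneq (~` U) set0.
    by rewrite -(setCK U) U0 setC0.
  have h1 := tbump_cvg mu0 oU U0; have h2 := tbump_cvg nu0 oU U0.
  have e : (fun n => (smint mu (tbump U n))%:E) =
      (fun n => (smint nu (tbump U n))%:E).
    by apply/funext => n; rewrite (H _ _ (tbump_lip n U0)).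
  by rewrite e in h1; exact: (cvg_unique _ h1 h2).
- by move=> _; rewrite ltey_eq fin_num_measure.
Qed.

End torus_measure_uniqueness.

(** * Completeness of L2 *)

Section L2_space.
Context d (T : measurableType d) {R : realType}.
Variable m : {measure set T -> \bar R}.
Hypothesis m1 : m setT = 1%E.

Let p12 : (1 <= 2%:E :> \bar R)%E.
Proof. by rewrite lee1n. Qed.

Definition L2 := LfunType m p12.
Implicit Types f g h : L2.

Lemma L2_measurable f : measurable_fun setT (f : T -> R).
Proof. by have := LfunP f => /andP[]; rewrite inE. Qed.

Lemma L2_mul_integrable f g : m.-integrable setT (EFin \o (fun x => f x * g x)).
Proof. exact/Lfun1_integrable/(Lfun2_mul_Lfun1 (LfunP f) (LfunP g)). Qed.

Lemma Lfun2_intro (f : T -> R) : measurable_fun setT f ->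
  (\int[m]_x (f x ^+ 2)%:E < +oo)%E -> f \in Lfun m 2%:E.
Proof.
move=> mf h; rewrite inE; apply/andP; split; first by rewrite inE.
rewrite inE/= /finite_norm unlock; apply: poweR_lty.
apply: le_lt_trans h; rewrite le_eqVlt; apply/orP; left; apply/eqP.
by apply: eq_integral => x _ /=; rewrite powR_mulrn// real_normK ?num_real.
Qed.

Lemma L2_bmeas (f : T -> R) : bmeas f -> f \in Lfun m 2%:E.
Proof.
move=> [mf [C hC]]; apply: Lfun2_intro => //.
apply: (@le_lt_trans _ _ (\int[m]_x (C ^+ 2)%:E)%E).
  apply: ge0_le_integral => //.
  - by move=> x _; rewrite lee_fin sqr_ge0.
  - by apply/measurable_EFinP; exact: measurable_funX.
  - by move=> x _; rewrite lee_fin -real_normK ?num_real// lerXn2r ?nnegrE//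
      (le_trans _ (hC x)).
by rewrite integral_cst// m1 mule1 ltry.
Qed.

Definition L2dot f g : R := \int[m]_x (f x * g x).

Fact L2dotC f g : L2dot f g = L2dot g f.
Proof. by apply: eq_Rintegral => x _; rewrite mulrC. Qed.

Fact L2dotDl f g h : L2dot (f + g) h = L2dot f h + L2dot g h.
Proof.
rewrite /L2dot -RintegralD//; try exact: L2_mul_integrable.
by apply: eq_Rintegral => x _; rewrite -mulrDl.
Qed.

Fact L2dotZl (a : R) f g : L2dot (a *: f) g = a * L2dot f g.
Proof.
rewrite /L2dot -RintegralZl//; try exact: L2_mul_integrable.
by apply: eq_Rintegral => x _; rewrite mulrA.
Qed.

Fact L2dot_ge0 f : 0 <= L2dot f f.
Proof. by apply: Rintegral_ge0 => x _; rewrite -expr2 sqr_ge0. Qed.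

Definition L2inner := SemiInner L2dotC L2dotDl L2dotZl L2dot_ge0.

Lemma integral_sqr f : (\int[m]_x (f x ^+ 2)%:E = (nrm L2inner f ^+ 2)%:E)%E.
Proof.
rewrite sqr_nrm /= /L2dot /Rintegral fineK//.
exact: integrable_fin_num (L2_mul_integrable f f).
Qed.

Definition L2one : L2 := Lfun_Sub p12 (L2_bmeas (@bmeas_cst _ T R 1)).

Fact L2abs_subproof f : (fun x => `|f x|) \in Lfun m 2%:E.
Proof.
apply: Lfun2_intro; first exact/measurableT_comp/L2_measurable.
under eq_integral do rewrite real_normK ?num_real//.
by rewrite integral_sqr ltry.
Qed.

Definition L2abs f : L2 := Lfun_Sub p12 (L2abs_subproof f).

Lemma L1_le_L2 f : \int[m]_x `|f x| <= nrm L2inner f.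
Proof.
have -> : \int[m]_x `|f x| = L2inner (L2abs f) L2one.
  by apply: eq_Rintegral => x _ /=; rewrite mulr1.
apply: le_trans (dot_le _ _ _) _.
have -> : nrm L2inner L2one = 1.
  rewrite /nrm (_ : L2inner _ _ = 1) ?sqrtr1//.
  transitivity (\int[m]_x (1 : R)).
    by apply: eq_Rintegral => x _ /=; rewrite mulr1.
  by rewrite /Rintegral integral_cst// m1 mul1e.
rewrite mulr1 /nrm /= /L2dot le_eqVlt; apply/orP; left; apply/eqP.
congr Num.sqrt.
by apply: eq_Rintegral => x _ /=; rewrite -!expr2 real_normK ?num_real.
Qed.

Lemma L2_integrable f : m.-integrable setT (EFin \o f).
Proof.
have := L2_mul_integrable f L2one.
by apply: eq_integrable => // x _ /=; rewrite mulr1.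
Qed.

Lemma integral_abs_le f :
  (\int[m]_x (`|f x|)%:E <= (nrm L2inner f)%:E)%E.
Proof.
have := L1_le_L2 f; rewrite -lee_fin /Rintegral fineK//.
exact: integrable_fin_num (L2_integrable (L2abs f)).
Qed.

(** Riesz-Fischer: the sum of the |v_(k+1) - v_k| has finite integral, so it is finite on a set [E]
    of full measure, where the telescoping series converges absolutely. *)
Lemma L2_cauchy_subseq_ae (v : nat -> L2) :
  (forall k, nrm L2inner (v k.+1 - v k) <= (2 ^ k.+1)%:R^-1) ->
  exists E (f : T -> R), [/\ measurable E, m (~` E) = 0%E,
    measurable_fun setT f & forall x, E x -> v k x @[k --> \oo] --> f x].
Proof.
move=> hv; pose g k x := (`|v k.+1 x - v k x|)%:E.
have mg k : measurable_fun setT (g k).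
  apply/measurable_EFinP/measurableT_comp => //.
  by apply: measurable_funB; exact: L2_measurable.
have g0 k x : setT x -> (0 <= g k x)%E by rewrite lee_fin.
pose G x := (\sum_(0 <= k <oo) g k x)%E.
have mG : measurable_fun setT G.
  exact: (@ge0_emeasurable_sum _ _ _ setT g xpredT
    (fun k x Tx _ => g0 k x Tx) (fun k _ => mg k)).
have iG : (\int[m]_x G x < +oo)%E.
  rewrite integral_nneseries//.
  apply: (@le_lt_trans _ _ (\sum_(0 <= k <oo) (1 / (2 ^ k.+1)%:R)%:E)%E).
    apply: lee_nneseries => [k _ _|k _].
      by apply: integral_ge0 => x _; exact: g0.
    rewrite div1r; apply: le_trans (integral_abs_le (v k.+1 - v k)) _.
    by rewrite lee_fin.
  apply: le_lt_trans (epsilon_trick0 xpredT ler01) _.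
  exact: ltry.
have G0 x : (0 <= G x)%E by apply: nneseries_ge0 => k _ _; exact: g0.
have GI : m.-integrable setT G.
  apply/integrableP; split=> //.
  by under eq_integral do rewrite gee0_abs//.
pose E := [set x | (G x < +oo)%E].
have mE : measurable E.
  rewrite -[E]setTI; exact: emeasurable_fun_infty_o.
(* Multiplication by the indicator of [E] makes the sequence converge everywhere, so that [f] is
   measurable as a pointwise limit. *)
pose f x := lim ((v k x * \1_E x : R) @[k --> \oo]).
have vf x : (v k x * \1_E x : R) @[k --> \oo] --> f x.
  rewrite /f; apply/cvg_ex.
  have [Ex|nEx] := pselect (E x); last first.
    by exists 0; rewrite indicE memNset//; under eq_fun do rewrite mulr0;
      exact: cvg_cst.
  apply/cvg_ex; rewrite indicE mem_set//; under eq_fun do rewrite mulr1.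
  have -> : (fun k => v k x) =
      (fun k => v 0%N x + series (telescope (fun k => v k x : R)) k).
    by apply/funext => k; exact: (eq_sum_telescope (fun k => v k x : R)).
  apply: is_cvgD; first exact: is_cvg_cst.
  apply: normed_cvg; apply: nondecreasing_is_cvgn.
    apply/nondecreasing_seqP => k.
    by rewrite [leRHS]seriesSr lerDl /= normr_ge0.
  exists (fine (G x)) => _ [k _ <-].
  rewrite -lee_fin fineK; last by rewrite ge0_fin_numE.
  rewrite /series/= -sumEFin; apply: (nneseries_lim_ge k) => i _ _.
  exact: g0.
exists E, f; split=> //.
- have : {ae m, forall x, setT x -> G x \is a fin_num} by exact: integrable_ae.
  case=> N [mN N0 hN]; apply/eqP; rewrite eq_le measure_ge0 andbT -N0.
  apply: le_measure; rewrite ?inE//; first exact: measurableC.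
  move=> x nEx; apply: hN => /= h; apply: nEx.
  by rewrite /E/= -ge0_fin_numE//; exact: h.
- apply: (@measurable_fun_cvg _ _ _ setT (fun k x => v k x * \1_E x : R)).
    move=> k; apply: measurable_funM; first exact: L2_measurable.
    exact: measurable_indic.
  by move=> x _; exact: vf.
- move=> x Ex; have := vf x; rewrite indicE mem_set//.
  by under eq_fun do rewrite mulr1.
Qed.

Lemma L2_fatou E (v : nat -> L2) (f : T -> R) (g : L2) (c : R) :
  measurable E -> m (~` E) = 0%E -> measurable_fun setT f ->
  (forall x, E x -> v k x @[k --> \oo] --> f x) ->
  (forall k, nrm L2inner (g - v k) <= c) ->
  (\int[m]_x ((g x - f x) ^+ 2)%:E <= (c ^+ 2)%:E)%E.
Proof.
move=> mE E0 mf vf gv.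
have mgf : measurable_fun setT (fun x => ((g x - f x) ^+ 2)%:E).
  exact/measurable_EFinP/measurable_funX/measurable_funB.
have mgv k : measurable_fun setT (fun x => ((g x - v k x) ^+ 2)%:E).
  by apply/measurable_EFinP/measurable_funX/measurable_funB; exact: L2_measurable.
have -> : (\int[m]_x ((g x - f x) ^+ 2)%:E =
    \int[m]_(x in E) ((g x - f x) ^+ 2)%:E)%E.
  rewrite -(setvU E) setUC ge0_integral_setU//=; last 4 first.
  - exact: measurableC.
  - by rewrite setUv.
  - by move=> x _; rewrite lee_fin sqr_ge0.
  - by rewrite /disj_set setICr.
  rewrite [X in (_ + X)%E](_ : _ = 0%E) ?adde0//.
  apply: null_set_integral => //; first exact: measurableC.
  exact: measurable_funTS.
have -> : (\int[m]_(x in E) ((g x - f x) ^+ 2)%:E =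
    \int[m]_(x in E) limn_einf (fun k => ((g x - v k x) ^+ 2)%:E))%E.
  apply: eq_integral => x; rewrite inE => Ex.
  apply/esym; apply: (cvg_limn_einf_sup _).1.
  apply: cvg_EFin; first exact: nearW.
  have h : g x - v k x @[k --> \oo] --> g x - f x.
    by apply: cvgB; [exact: cvg_cst | exact: vf].
  by under eq_fun do rewrite /= expr2; rewrite expr2; exact: cvgM.
apply: le_trans (fatou _ mE _ _) _.
- by move=> k; exact: measurable_funTS.
- by move=> k x _; rewrite lee_fin sqr_ge0.
rewrite limn_einf_lim; apply: lime_le; first exact: is_cvg_einfs.
apply: nearW => k; apply: (@le_trans _ _
    (\int[m]_(x in E) ((g x - v k x) ^+ 2)%:E)%E).
  by apply: ereal_inf_lbound; exists k => /=.
apply: (@le_trans _ _ (\int[m]_x ((g x - v k x) ^+ 2)%:E)%E).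
  apply: ge0_subset_integral => //.
  by move=> x _; rewrite lee_fin sqr_ge0.
rewrite (integral_sqr (g - v k)) lee_fin.
by rewrite lerXn2r ?nnegrE ?nrm_ge0//; apply: le_trans (gv k); exact: nrm_ge0.
Qed.

Lemma L2_complete : nrm_complete L2inner.
Proof.
move=> u cu.
have /choice[N hN] : forall k : nat, exists N, forall i j, (N <= i)%N ->
    (N <= j)%N -> nrm L2inner (u i - u j) <= (2 ^ k.+1)%:R^-1.
  by move=> k; apply: cu; rewrite invr_gt0 ltr0n expn_gt0.
(* These partial sums are nondecreasing and dominate both [N k] and [k]. *)
pose M k := (\sum_(i < k.+1) (N i).+1)%N.
have NM k : (N k <= M k)%N by rewrite /M big_ord_recr/= addnS ltnW// ltnS leq_addl.
have Mm k l : (k <= l)%N -> (M k <= M l)%N.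
  move=> kl; rewrite -(subnK kl); elim: (l - k)%N => [//|i ih].
  by apply: (leq_trans ih); rewrite addSn /M [in leqRHS]big_ord_recr leq_addr.
pose v k := u (M k).
have hv k : nrm L2inner (v k.+1 - v k) <= (2 ^ k.+1)%:R^-1.
  by apply: hN => //; apply: leq_trans (NM k) _; exact: Mm.
have [E [f [mE E0 mf vf]]] := L2_cauchy_subseq_ae hv.
have ufle e : 0 < e -> exists K, forall k, (K <= k)%N ->
    (\int[m]_x ((u k x - f x) ^+ 2)%:E <= (e ^+ 2)%:E)%E.
  move=> e0; have [K hK] := cu _ e0.
  have hk1 k : (K <= k)%N -> (K <= M k)%N.
    move=> Kk; apply: leq_trans Kk _; elim: k => // k ih.
    by rewrite /M big_ord_recr/= addnS ltnS; apply: leq_trans ih (leq_addr _ _).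
  exists K => k Kk.
  apply: (@L2_fatou E (fun i => v (i + K)%N)) => //.
    by move=> x Ex; have := vf x Ex; rewrite -(cvg_shiftn K).
  by move=> i; apply: hK => //; apply: hk1; exact: leq_addl.
have fL : f \in Lfun m 2%:E.
  have [K hK] := ufle 1 ltr01.
  have h : (fun x => u K x - f x) \in Lfun m 2%:E.
    apply: Lfun2_intro.
      by apply: measurable_funB => //; exact: L2_measurable.
    by apply: le_lt_trans (hK _ (leqnn _)) _; rewrite ltry.
  rewrite (_ : f = u K - Lfun_Sub p12 h); first exact: LfunP.
  by apply/funext => x /=; rewrite [RHS]/= opprB addrC subrK.
exists (Lfun_Sub p12 fL) => e e0; have [K hK] := ufle e e0.
exists K => k Kk; rewrite -(@ler_pXn2r _ 2)// ?nnegrE ?nrm_ge0 ?(ltW e0)//.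
by rewrite -lee_fin -integral_sqr; exact: hK.
Qed.

End L2_space.

(** * Convolution kernels *)

Section torus_L2.
Context {R : realType}.
Local Notation T := (torus R).
Local Notation M := (signed_measure T R).

Fact tleb_finite : fin_num_fun (@tleb R).
Proof.
have h : (@tleb R setT < +oo)%E by rewrite tleb_setT ltry.
exact: lty_fin_num_fun.
Qed.

HB.instance Definition _ := @Measure_isFinite.Build _ T R (@tleb R) tleb_finite.

Definition tL2 := L2 (@tleb R).
Definition tL2inner : semi_inner tL2 := L2inner (@tleb R).
Implicit Types (f g : tL2) (k : T -> R) (mu : M) (C A : R).

(** The default 0 only makes [toL] total; its value is computed for square-integrable functions
    alone. *)
Definition toL (a : T -> R) : tL2 :=
  if pselect (a \in Lfun (@tleb R) 2%:E) is left h then Lfun_Sub _ h else 0.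

Lemma toLK (a : T -> R) : a \in Lfun (@tleb R) 2%:E -> toL a = a :> (T -> R).
Proof. by rewrite /toL; case: pselect. Qed.

Lemma toL_bmeas (a : T -> R) : bmeas a -> toL a = a :> (T -> R).
Proof. by move=> ba; apply: toLK; apply: L2_bmeas => //; exact: tleb_setT. Qed.

Lemma nrm_le_sup f A : 0 <= A -> (forall x, `|f x| <= A) -> nrm tL2inner f <= A.
Proof.
move=> A0 fA; rewrite -(@ler_pXn2r _ 2)// ?nnegrE ?nrm_ge0//.
rewrite -lee_fin -integral_sqr -[leRHS]mule1 -(@tleb_setT R).
rewrite -integral_cst//; apply: ge0_le_integral => //.
- by move=> x _; rewrite lee_fin sqr_ge0.
- by apply/measurable_EFinP/measurable_funX/L2_measurable.
- by move=> x _; rewrite lee_fin -[leLHS]ger0_norm ?sqr_ge0// normrX lerXn2r ?nnegrE.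
Qed.

Lemma tlip_sub C k s : tlip C k -> 0 <= C -> tlip C (fun x => k (x - s)).
Proof.
move=> kC C0 x y; apply: le_trans (kC _ _) _.
by rewrite ler_wpM2l// tdist_sub2r.
Qed.

Lemma tlip_subl C k s : tlip C k -> 0 <= C -> tlip C (fun x => k (s - x)).
Proof.
move=> kC C0 x y; apply: le_trans (kC _ _) _.
by rewrite ler_wpM2l// tdist_sub2l.
Qed.

Definition kernL k s : tL2 := toL (fun x => k (s - x)).
Definition kpre k f s : R := \int[@tleb R]_x (k (s - x) * f x).
Definition kconv k mu s : R := smint mu (fun x => k (x - s)).

Lemma kernLE C k s : tlip C k -> 0 <= C -> kernL k s = (fun x => k (s - x)) :> (T -> R).
Proof. by move=> kC C0; apply: toL_bmeas; apply: tlip_bmeas; exact: tlip_subl kC C0. Qed.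

Lemma kernLEx C k s x : tlip C k -> 0 <= C -> kernL k s x = k (s - x).
Proof. by move=> kC C0; rewrite (kernLE s kC C0). Qed.

(** Reading the convolution as a scalar product with a translated kernel lets Cauchy-Schwarz give
    the bounds below for [f] merely in L^2. *)
Lemma kpreE C k f s : tlip C k -> 0 <= C -> kpre k f s = tL2inner (kernL k s) f.
Proof.
by move=> kC C0; apply: eq_Rintegral => x _; rewrite (kernLE s kC C0).
Qed.

Lemma kernL_lip C k s t : tlip C k -> 0 <= C ->
  nrm tL2inner (kernL k s - kernL k t) <= C * tdist s t.
Proof.
move=> kC C0; apply: nrm_le_sup; first by rewrite mulr_ge0// tdist_ge0.
move=> x; rewrite [X in `|X|](_ : _ = k (s - x) - k (t - x)).
  exact: tlip_sub kC C0 _ _.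
by rewrite -(kernLEx s x kC C0) -(kernLEx t x kC C0).
Qed.

Lemma kpre_lip C k f : tlip C k -> 0 <= C ->
  tlip (C * nrm tL2inner f) (kpre k f).
Proof.
move=> kC C0 s t; rewrite !(kpreE _ _ kC C0) -dotNl -dotDl.
apply: le_trans (dot_cauchy _ _ _) _; rewrite mulrAC ler_wpM2r ?nrm_ge0//.
exact: kernL_lip.
Qed.

Lemma kpre_bound C A k f s : tlip C k -> 0 <= C -> (forall x, `|k x| <= A) ->
  `|kpre k f s| <= A * nrm tL2inner f.
Proof.
move=> kC C0 kA; rewrite (kpreE _ _ kC C0).
apply: le_trans (dot_cauchy _ _ _) _; rewrite ler_wpM2r ?nrm_ge0//.
apply: nrm_le_sup => [|x]; first exact: le_trans (kA 0).
by rewrite (kernLE s kC C0).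
Qed.

Lemma kpre_second_diff C A k f m h : tlip C k -> 0 <= C -> 0 <= A ->
  (forall m, `|second_diff k m h| <= A) ->
  `|second_diff (kpre k f) m h| <= A * nrm tL2inner f.
Proof.
move=> kC C0 A0 kA; rewrite /second_diff !(kpreE _ _ kC C0).
rewrite -dotZl -dotNl -!dotDl.
apply: le_trans (dot_cauchy _ _ _) _; rewrite ler_wpM2r ?nrm_ge0//.
apply: nrm_le_sup => [//|x]; have := kA (m - trep x).
rewrite (_ : second_diff k _ h = kernL k (tproj (m + h)) x +
  kernL k (tproj (m - h)) x - 2 * kernL k (tproj m) x) => [//|].
rewrite !(kernLEx _ _ kC C0).
rewrite /second_diff -(trepK x) !tproj_sub trepK.
by congr (k (tproj _) + k (tproj _) - _); ring.
Qed.

Lemma kpreB k f g s C : tlip C k -> 0 <= C ->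
  kpre k (f - g) s = kpre k f s - kpre k g s.
Proof. by move=> kC C0; rewrite !(kpreE _ _ kC C0) dotDr dotNr. Qed.

Lemma kconv_bmeas C k mu : tlip C k -> 0 <= C -> smpositive mu ->
  bmeas (kconv k mu).
Proof.
move=> kC C0 mu0; set m := jordan_pos (hahnP mu).
have bk s : bmeas (fun x : T => k (x - s)) by apply: tlip_bmeas; exact: tlip_sub kC C0.
have fm : m setT \is a fin_num by rewrite fin_num_measure.
apply: (@tlip_bmeas _ (C * fine (m setT))) => s t.
rewrite /kconv !smint_pos// -RintegralB//; try exact: bmeas_integrable.
have bks : bmeas (fun x : T => k (x - s) - k (x - t)) by apply: bmeasD => //; exact: bmeasN.
apply: le_trans (le_normr_Rintegral _ _) _ => //; first exact: bmeas_integrable.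
rewrite mulrAC -Rintegral_cst//.
apply: le_Rintegral => //.
- apply: (bmeas_integrable m); exact: bmeas_norm.
- by apply: (bmeas_integrable m); exact: bmeas_cst.
- by move=> x _; exact: tlip_subl kC C0 _ _.
Qed.

(** Fubini for [k (x - y) * f y], which is integrable on the product because [k] is bounded and L^2
    embeds in L^1 for a probability measure. *)
Lemma kpre_adjoint C k f mu : tlip C k -> 0 <= C -> smpositive mu ->
  smint mu (kpre k f) = tL2inner f (toL (kconv k mu)).
Proof.
move=> kC C0 mu0; rewrite smint_pos//; set m := jordan_pos (hahnP mu).
have [A kA] : exists A, forall x, `|k x| <= A by case: (tlip_bmeas kC).
have A0 : 0 <= A by exact: le_trans (kA 0).
have mk : measurable_fun setT (fun z : T * T => k (z.1 - z.2)).
  apply: measurableT_comp; last exact: measurable_tsub.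
  exact: (measurable_tcontinuous (tlip_continuous kC)).
pose F (z : T * T) := (k (z.1 - z.2) * f z.2)%:E.
have mF : measurable_fun setT F.
  apply/measurable_EFinP/measurable_funM => //.
  by apply: measurableT_comp => //; exact: L2_measurable.
have fi : tleb.-integrable setT (EFin \o f) by apply: L2_integrable; exact: tleb_setT.
have iF : (m \x @tleb R)%E.-integrable setT F.
  apply/integrable12ltyP => //.
  apply: (@le_lt_trans _ _ (\int[m]_x (A * fine (\int[@tleb R]_y `|(f y)%:E|))%:E)%E).
    apply: ge0_le_integral => //.
    - by move=> x _; exact: integral_ge0.
    - apply: (measurable_fun_fubini_tonelli_F (abse \o F)) => //=.
      exact: measurableT_comp.
    - move=> x _; rewrite EFinM fineK; last first.
        by have /integrableP[_ h] := fi; rewrite ge0_fin_numE// integral_ge0.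
      rewrite -ge0_integralZl//; last first.
        by apply: measurableT_comp => //; case/integrableP: fi.
      apply: ge0_le_integral => //.
      + apply: measurableT_comp => //.
        exact: measurableT_comp mF (measurable_pair1 x).
      + apply: measurable_funeM; apply: measurableT_comp => //.
        by case/integrableP: fi.
      + by move=> y _; rewrite /F/= lee_fin normrM ler_wpM2r.
  rewrite integral_cst//= lte_mul_pinfty// ?lee_fin ?mulr_ge0//.
    by rewrite fine_ge0// integral_ge0.
  by rewrite ltey_eq fin_num_measure.
have := Fubini iF; rewrite /F/= => H.
rewrite /Rintegral.
transitivity (fine (\int[m]_x \int[@tleb R]_y (k (x - y) * f y)%:E)%E).
  congr fine; apply: eq_integral => x _; rewrite /kpre /Rintegral fineK//.
  apply: integrable_fin_num => //.
  have := L2_mul_integrable (kernL k x) f.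
  by rewrite (kernLE x kC C0).
rewrite H; rewrite /= /L2dot /Rintegral; congr fine.
apply: eq_integral => y _; rewrite toL_bmeas; last exact: kconv_bmeas kC C0 mu0.
rewrite /kconv smint_pos// /Rintegral -/m.
have bk : bmeas (fun x : T => k (x - y)) by apply: tlip_bmeas; exact: tlip_sub kC C0.
transitivity (\int[m]_x ((f y)%:E * (k (x - y))%:E))%E.
  by apply: eq_integral => x _; rewrite -EFinM mulrC.
rewrite integralZl//; last exact: (bmeas_integrable m).
rewrite EFinM fineK//; apply: integrable_fin_num => //.
exact: (bmeas_integrable m).
Qed.

End torus_L2.

(** * The Wasserstein regularizer *)

Section regularizer.
Context {R : realType}.
Local Notation T := (torus R).
Local Notation M := (signed_measure T R).
Local Notation X := (M * M)%type.
Local Notation F2 := ((T -> R) * (T -> R))%type.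
Implicit Types (mu nu : M) (u v : X) (eta : F2) (f : T -> R) (z : T * T).

Definition bmeas2 eta := bmeas eta.1 /\ bmeas eta.2.

Lemma inXpre_bmeas2 eta : inXpre eta -> bmeas2 eta.
Proof. by move=> [c1 c2]; split; exact: tcontinuous_bmeas. Qed.

(** The slack of <eta, D_z> <= 1 after clearing the denominator: nonnegative for feasible pairs,
    zero exactly at contact points. It is also the slack of Kantorovich's dual constraint for the
    cost 2 + d. *)
Definition gap eta z : R := 2 + tdist z.1 z.2 - (eta.1 z.1 + eta.2 z.2).

Definition smpos2 u := smpositive u.1 /\ smpositive u.2.

Lemma den_gt0 z : 0 < 2 + tdist z.1 z.2.
Proof. by have := tdist_ge0 z.1 z.2; lra. Qed.

Lemma Datom_pos z : smpos2 (Datom z).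
Proof.
by split; apply: smpositiveZ; rewrite ?invr_ge0 ?(ltW (den_gt0 z))//;
  exact: smdirac_pos.
Qed.

Lemma pairing_Datom eta z : bmeas2 eta ->
  pairing eta (Datom z) = (eta.1 z.1 + eta.2 z.2) / (2 + tdist z.1 z.2).
Proof.
move=> [b1 b2]; have d0 := ltW (den_gt0 z); have [m1 _] := b1; have [m2 _] := b2.
rewrite /pairing /= !smintZ ?invr_ge0//; try exact: smdirac_pos.
by rewrite !smint_dirac// -mulrDr mulrC.
Qed.

Lemma pairing_Datom_gap eta z : bmeas2 eta ->
  1 - pairing eta (Datom z) = gap eta z / (2 + tdist z.1 z.2).
Proof.
by move=> b; rewrite pairing_Datom// /gap; field; rewrite gt_eqF ?den_gt0.
Qed.

Lemma pairing_Datom_le1 eta z : bmeas2 eta ->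
  pairing eta (Datom z) <= 1 <-> 0 <= gap eta z.
Proof.
move=> b; rewrite -subr_ge0 pairing_Datom_gap// pmulr_lge0 ?invr_gt0//.
exact: den_gt0.
Qed.

Lemma pairing_Datom_eq1 eta z : bmeas2 eta ->
  pairing eta (Datom z) = 1 <-> gap eta z = 0.
Proof.
move=> b; have d0 := den_gt0 z; have := pairing_Datom_gap z b.
split=> h; last by move: H; rewrite h mul0r; lra.
by move/eqP: H; rewrite h subrr eq_sym mulf_eq0 invr_eq0 (gt_eqF d0) orbF => /eqP.
Qed.

Lemma smpositive_tvnorm0 mu : smpositive mu -> tvnorm mu = 0 -> mu = 0.
Proof.
move=> mu0; rewrite tvnorm_pos// => h; apply: signed_measure_eqP => A.
have [mA|nA] := pselect (measurable A); last by rewrite !smcharge_out.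
have muT : mu setT = 0%E by rewrite -(fineK (sm_fin_num mu _)) h.
apply/le_anti; rewrite mu0 andbT.
have -> : (0 : M) A = mu setT by rewrite muT.
rewrite -(jordan_pos_smpositive A mu0) -(jordan_pos_smpositive setT mu0).
by apply: le_measure; rewrite ?inE.
Qed.

Lemma coupling_smint (g : {measure set (T * T) -> \bar R}) mu nu f :
  smpositive mu -> smpositive nu -> coupling mu nu g -> bmeas f ->
  smint mu f = \int[g]_z f z.1 /\ smint nu f = \int[g]_z f z.2.
Proof.
move=> mu0 nu0 hg bf; have [mf [C hC]] := bf.
have gT : (g setT < +oo)%E.
  by have [+ _] := hg _ measurableT; rewrite setXTT => ->; rewrite ltey_eq sm_fin_num.
have mEf : measurable_fun setT (EFin \o f) by exact/measurable_EFinP.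
split.
  pose m : {measure set T -> \bar R} :=
    measure_function_pushforward__canonical__measure_function_Measure g
      (@measurable_fst _ _ T T).
  rewrite (@smint_measureE _ _ _ m)//; last first.
    move=> A mA; have [<- _] := hg _ mA; rewrite /m/= /pushforward; congr (g _).
    by apply/seteqP; split=> z //= [].
  rewrite /Rintegral /m /= integral_pushforward//.
  apply: bmeas_integrable_lty => //; split; last by exists C.
  exact: measurableT_comp.
pose m : {measure set T -> \bar R} :=
  measure_function_pushforward__canonical__measure_function_Measure g
    (@measurable_snd _ _ T T).
rewrite (@smint_measureE _ _ _ m)//; last first.
  move=> A mA; have [_ <-] := hg _ mA; rewrite /m/= /pushforward; congr (g _).
  by apply/seteqP; split=> z //= [].
rewrite /Rintegral /m /= integral_pushforward//.
apply: bmeas_integrable_lty => //; split; last by exists C.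
exact: measurableT_comp.
Qed.

Lemma bmeas_proj1 f : bmeas f -> bmeas (fun z : T * T => f z.1).
Proof.
by move=> [mf [C hC]]; split; [exact: measurableT_comp | exists C].
Qed.

Lemma bmeas_proj2 f : bmeas f -> bmeas (fun z : T * T => f z.2).
Proof.
by move=> [mf [C hC]]; split; [exact: measurableT_comp | exists C].
Qed.

Lemma bmeas_tdist : bmeas (fun z : T * T => tdist z.1 z.2).
Proof.
split; first exact: measurable_tdist.
by exists 2^-1 => z; rewrite ger0_norm ?tdist_ge0// tdist_le1.
Qed.

Lemma bmeas_gap eta : bmeas2 eta -> bmeas (gap eta).
Proof.
move=> [b1 b2]; apply: bmeasD.
  by apply: bmeasD; [exact: bmeas_cst | exact: bmeas_tdist].
by apply: bmeasN; apply: bmeasD; [exact: bmeas_proj1 | exact: bmeas_proj2].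
Qed.

Section normalized_coupling.
Variables (v : X) (g : {measure set (T * T) -> \bar R}).
Hypothesis vpos : smpos2 v.
Let c := tvnorm v.1.
Hypothesis (c0 : 0 < c) (hg : coupling (c^-1 *: v.1) (c^-1 *: v.2) g).

Let c'0 : 0 <= c^-1. Proof. by rewrite invr_ge0 ltW. Qed.

Lemma coupling_setT : g setT = 1%E.
Proof.
have [+ _] := hg measurableT; rewrite setXTT => ->.
have cE : v.1 setT = c%:E.
  by rewrite /c tvnorm_pos ?fineK ?sm_fin_num//; exact: vpos.1.
transitivity ((c^-1 * c)%:E); last by rewrite mulVf// gt_eqF.
by rewrite EFinM -cE.
Qed.

Lemma coupling_integrable (h : T * T -> R) : bmeas h ->
  g.-integrable setT (EFin \o h).
Proof. by apply: bmeas_integrable_lty; rewrite coupling_setT ltry. Qed.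

Lemma coupling_pairing eta : bmeas2 eta ->
  \int[g]_z (eta.1 z.1 + eta.2 z.2) = c^-1 * pairing eta v.
Proof.
move=> [b1 b2]; have [v1 v2] := vpos.
rewrite RintegralD//; try exact: coupling_integrable (bmeas_proj1 _);
  try exact: coupling_integrable (bmeas_proj2 _).
have p1 := smpositiveZ c'0 v1; have p2 := smpositiveZ c'0 v2.
have [<- _] := coupling_smint p1 p2 hg b1.
have [_ <-] := coupling_smint p1 p2 hg b2.
by rewrite (smintZ c'0 v1 b1) (smintZ c'0 v2 b2) -mulrDr.
Qed.

Lemma coupling_affine (a b : R) (h : T * T -> R) : bmeas h ->
  \int[g]_z (a + b * h z) = a + b * \int[g]_z h z.
Proof.
move=> bh; rewrite RintegralD//; last 2 first.
- by apply: coupling_integrable; exact: bmeas_cst.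
- by apply: coupling_integrable; apply: bmeasM => //; exact: bmeas_cst.
rewrite RintegralZl//; last exact: coupling_integrable.
by rewrite {1}/Rintegral integral_cst// coupling_setT mule1.
Qed.

Lemma coupling_cost :
  (\int[g]_z (tdist z.1 z.2)%:E = (\int[g]_z tdist z.1 z.2)%:E)%E.
Proof.
rewrite /Rintegral fineK//; apply: integrable_fin_num => //.
exact: coupling_integrable bmeas_tdist.
Qed.

(** This identity yields weak duality when the gap is nonnegative, and complementary slackness
    because its value is small for a nearly optimal coupling. *)
Lemma coupling_gap eta : bmeas2 eta ->
  \int[g]_z gap eta z = 2 + \int[g]_z tdist z.1 z.2 - c^-1 * pairing eta v.
Proof.
move=> b; have [b1 b2] := b; rewrite -coupling_pairing// /gap.
rewrite RintegralB//; last 2 first.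
- by apply: coupling_integrable; apply: bmeasD;
    [exact: bmeas_cst | exact: bmeas_tdist].
- by apply: coupling_integrable; apply: bmeasD;
    [exact: bmeas_proj1 | exact: bmeas_proj2].
congr (_ - _); rewrite RintegralD//; last 2 first.
- by apply: coupling_integrable; exact: bmeas_cst.
- exact: coupling_integrable bmeas_tdist.
by rewrite {1}/Rintegral integral_cst// coupling_setT mule1.
Qed.

End normalized_coupling.

Lemma Greg_ltyP v : (Greg v < +oo)%E -> smpos2 v /\ tvnorm v.1 = tvnorm v.2.
Proof. by rewrite /Greg; case: asboolP => // -[]. Qed.

Lemma GregE v : smpos2 v -> tvnorm v.1 = tvnorm v.2 ->
  Greg v = (W1bar v.1 v.2 + (tvnorm v.1)%:E + (tvnorm v.2)%:E)%E.
Proof. by move=> [v1 v2] h; rewrite /Greg; case: asboolP => // -[]. Qed.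

Lemma tvnorm_ge0 mu : smpositive mu -> 0 <= tvnorm mu.
Proof. by move=> mu0; rewrite tvnorm_pos// fine_ge0. Qed.

Lemma smpos2_tv0 v : smpos2 v -> tvnorm v.1 = tvnorm v.2 -> tvnorm v.1 = 0 ->
  v = 0.
Proof.
case: v => mu nu [/= v1 v2] h h0.
by rewrite (smpositive_tvnorm0 v1 h0) (smpositive_tvnorm0 v2)// -h.
Qed.

Lemma pairing0 eta : pairing eta 0 = 0.
Proof. by rewrite /pairing !smint0 addr0. Qed.

Lemma tvnorm0 : tvnorm (0 : M) = 0.
Proof. by rewrite tvnorm_pos//; exact: smpositive0. Qed.

Lemma Greg0 : Greg (0 : X) = 0%E.
Proof.
rewrite GregE ?tvnorm0//; last by split; exact: smpositive0.
by rewrite /W1bar tvnorm0 eqxx !adde0.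
Qed.

Lemma Greg_ge eta v : bmeas2 eta -> (forall z, 0 <= gap eta z) ->
  ((pairing eta v)%:E <= Greg v)%E.
Proof.
move=> b h; have [Gv|] := ltP (Greg v) +oo%E; last by move=> /(le_trans _); apply; exact: leey.
have [vpos v12] := Greg_ltyP Gv.
have := tvnorm_ge0 vpos.1; rewrite le_eqVlt => /predU1P[c0|c0].
  by rewrite (smpos2_tv0 vpos v12)// pairing0 Greg0.
rewrite GregE// /W1bar gt_eqF//.
set c := tvnorm v.1 in c0 *; rewrite -v12 -/c.
have : ((c^-1 * pairing eta v - 2)%:E <= W1 (c^-1 *: v.1) (c^-1 *: v.2))%E.
  apply: le_ereal_inf_tmp => _ [g hg <-].
  rewrite (coupling_cost vpos c0 hg) lee_fin.
  have := coupling_gap vpos c0 hg b.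
  have : 0 <= \int[g]_z gap eta z by apply: Rintegral_ge0.
  by rewrite -/c; lra.
have c00 : (0 <= c%:E)%E by rewrite lee_fin ltW.
move=> /(lee_wpmul2l c00) hW; rewrite -addeA.
apply: le_trans (leeD2r _ hW); rewrite -!EFinM -!EFinD lee_fin.
by rewrite mulrBr mulrA divff ?gt_eqF// mul1r; lra.
Qed.

(** By compactness the gap has a lower bound c > 0 where |h| >= e, and there [A / c * gap eta z]
    exceeds the bound [A] of |h|. *)
Lemma norm_le_gap eta (h : T * T -> R) e : continuous (gap eta) ->
  continuous h -> (forall z, 0 <= gap eta z) ->
  (forall z, gap eta z = 0 -> h z = 0) -> 0 < e ->
  exists2 C, 0 <= C & forall z, `|h z| <= e + C * gap eta z.
Proof.
move=> gc hc g0 gh e0.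
have nc : continuous (fun z => `|h z|).
  by move=> z; apply: continuous_comp; [exact: hc | exact: norm_continuous].
have nec : continuous (fun z => `|h z| - e).
  by move=> z; apply: cvgB; [exact: nc | exact: cvg_cst].
have [c c0 hcz] : exists2 c, 0 < c & forall z, 0 <= `|h z| - e -> c <= gap eta z.
  apply: compact_lower_bound => // z; rewrite subr_ge0 => hz.
  rewrite lt_def g0 andbT; apply: contraTneq hz => /gh ->.
  by rewrite normr0 -ltNge.
have [A A0 hA] : exists2 A, 0 <= A & forall z, `|h z| <= A.
  have cT : compact [set: T * T].
    by rewrite -setXTT; apply: compact_setX; exact: tcompact.
  have [z _ hz] := compact_EVT_max
    (ex_intro (fun x => setT x) ((0, 0) : T * T) I) cT (continuous_subspaceT nc).
  by exists `|h z| => // w; apply: hz; rewrite inE.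
exists (A / c) => [|z]; first by rewrite divr_ge0// ltW.
have [hz|hz] := leP e `|h z|; last first.
  have : 0 <= A / c * gap eta z by rewrite mulr_ge0// divr_ge0// ltW.
  by move: hz; lra.
have : A <= A / c * gap eta z.
  by rewrite -mulrA ler_peMr// mulrC ler_pdivlMr// mul1r hcz// subr_ge0.
by have := hA z; lra.
Qed.

(* Complementary slackness: near-optimal couplings concentrate on the contact
   set of eta, so no existence theorem for optimal couplings is needed. *)
Lemma Greg_slackness eta eta' v : bmeas2 eta -> bmeas2 eta' ->
  continuous (gap eta) ->
  continuous (fun z : T * T => eta'.1 z.1 + eta'.2 z.2) ->
  (forall z, 0 <= gap eta z) -> Greg v = (pairing eta v)%:E ->
  (forall z, gap eta z = 0 -> eta'.1 z.1 + eta'.2 z.2 = 0) ->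
  pairing eta' v = 0.
Proof.
move=> b b' gc hc g0 Gv gh.
have [vpos v12] := @Greg_ltyP v ltac:(by rewrite Gv ltry).
have := tvnorm_ge0 vpos.1; rewrite le_eqVlt => /predU1P[c0|c0].
  by rewrite (smpos2_tv0 vpos v12)// pairing0.
have := Gv; rewrite GregE// /W1bar gt_eqF//.
set c := tvnorm v.1 in c0 *; rewrite -v12 -/c => Gv'.
have W1E : W1 (c^-1 *: v.1) (c^-1 *: v.2) = (c^-1 * pairing eta v - 2)%:E.
  move: Gv'; case: (W1 _ _) => [r| |] /=.
  - rewrite -EFinM -!EFinD => -[h]; congr (_%:E).
    by rewrite -h; field; rewrite gt_eqF.
  - by rewrite mulry gtr0_sg// mul1e.
  - by rewrite mulrNy gtr0_sg// mul1e.
apply/normr0_eq0/le_anti; rewrite normr_ge0 andbT.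
apply/ler_addgt0Pr => e e0; rewrite add0r.
have e2c : 0 < e / (2 * c) by rewrite divr_gt0// mulr_gt0.
have [C C0 hC] := norm_le_gap gc hc g0 gh e2c.
(* With this excess cost, C times the integrated gap is at most e / (2 c). The error from
   [norm_le_gap] is as large, and scaling the sum by [c] gives [e]. *)
have d0 : 0 < e / (2 * c) / (C + 1) by rewrite divr_gt0// ltr_wpDl.
have [_ [g hg <-]] := lb_ereal_inf_adherent d0
  (ltac:(by rewrite -/(W1 _ _) W1E) :
    ereal_inf [set (\int[g]_z (tdist z.1 z.2)%:E)%E |
      g in coupling (c^-1 *: v.1) (c^-1 *: v.2)] \is a fin_num).
rewrite -/(W1 _ _) W1E (coupling_cost vpos c0 hg) -EFinD lte_fin => hW.
have bh : bmeas (fun z : T * T => eta'.1 z.1 + eta'.2 z.2).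
  by case: b' => b1 b2; apply: bmeasD; [exact: bmeas_proj1 | exact: bmeas_proj2].
have hgap := coupling_gap vpos c0 hg b.
have key : `|c^-1 * pairing eta' v| <= e / (2 * c) + C * \int[g]_z gap eta z.
  rewrite -(coupling_pairing vpos c0 hg b').
  apply: le_trans (le_normr_Rintegral _ _) _ => //.
    exact: (coupling_integrable vpos c0 hg).
  have -> : e / (2 * c) + C * \int[g]_z gap eta z =
      \int[g]_z (e / (2 * c) + C * gap eta z).
    by rewrite (coupling_affine vpos c0 hg)//; exact: bmeas_gap.
  apply: le_Rintegral => //.
  - by apply: (coupling_integrable vpos c0 hg); exact: bmeas_norm.
  - apply: (coupling_integrable vpos c0 hg).
    apply: bmeasD; first exact: bmeas_cst.
    by apply: bmeasM; [exact: bmeas_cst | exact: bmeas_gap].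
have gle : \int[g]_z gap eta z <= e / (2 * c) / (C + 1) by rewrite hgap -/c; lra.
have CC : C * \int[g]_z gap eta z <= e / (2 * c).
  apply: le_trans (ler_wpM2l C0 gle) _.
  rewrite mulrCA ger_pMr// ler_pdivrMr ?mul1r; lra.
have : c * `|c^-1 * pairing eta' v| <= c * (e / (2 * c) + e / (2 * c)).
  by rewrite ler_pM2l//; lra.
rewrite -{1}(gtr0_norm c0) -normrM mulVKf ?gt_eqF//.
by rewrite (_ : c * _ = e)//; field; rewrite gt_eqF.
Qed.

(** * Finite nonnegative combinations of atoms *)

Section finite_atoms.
Variables (n : nat) (c : 'I_n -> R) (z : 'I_n -> T * T).
Hypothesis c_ge0 : forall i, 0 <= c i.
Let w i := c i / (2 + tdist (z i).1 (z i).2).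
Let w0 i : 0 <= w i.
Proof. by rewrite divr_ge0// ltW// den_gt0. Qed.
Let W := \sum_i w i.
Let u := \sum_i c i *: Datom (z i).

Lemma atoms_fst : u.1 = \sum_i w i *: smdirac R (z i).1.
Proof.
rewrite /u (big_morph fst (fun _ _ => erefl) erefl).
by apply: eq_bigr => i _; rewrite /= scalerA.
Qed.

Lemma atoms_snd : u.2 = \sum_i w i *: smdirac R (z i).2.
Proof.
rewrite /u (big_morph snd (fun _ _ => erefl) erefl).
by apply: eq_bigr => i _; rewrite /= scalerA.
Qed.

Lemma atoms_pos : smpos2 u.
Proof.
rewrite /smpos2 atoms_fst atoms_snd.
by split; apply: smpositive_sum => i; apply: smpositiveZ => //; exact: smdirac_pos.
Qed.

Lemma sum_diracE (x : 'I_n -> T) A : measurable A ->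
  (\sum_i w i *: smdirac R (x i)) A = (\sum_i (w i)%:E * \d_(x i) A)%E.
Proof.
move=> mA; rewrite (big_morph (fun m : M => m A) (fun _ _ => erefl) erefl).
apply: eq_bigr => i _; rewrite -smdiracE//.
Qed.

Lemma atoms_tvnorm : tvnorm u.1 = W /\ tvnorm u.2 = W.
Proof.
have [u1 u2] := atoms_pos; rewrite !tvnorm_pos// atoms_fst atoms_snd.
rewrite !sum_diracE//; split.
  by under eq_bigr do rewrite diracT mule1; rewrite sumEFin.
by under eq_bigr do rewrite diracT mule1; rewrite sumEFin.
Qed.

Lemma pairing_atoms eta : bmeas2 eta ->
  pairing eta u = \sum_i c i * pairing eta (Datom (z i)).
Proof.
move=> b; have [b1 b2] := b; rewrite /pairing atoms_fst atoms_snd.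
rewrite !smint_sum//; try by move=> i; apply: smpositiveZ => //; exact: smdirac_pos.
rewrite -big_split; apply: eq_bigr => i _ /=.
have [m1 _] := b1; have [m2 _] := b2; have d0 := ltW (den_gt0 (z i)).
rewrite !smintZ ?invr_ge0//; try exact: smdirac_pos.
by rewrite !smint_dirac// /w; ring.
Qed.

(** [msum] takes a sequence indexed by the natural numbers, hence the extension by the zero measure
    beyond [n]. *)
Let atom_measure (k : nat) : {measure set (T * T) -> \bar R} :=
  if (insub k : option 'I_n) is Some i
  then (mscale (NngNum (w0 i)) (dirac (z i)) : {measure set (T * T) -> \bar R})
  else (mzero : {measure set (T * T) -> \bar R}).

(** The plan moving each mass [w i] from the first to the second point of [z i] is admissible, and
    its cost plus twice the total mass is the sum of the [c i]. It need not be optimal, so this is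
    only an inequality. *)
Lemma Greg_atoms : (Greg u <= (\sum_i c i)%:E)%E.
Proof.
have [t1 t2] := atoms_tvnorm; have W0 : 0 <= W by apply: sumr_ge0.
rewrite GregE ?t1 ?t2//; last exact: atoms_pos.
have cE : \sum_i c i = \sum_i w i * tdist (z i).1 (z i).2 + W + W.
  rewrite /W -!big_split; apply: eq_bigr => i _ /=.
  by rewrite /w; field; rewrite gt_eqF ?den_gt0.
rewrite cE !EFinD -!addeA; apply: leeD2r; rewrite /W1bar t1.
have [W00|Wn0] := eqVneq W 0.
  by rewrite lee_fin; apply: sumr_ge0 => i _; rewrite mulr_ge0 ?tdist_ge0.
have Wp : 0 < W by rewrite lt_def Wn0.
have W'0 : 0 <= W^-1 by rewrite invr_ge0.
pose g : {measure set (T * T) -> \bar R} :=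
  mscale (NngNum W'0) (msum atom_measure n).
have gE A : g A = ((W^-1)%:E * \sum_i (w i)%:E * \d_(z i) A)%E.
  rewrite /g /= /mscale /= /msum; congr (_ * _)%E; apply: eq_bigr => i _.
  by rewrite /atom_measure valK.
have hg : coupling (W^-1 *: u.1) (W^-1 *: u.2) g.
  move=> A mA; rewrite !gE; split.
    rewrite [RHS](_ : _ = (W^-1)%:E * u.1 A)%E// atoms_fst sum_diracE//.
    congr (_ * _)%E; apply: eq_bigr => i _; congr (_ * _)%E.
    have e : (z i \in A `*` setT) = ((z i).1 \in A).
      by apply/idP/idP; rewrite !inE; [case | move=> h; split].
    by rewrite !diracE e.
  rewrite [RHS](_ : _ = (W^-1)%:E * u.2 A)%E// atoms_snd sum_diracE//.
  congr (_ * _)%E; apply: eq_bigr => i _; congr (_ * _)%E.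
  have e : (z i \in setT `*` A) = ((z i).2 \in A).
    by apply/idP/idP; rewrite !inE; [case | move=> h; split].
  by rewrite !diracE e.
apply: (@le_trans _ _ (W%:E * \int[g]_z (tdist z.1 z.2)%:E)%E).
  apply: lee_wpmul2l; first by rewrite lee_fin.
  by apply: ereal_inf_lbound; exists g.
have mt : measurable_fun setT (fun z : T * T => (tdist z.1 z.2)%:E).
  by apply/measurable_EFinP; exact: measurable_tdist.
have t0 (x : T * T) : (0 <= (tdist x.1 x.2)%:E)%E by rewrite lee_fin tdist_ge0.
rewrite ge0_integral_mscale// ge0_integral_measure_sum//.
rewrite muleA -EFinM divff// mul1e -sumEFin; apply: lee_sum => i _.
rewrite /atom_measure valK ge0_integral_mscale// integral_dirac//.
by rewrite diracT mul1e.
Qed.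

End finite_atoms.

Lemma Greg_Datom z : (Greg (Datom z) <= 1)%E.
Proof.
have := @Greg_atoms 1 (fun=> 1) (fun=> z) (fun=> ler01).
by rewrite !big_ord1 scale1r.
Qed.

(** Atoms test the subgradient inequality in one direction, weak duality gives the other. The dual
    constraint thus becomes a family of inequalities indexed by T x T. *)
Lemma subdiff_Greg0 eta : subdiff (@Greg R) 0 eta <->
  inXpre eta /\ forall z, 0 <= gap eta z.
Proof.
split=> [[ic _ h]|[ic h]]; split=> //.
- move=> z; apply/(pairing_Datom_le1 z (inXpre_bmeas2 ic)).
  have := h (Datom z); rewrite subr0 Greg0 add0e => hz.
  by rewrite -lee_fin; exact: le_trans hz (Greg_Datom z).
- by rewrite Greg0.
- by move=> v; rewrite subr0 Greg0 add0e; apply: Greg_ge => //; exact: inXpre_bmeas2.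
Qed.

(** * Atoms as extreme points of the unit ball *)

Lemma smpositive_dirac mu (x : T) : smpositive mu ->
  (forall A, measurable A -> ~ A x -> mu A = 0%E) ->
  mu = tvnorm mu *: smdirac R x.
Proof.
move=> mu0 h; apply: signed_measure_eqP => A.
have [mA|nA] := pselect (measurable A); last by rewrite !smcharge_out.
rewrite [RHS](_ : _ = (tvnorm mu)%:E * smdirac R x A)%E//.
rewrite smdiracE// tvnorm_pos// fineK ?sm_fin_num// diracE.
have [Ax|nAx] := pselect (A x); last by rewrite memNset// mule0 h.
rewrite mem_set// mule1 -(setUv A) chargeU ?setICr//; last exact: measurableC.
have -> : mu (~` A) = 0%E by apply: h; [exact: measurableC | exact].
by rewrite adde0.
Qed.

Lemma smpos2_atom v z : smpos2 v -> tvnorm v.1 = tvnorm v.2 ->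
  (forall A, measurable A -> ~ A z.1 -> v.1 A = 0%E) ->
  (forall A, measurable A -> ~ A z.2 -> v.2 A = 0%E) ->
  v = (tvnorm v.1 * (2 + tdist z.1 z.2)) *: Datom z.
Proof.
move=> [v1 v2] v12 h1 h2; have d0 := den_gt0 z.
rewrite /Datom [RHS]surjective_pairing /= !scalerA mulfK ?gt_eqF//.
rewrite -(smpositive_dirac v1 h1) v12 -(smpositive_dirac v2 h2).
by case: (v).
Qed.

(** A pair feasible by the triangle inequality and with contact at [z]; it shows that a nonnegative
    multiple r D_z in the unit ball has r <= 1. *)
Definition witness z : F2 :=
  (fun s => 1 + tdist s z.2, fun t => 1 - tdist t z.2).

Lemma tdist_lip1 (s : T) : tlip 1 (fun x => tdist x s).
Proof. by move=> x y; rewrite mul1r; have := tdist_lip x s y s; rewrite tdistxx addr0. Qed.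

Lemma inXpre_witness z : inXpre (witness z).
Proof.
split; apply: (@tlip_continuous _ 1) => x y; rewrite /witness/=.
  rewrite opprD addrACA subrr add0r; exact: tdist_lip1.
rewrite (_ : _ - _ - _ = - (tdist x z.2 - tdist y z.2)); last by ring.
by rewrite normrN; exact: tdist_lip1.
Qed.

Lemma gap_witness_ge0 z x : 0 <= gap (witness z) x.
Proof.
rewrite /gap /witness /=; have := tdist_triangle x.2 x.1 z.2; lra.
Qed.

Lemma pairing_witness z : pairing (witness z) (Datom z) = 1.
Proof.
apply/(pairing_Datom_eq1 z (inXpre_bmeas2 (inXpre_witness z))).
by rewrite /gap/= tdistxx; lra.
Qed.

Lemma pairingZ eta v (a : R) : bmeas2 eta -> smpos2 v -> 0 <= a ->
  pairing eta (a *: v) = a * pairing eta v.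
Proof.
move=> [b1 b2] [v1 v2] a0.
by rewrite [LHS]/pairing /= (smintZ a0 v1 b1) (smintZ a0 v2 b2) -mulrDr.
Qed.

(** In a convex decomposition of an atom into positive measures, both terms are carried by the same
    two points, hence are multiples of the atom by [a] and [c]. The witness gives a, c <= 1, while
    their weighted mean is 1. *)
Lemma Datom_extreme z :
  extreme_points [set u | (Greg u <= 1)%E] (Datom z).
Proof.
split=> [|v w t /= Gv Gw /andP[t0 t1] D]; first exact: Greg_Datom.
have b := inXpre_bmeas2 (inXpre_witness z).
have t10 : 0 < 1 - t by rewrite subr_gt0.
have [vpos v12] := Greg_ltyP (le_lt_trans Gv (ltry 1)).
have [wpos w12] := Greg_ltyP (le_lt_trans Gw (ltry 1)).
have supp (a b' : M) (s : R) (x : T) : smpositive a -> smpositive b' ->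
    s *: smdirac R x = t *: a + (1 - t) *: b' -> forall A, measurable A ->
    ~ A x -> a A = 0%E /\ b' A = 0%E.
  move=> a0 b0 e A mA nAx.
  have : (t *: a + (1 - t) *: b') A = 0%E.
    rewrite -e [LHS](_ : _ = s%:E * smdirac R x A)%E// smdiracE// diracE memNset//.
    by rewrite mule0.
  rewrite [LHS](_ : _ = t%:E * a A + (1 - t)%:E * b' A)%E//.
  have ta : (0 <= t%:E * a A)%E by rewrite mule_ge0// lee_fin ltW.
  have tb : (0 <= (1 - t)%:E * b' A)%E by rewrite mule_ge0// lee_fin ltW.
  move/eqP; rewrite padde_eq0//.
  by rewrite !mule_eq0 !eqe (gt_eqF t0) (gt_eqF t10)/= => /andP[/eqP -> /eqP ->].
have D1 : (2 + tdist z.1 z.2)^-1 *: smdirac R z.1 = t *: v.1 + (1 - t) *: w.1.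
  by have := congr1 fst D.
have D2 : (2 + tdist z.1 z.2)^-1 *: smdirac R z.2 = t *: v.2 + (1 - t) *: w.2.
  by have := congr1 snd D.
have S1 := supp _ _ _ _ vpos.1 wpos.1 D1; have S2 := supp _ _ _ _ vpos.2 wpos.2 D2.
have vE : v = _ := smpos2_atom vpos v12
  (fun A mA nA => (S1 A mA nA).1) (fun A mA nA => (S2 A mA nA).1).
have wE : w = _ := smpos2_atom wpos w12
  (fun A mA nA => (S1 A mA nA).2) (fun A mA nA => (S2 A mA nA).2).
move: vE wE; set a := _ * _; set c := tvnorm w.1 * _ => vE wE.
have d0 := ltW (den_gt0 z).
have a0 : 0 <= a by apply: mulr_ge0 => //; apply: tvnorm_ge0; exact: vpos.1.
have c0 : 0 <= c by apply: mulr_ge0 => //; apply: tvnorm_ge0; exact: wpos.1.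
have pos := Datom_pos z.
have le1 (r : R) (x : X) : 0 <= r -> x = r *: Datom z -> (Greg x <= 1)%E -> r <= 1.
  move=> r0 -> /(le_trans (Greg_ge _ b (gap_witness_ge0 z))).
  by rewrite pairingZ// pairing_witness mulr1 lee_fin.
have a1 := le1 _ _ a0 vE Gv; have c1 := le1 _ _ c0 wE Gw.
have : t * a + (1 - t) * c = 1.
  have := congr1 (pairing (witness z)) D; rewrite vE wE pairing_witness.
  rewrite !scalerA -scalerDl pairingZ ?pairing_witness ?mulr1//.
  by rewrite addr_ge0// mulr_ge0// ltW.
move=> e; have ea : a = 1 by nra.
have ec : c = 1 by nra.
by rewrite vE wE ea ec scale1r.
Qed.

Lemma Datom_Bset z : Bset (Datom z).
Proof. by apply: subset_closure; exact: Datom_extreme. Qed.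

(** * Weak* convergence and the metric on the atoms *)

Lemma prod_topology_cvgP (U : Type) (F : set_system {ptws U -> R})
    (FF : Filter F) (f : {ptws U -> R}) :
  F --> f <-> forall t, (g t) @[g --> F] --> (f t : R).
Proof.
split=> [h t A nA|h].
  have h1 := iffLR (cvg_sup _ f FF) h t.
  exact: (h1 _ (@initial_continuous _ _ (fun g : {ptws U -> R} => g t) f A nA)).
apply/cvg_sup => t A /= [_ [[B Bop <-] Bfs sBfA]].
have nB : nbhs (f t) B by apply: open_nbhs_nbhs.
have hB : F ((fun g : {ptws U -> R} => g t) @^-1` B) := h t _ nB.
exact: (filterS sBfA hB).
Qed.

Lemma weakstar_cvgP (u_ : nat -> X) v :
  ((u_ : nat -> initial_topology (@weakstar_eval R)) @ \oo -->
    (v : initial_topology (@weakstar_eval R))) <->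
  forall eta, inXpre eta -> pairing eta (u_ k) @[k --> \oo] --> pairing eta v.
Proof.
split=> [h eta ic|h].
  have h2 : weakstar_eval (u_ k) @[k --> \oo] --> weakstar_eval v.
    by move=> A nA; exact: (h _ (@initial_continuous _ _ (@weakstar_eval R) v A nA)).
  exact: (iffLR (prod_topology_cvgP _ _) h2 (exist _ eta ic)).
have h2 : weakstar_eval (u_ k) @[k --> \oo] --> weakstar_eval v.
  by apply/prod_topology_cvgP => -[eta ic]; exact: h.
move=> A /= [_ [[B Bop <-] Bfs sBfA]].
have nB : nbhs (weakstar_eval v) B by apply: open_nbhs_nbhs.
have hB : \forall k \near \oo, B (weakstar_eval (u_ k)) := h2 _ nB.
by apply: filterS hB => k; exact: sBfA.
Qed.

Section ball_metric.
Variable dB : X -> X -> R.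
Hypothesis hdB : metrizes_weakstar (@Bset R) dB.

Lemma pairing_Datom_cvg eta (z_ : nat -> T * T) z : inXpre eta ->
  (forall e, 0 < e -> exists N, forall k, (N <= k)%N ->
    tdist (z_ k).1 z.1 < e /\ tdist (z_ k).2 z.2 < e) ->
  pairing eta (Datom (z_ k)) @[k --> \oo] --> pairing eta (Datom z).
Proof.
move=> ic hz; have b := inXpre_bmeas2 ic; have [c1 c2] := ic.
have zc1 : (z_ k).1 @[k --> \oo] --> z.1.
  apply/cvg_ballP => e e0; have [N hN] := hz e e0; exists N => // k /hN [h _].
  by apply/tball; rewrite tdist_sym.
have zc2 : (z_ k).2 @[k --> \oo] --> z.2.
  apply/cvg_ballP => e e0; have [N hN] := hz e e0; exists N => // k /hN [_ h].
  by apply/tball; rewrite tdist_sym.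
have dc : 2 + tdist (z_ k).1 (z_ k).2 @[k --> \oo] --> 2 + tdist z.1 z.2.
  apply: cvgD; first exact: cvg_cst.
  apply/cvgrPdist_le => e e0; have e2 : 0 < e / 2 by lra.
  have [N hN] := hz _ e2; exists N => // k /hN [h1 h2].
  apply: le_trans (tdist_lip _ _ _ _) _.
  by rewrite (tdist_sym z.1) (tdist_sym z.2); lra.
under eq_fun do rewrite pairing_Datom//; rewrite pairing_Datom//.
apply: cvgM; last by apply: cvgV => //; rewrite gt_eqF ?den_gt0.
by apply: cvgD; [exact: (cvg_comp _ _ zc1 (c1 _)) | exact: (cvg_comp _ _ zc2 (c2 _))].
Qed.

(** [dB] is known only through its convergent sequences, hence the contradiction with points at
    distance below 1/(k+1). The converse comparison follows the same pattern, with distance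
    functions as test pairs. *)
Lemma Datom_dB_small z e : 0 < e -> exists2 r, 0 < r & forall x,
  tdist x.1 z.1 < r -> tdist x.2 z.2 < r -> dB (Datom x) (Datom z) <= e.
Proof.
move=> e0; apply: contrapT => H.
have /choice[z_ hz_] : forall k : nat, exists x, [/\ tdist x.1 z.1 < k.+1%:R^-1,
    tdist x.2 z.2 < k.+1%:R^-1 & e < dB (Datom x) (Datom z)].
  move=> k; apply: contrapT => nH; apply: H; exists (k.+1%:R^-1).
    by rewrite invr_gt0 ltr0n.
  by move=> x x1 x2; rewrite leNgt; apply/negP => h; apply: nH; exists x.
have [_ _ _ /(_ (fun k => Datom (z_ k)) (Datom z))] := hdB.
case=> [k||_]; try exact: Datom_Bset.
have W : ((fun k => Datom (z_ k)) : nat -> initial_topology (@weakstar_eval R)) @ \oo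
    --> (Datom z : initial_topology (@weakstar_eval R)).
  apply/weakstar_cvgP => eta ic; apply: pairing_Datom_cvg => // d d0.
  have d2 : 0 < d / 2 by lra.
  have [N hN] := archi_inv d2; exists N => k /hN h.
  have hd := le_lt_trans h (_ : d / 2 < d).
  by have [h1 h2 _] := hz_ k; split; [apply: (lt_trans h1)|apply: (lt_trans h2)];
    apply: hd; lra.
move=> /(_ W) /cvgrPdist_lt /(_ _ e0) [N _ /(_ N (leqnn _))].
by have [_ _ h] := hz_ N; rewrite sub0r normrN => /(le_lt_trans (ler_norm _)); lra.
Qed.

Lemma dB_small_Datom z r : 0 < r -> exists2 e, 0 < e & forall x,
  dB (Datom x) (Datom z) <= e -> tdist x.1 z.1 < r /\ tdist x.2 z.2 < r.
Proof.
move=> r0; apply: contrapT => H.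
have /choice[z_ hz_] : forall k : nat, exists x,
    dB (Datom x) (Datom z) <= k.+1%:R^-1 /\
    ~ (tdist x.1 z.1 < r /\ tdist x.2 z.2 < r).
  move=> k; apply: contrapT => nH; apply: H; exists (k.+1%:R^-1).
    by rewrite invr_gt0 ltr0n.
  by move=> x hx; apply: contrapT => h; apply: nH; exists x.
have [dB0 _ _ /(_ (fun k => Datom (z_ k)) (Datom z))] := hdB.
case=> [k||+ _]; try exact: Datom_Bset.
have dc : dB (Datom (z_ k)) (Datom z) @[k --> \oo] --> (0 : R).
  apply/cvgrPdist_le => e e0; have [N hN] := archi_inv e0.
  exists N => // k /hN h; rewrite sub0r normrN ger0_norm.
    by have [h2 _] := hz_ k; exact: le_trans h2 h.
  by have [] := dB0 (Datom (z_ k)) (Datom z) (@Datom_Bset _) (@Datom_Bset _).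
move=> /(_ dc)/weakstar_cvgP W.
have test eta : inXpre eta -> (forall x, 0 <= eta.1 x) -> (forall x, 0 <= eta.2 x) ->
    eta.1 z.1 = 0 -> eta.2 z.2 = 0 -> exists N, forall k, (N <= k)%N ->
    eta.1 (z_ k).1 + eta.2 (z_ k).2 < r.
  move=> ic e1 e2 e10 e20; have b := inXpre_bmeas2 ic.
  have := W _ ic; rewrite [in X in _ --> X]pairing_Datom// e10 e20 addr0 mul0r.
  (* The denominator of an atom is at most 5/2, so a pairing below r / 3 has its numerator below
     [r]. *)
  have r3 : 0 < r / 3 by lra.
  move=> /cvgrPdist_lt /(_ _ r3) [N _ hN]; exists N => k /hN.
  rewrite sub0r normrN pairing_Datom// ger0_norm; last first.
    by apply: divr_ge0; [exact: addr_ge0 | exact: ltW (den_gt0 _)].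
  rewrite ltr_pdivrMr ?den_gt0//; have := tdist_le1 (z_ k).1 (z_ k).2.
  by move=> h1 h2; nra.
have c0 : continuous (fun _ : T => 0 : R) by exact: cst_continuous.
have [N1 hN1] := test (fun x => tdist x z.1, fun=> 0)
  (conj (tlip_continuous (tdist_lip1 z.1)) c0) (fun x => tdist_ge0 _ _)
  (fun=> lexx 0) (tdistxx _) erefl.
have [N2 hN2] := test (fun=> 0, fun x => tdist x z.2)
  (conj c0 (tlip_continuous (tdist_lip1 z.2))) (fun=> lexx 0)
  (fun x => tdist_ge0 _ _) erefl (tdistxx _).
have [_] := hz_ (maxn N1 N2); apply.
have := hN1 _ (leq_maxl N1 N2); have := hN2 _ (leq_maxr N1 N2) => /=.
by rewrite add0r addr0.
Qed.

End ball_metric.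

End regularizer.

(** * Local uniqueness of contact points *)

Section quotient_second_derivative.
Context {R : realType}.
Implicit Types (a b k s h : R).

(** A slope of modulus larger than 1 at [a] would persist nearby by continuity, against the mean
    value theorem. *)
Lemma derive_slope_le1 (f f1 : R -> R) a : (forall x : R, is_derive x 1 f (f1 x)) ->
  continuous f1 -> (forall p, f p - f a <= `|p - a|) -> `|f1 a| <= 1.
Proof.
move=> fd f1c H.
have key e : 0 < e -> exists2 d, 0 < d & forall c, `|c - a| <= d -> `|f1 a - f1 c| < e.
  move=> e0; have /cvgrPdist_lt /(_ e e0) := f1c a.
  move=> /nbhs_ballP[d /= d0 hd]; exists (d / 2) => [|c ca]; first lra.
  by apply: hd; rewrite /ball/= distrC; lra.
rewrite ler_norml; apply/andP; split; rewrite leNgt; apply/negP => h.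
  have [|d d0 hd] := key (- 1 - f1 a); first lra.
  have fc : {within `[a - d, a], continuous f}.
    exact/continuous_subspaceT/(is_derive1_continuous fd).
  have [|c] := MVT_segment _ (fun x _ => fd x) fc; first lra.
  rewrite in_itv/= => /andP[c1 c2] fE.
  have := hd c; rewrite ler0_norm; last lra.
  move=> /(_ ltac:(lra)) /ltr_normlP[+ _]; have := H (a - d).
  rewrite ler0_norm; last lra.
  move=> h1 h2; have : f1 c * (a - (a - d)) < - 1 * (a - (a - d)).
    by rewrite ltr_pM2r; lra.
  rewrite -fE; lra.
have [|d d0 hd] := key (f1 a - 1); first lra.
have fc : {within `[a, a + d], continuous f}.
  exact/continuous_subspaceT/(is_derive1_continuous fd).
have [|c] := MVT_segment _ (fun x _ => fd x) fc; first lra.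
rewrite in_itv/= => /andP[c1 c2] fE.
have := hd c; rewrite ger0_norm; last lra.
move=> /(_ ltac:(lra)) /ltr_normlP[_ h2]; have := H (a + d).
rewrite ger0_norm; last lra.
move=> h1; have : 1 * (a + d - a) < f1 c * (a + d - a).
  by rewrite ltr_pM2r; lra.
rewrite -fE; lra.
Qed.

(** Let D(p) = 2 + s (p - b), equal to the numerator at [a]. There the second derivative of the
    quotient times D^2 is f2 D - 2 s f1 + 2, and s f1 <= 1, so a negative value forces f2 < 0. The
    slope bound replaces criticality, which the smoothed quotient may lack on the diagonal. *)
Lemma quotient_second_derivative (f f1 f2 : R -> R) a b k s :
  (forall x : R, is_derive x 1 f (f1 x)) ->
  (forall x : R, is_derive x 1 f1 (f2 x)) ->
  s ^+ 2 = 1 -> 0 < 2 + s * (a - b) -> f a + k = 2 + s * (a - b) ->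
  `|f1 a| <= 1 ->
  derive1 (derive1 (fun p => (f p + k) / (2 + s * (p - b)))) a < 0 ->
  f2 a < 0.
Proof.
move=> fd f1d s2 D0 fa f1a; set F := fun p => _.
pose D (p : R) : R := 2 + s * (p - b); pose N (p : R) : R := f p + k.
have Dd (p : R) : is_derive p 1 D s.
  have := is_deriveD (is_derive_cst (2 : R) p 1) (is_deriveZ s
    (is_deriveB (is_derive_id p (1 : R)) (is_derive_cst b p 1))).
  by rewrite add0r subr0 /GRing.scale/= mulr1.
have Nd (p : R) : is_derive p 1 N (f1 p).
  by have := is_deriveD (fd p) (is_derive_cst k p 1); rewrite addr0.
have Vd (p : R) (nz : D p != 0) : is_derive p 1 (fun q => (D q)^-1) (- (D p) ^- 2 * s).
  exact: (is_deriveV nz (Dd p)).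
have Fd (p : R) : D p != 0 -> is_derive p 1 F (f1 p / D p - s * N p / D p ^+ 2).
  move=> nz; have := is_deriveM (Nd p) (Vd p nz).
  rewrite /GRing.scale/= => h; apply: is_derive_eq h _.
  by field.
pose G p := f1 p / D p - s * N p / D p ^+ 2.
have nzD : D a != 0 by rewrite gt_eqF.
have nearD : \forall p \near a, D p != 0.
  have Dc : continuous D by exact: is_derive1_continuous Dd.
  have : \forall p \near a, 0 < D p by apply: (cvgr_gt _ (Dc a)).
  by apply: filterS => p p0; rewrite gt_eqF.
have FG : \forall p \near a, derive1 F p = G p.
  apply: filterS nearD => p nz; rewrite derive1E.
  by have := Fd p nz; case.
have Gd : is_derive a 1 G (f2 a / D a - 2 * s * f1 a / D a ^+ 2 + 2 * N a / D a ^+ 3).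
  have d1 := is_deriveM (f1d a) (Vd a nzD).
  have d2 := is_deriveM (is_deriveZ s (Nd a)) (is_deriveM (Vd a nzD) (Vd a nzD)).
  have := is_deriveB d1 d2; rewrite /GRing.scale/= => h.
  have e : (fun q => f1 q * (D q)^-1) - (fun q => s * N q) *
      ((fun q => (D q)^-1) * (fun q => (D q)^-1)) = G.
    apply/funext => q; rewrite /G [LHS]/(_ - _ * (_ * _)).
    by rewrite -invfM -expr2.
  rewrite -e; apply: is_derive_eq h _.
  rewrite [X in X - _ = _](_ : _ = f2 a / D a - s * f1 a / D a ^+ 2); last by field.
  change (f2 a / D a - s * f1 a / D a ^+ 2 -
   (s * N a * ((D a)^-1 * (- D a ^- 2 * s) + (D a)^-1 * (- D a ^- 2 * s)) +
    (D a)^-1 * (D a)^-1 * (s * f1 a)) =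
   f2 a / D a - 2 * s * f1 a / D a ^+ 2 + 2 * N a / D a ^+ 3).
  transitivity (f2 a / D a - s * f1 a / D a ^+ 2 -
    (s * f1 a / D a ^+ 2 - 2 * s ^+ 2 * N a / D a ^+ 3)); first by field.
  by rewrite s2; field.
rewrite derive1E (near_eq_derive _ FG)//; case: Gd => _ -> .
have NE : N a = D a by [].
have D0' : 0 < D a by [].
rewrite NE => h.
have : (f2 a / D a - 2 * s * f1 a / D a ^+ 2 + 2 * D a / D a ^+ 3) * D a ^+ 2 < 0.
  by rewrite pmulr_llt0// exprn_gt0.
have -> : (f2 a / D a - 2 * s * f1 a / D a ^+ 2 + 2 * D a / D a ^+ 3) * D a ^+ 2 =
  f2 a * D a - 2 * (s * f1 a) + 2 by field.
have sn : `|s| = 1 by apply/eqP; rewrite -sqr_norm_eq1 s2.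
have : s * f1 a <= 1.
  by apply: le_trans (ler_norm _) _; rewrite normrM sn mul1r.
move=> h1 h2; rewrite -(pmulr_llt0 _ D0'); lra.
Qed.

End quotient_second_derivative.

Section local_contact.
Context {R : realType}.
Local Notation T := (torus R).
Implicit Types (phi psi : T -> R) (a b m h r : R) (x z : T * T).

Lemma derive_line (F : 'rV[R]_2 -> R) (v c : 'rV[R]_2) :
  'D_v F c = derive1 (fun t : R => F (t *: v + c)) 0.
Proof.
rewrite /derive1 /derive; set A := fun h : R => _; set B := fun h : R => _.
rewrite (_ : A = B)//; apply/funext => t.
by rewrite /A /B addr0 scale0r add0r.
Qed.

Lemma derive1_shift (f : R -> R) a :
  derive1 (fun t => f (t + a)) 0 = derive1 f a.
Proof.
rewrite /derive1; set A := fun h : R => _; set B := fun h : R => _.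
by rewrite (_ : A = B)//; apply/funext => t; rewrite /A /B addr0 add0r.
Qed.

Lemma row2_line1 a b t : t *: delta_mx 0 ord0 + row2 a b = row2 (t + a) b.
Proof.
apply/rowP => j; rewrite !mxE; case: j => -[|[|//]] hj /=.
  by rewrite mulr1.
by rewrite mulr0 add0r.
Qed.

Lemma row2_line2 a b t : t *: delta_mx 0 ord_max + row2 a b = row2 a (t + b).
Proof.
apply/rowP => j; rewrite !mxE; case: j => -[|[|//]] hj /=.
  by rewrite mulr0 add0r.
by rewrite mulr1.
Qed.

Lemma derive_row2_1 (F : 'rV[R]_2 -> R) a b :
  'D_(delta_mx 0 ord0) F (row2 a b) = derive1 (fun p => F (row2 p b)) a.
Proof.
rewrite derive_line -[RHS]derive1_shift; apply: (congr1 (fun g => derive1 g 0)).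
by apply/funext => u; rewrite row2_line1.
Qed.

Lemma derive_row2_2 (F : 'rV[R]_2 -> R) a b :
  'D_(delta_mx 0 ord_max) F (row2 a b) = derive1 (fun p => F (row2 a p)) b.
Proof.
rewrite derive_line -[RHS]derive1_shift; apply: (congr1 (fun g => derive1 g 0)).
by apply/funext => u; rewrite row2_line2.
Qed.

Lemma hessian_line1 (F : 'rV[R]_2 -> R) a b :
  hessian F (row2 a b) ord0 ord0 = derive1 (derive1 (fun p => F (row2 p b))) a.
Proof.
rewrite mxE derive_row2_1; apply: (congr1 (fun g => derive1 g a)).
by apply/funext => t; rewrite derive_row2_1.
Qed.

Lemma hessian_line2 (F : 'rV[R]_2 -> R) a b :
  hessian F (row2 a b) ord_max ord_max =
  derive1 (derive1 (fun p => F (row2 a p))) b.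
Proof.
rewrite mxE derive_row2_2; apply: (congr1 (fun g => derive1 g b)).
by apply/funext => t; rewrite derive_row2_2.
Qed.

Lemma negative_definite_diag n (H : 'M[R]_n) i : negative_definite H -> H i i < 0.
Proof.
move=> /(_ (delta_mx 0 i)).
have nz : delta_mx 0 i != 0 :> 'rV[R]_n.
  apply/eqP => /rowP /(_ i); rewrite !mxE !eqxx => /eqP; by rewrite oner_eq0.
move=> /(_ nz); rewrite -rowE trmx_delta -colE; by rewrite !mxE.
Qed.

(** With one coordinate fixed, contact puts the other potential below a translate of the distance,
    which bounds its slope by 1; the diagonal Hessian entries then give concavity of each potential.
    In the second variable the denominator reads 2 - s (p - a), hence the change of sign. *)
Lemma contact_concave phi psi x a b (f1 f2 g1 g2 : R -> R) :
  (forall t : R, is_derive t 1 (phi \o @tproj R) (f1 t)) ->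
  (forall t : R, is_derive t 1 f1 (f2 t)) ->
  (forall t : R, is_derive t 1 (psi \o @tproj R) (g1 t)) ->
  (forall t : R, is_derive t 1 g1 (g2 t)) ->
  (forall z, 0 <= gap (phi, psi) z) -> gap (phi, psi) x = 0 ->
  tproj a = x.1 -> tproj b = x.2 -> tdist x.1 x.2 = `|a - b| ->
  negative_definite (hessian (Flocal phi psi (b <= a)) (row2 a b)) ->
  f2 a < 0 /\ g2 b < 0.
Proof.
move=> fd1 fd2 gd1 gd2 g0 gx ax bx dx H.
have f1c := is_derive1_continuous fd2; have g1c := is_derive1_continuous gd2.
have gxE : phi (tproj a) + psi (tproj b) = 2 + `|a - b|.
  by move: gx; rewrite /gap/= -ax -bx -{1}dx ax bx; lra.
have s1 : `|f1 a| <= 1.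
  apply: (derive_slope_le1 fd1 f1c) => p /=.
  have := g0 (tproj p, tproj b); rewrite /gap/=.
  have := tdist_proj p b; have := ler_distD a p b; lra.
have s2 : `|g1 b| <= 1.
  apply: (derive_slope_le1 gd1 g1c) => p /=.
  have := g0 (tproj a, tproj p); rewrite /gap/=.
  have := tdist_proj a p; have := ler_distD b a p; rewrite (distrC b p); lra.
pose s : R := if b <= a then 1 else -1.
have sE : s * (a - b) = `|a - b|.
  rewrite /s; case: (leP b a) => ab; first by rewrite mul1r ger0_norm ?subr_ge0.
  by rewrite mulN1r ltr0_norm ?subr_lt0.
have ss : s ^+ 2 = 1 by rewrite /s; case: ifP; rewrite ?sqrrN expr1n.
have D0 : 0 < 2 + s * (a - b) by rewrite sE; have := normr_ge0 (a - b); lra.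
have := negative_definite_diag ord0 H; have := negative_definite_diag ord_max H.
rewrite hessian_line1 hessian_line2.
have -> : (fun p => Flocal phi psi (b <= a) (row2 p b)) =
    fun p => ((phi \o @tproj R) p + psi (tproj b)) / (2 + s * (p - b)).
  apply/funext => p; rewrite /Flocal !mxE /= /s; congr (_ / (2 + _)).
  by case: (b <= a); [rewrite mul1r | rewrite mulN1r opprB].
have -> : (fun p => Flocal phi psi (b <= a) (row2 a p)) =
    fun p => ((psi \o @tproj R) p + phi (tproj a)) / (2 + - s * (p - a)).
  apply/funext => p; rewrite /Flocal !mxE /= /s addrC; congr (_ / (2 + _)).
  by case: (b <= a); [rewrite mulN1r opprB | rewrite opprK mul1r].
move=> h2 h1; split.
  by apply: (quotient_second_derivative fd1 fd2 ss D0 _ s1 h1); rewrite sE -gxE.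
have ss' : (- s) ^+ 2 = 1 by rewrite sqrrN.
have sE' : - s * (b - a) = `|a - b| by rewrite -sE; ring.
have D0' : 0 < 2 + - s * (b - a) by rewrite sE' -sE.
apply: (quotient_second_derivative gd1 gd2 ss' D0' _ s2 h2).
by rewrite sE' -gxE addrC.
Qed.

(* At antipodal points the distance has a concave kink, which a C^2 potential
   cannot touch from below. *)
Lemma contact_not_antipodal phi psi x a b C : tproj a = x.1 -> tproj b = x.2 ->
  (forall m h, `|second_diff phi m h| <= C * h ^+ 2) ->
  (forall z, 0 <= gap (phi, psi) z) -> gap (phi, psi) x = 0 ->
  tdist x.1 x.2 = `|a - b| -> `|a - b| < 2^-1.
Proof.
move=> ax bx hC g0 gx dx; rewrite lt_neqAle -dx tdist_le1 andbT dx.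
apply/eqP => ab.
(* This [h] gives C h^2 <= h, whereas feasibility at the two neighbours of [a], both closer to [b]
   by [h], makes the second difference at most - 2 h. *)
pose h : R := Num.min 2^-1 (`|C| + 1)^-1.
have C1 : 0 < `|C| + 1 by rewrite ltr_wpDl.
have h0 : 0 < h by rewrite lt_min !invr_gt0 C1 ltr0n.
have h12 : h <= 2^-1 by rewrite /h ge_min lexx.
have hC1 : (`|C| + 1) * h <= 1.
  by rewrite -ler_pdivlMl// mulr1 /h ge_min lexx orbT.
have near p : (p = a + h) \/ (p = a - h) -> tdist (tproj p) (tproj b) <= 2^-1 - h.
  move=> hp.
  have [k hk] : exists k : int, `|p - b + k%:~R| <= 2^-1 - h.
    case: (ler0P (a - b)) ab => _ ab; case: hp => ->.
    - by exists 0; rewrite addr0 ler_norml; apply/andP; split; lra.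
    - by exists 1; rewrite ler_norml; apply/andP; split; lra.
    - by exists (-1); rewrite ler_norml; apply/andP; split; lra.
    - by exists 0; rewrite addr0 ler_norml; apply/andP; split; lra.
  apply: le_trans hk; rewrite -(tprojDz p k).
  by apply: le_trans (tdist_proj _ _) _; rewrite addrAC.
have := g0 (tproj (a + h), tproj b); have := g0 (tproj (a - h), tproj b).
have := near (a + h) (or_introl erefl); have := near (a - h) (or_intror erefl).
move: gx; rewrite /gap/= dx ab -ax -bx => e1 e2 e3 e4 e5.
have := hC a h; rewrite /second_diff => /ler_normlP[h3 _].
have : C * h ^+ 2 <= h.
  rewrite expr2 mulrA; have := ler_norm C; nra.
lra.
Qed.

Lemma second_diffN (f : T -> R) m h : second_diff f m (- h) = second_diff f m h.
Proof. by rewrite /second_diff opprK [X in X - _]addrC. Qed.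

Lemma tdist_rep_at a (y : T) : exists2 c, tproj c = y & tdist (tproj a) y = `|a - c|.
Proof.
have [k kE] := tdist_ex (tproj a) y; have [j jE] := trep_proj a.
exists (trep y - (j + k)%:~R); first by rewrite -intrN tprojDz trepK.
by rewrite kE jE intrD; congr `|_|; ring.
Qed.

(* Two contact points would make the midpoint violate feasibility, because
   the potentials are strictly concave and the distance is locally convex. *)
Lemma contact_locally_unique phi psi x a b (f1 f2 g1 g2 : R -> R) :
  (forall t : R, is_derive t 1 (phi \o @tproj R) (f1 t)) ->
  (forall t : R, is_derive t 1 f1 (f2 t)) -> continuous f2 -> f2 a < 0 ->
  (forall t : R, is_derive t 1 (psi \o @tproj R) (g1 t)) ->
  (forall t : R, is_derive t 1 g1 (g2 t)) -> continuous g2 -> g2 b < 0 ->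
  tproj a = x.1 -> tproj b = x.2 -> `|a - b| < 2^-1 ->
  exists2 rk : R * R, 0 < rk.1 /\ 0 < rk.2 &
  forall eta : (T -> R) * (T -> R), (forall z, 0 <= gap eta z) ->
  (forall m h, `|second_diff eta.1 m h - second_diff phi m h| <= rk.2 * h ^+ 2) ->
  (forall m h, `|second_diff eta.2 m h - second_diff psi m h| <= rk.2 * h ^+ 2) ->
  forall z w, gap eta z = 0 -> gap eta w = 0 ->
  tdist z.1 x.1 < rk.1 -> tdist z.2 x.2 < rk.1 ->
  tdist w.1 x.1 < rk.1 -> tdist w.2 x.2 < rk.1 -> z = w.
Proof.
(* Near [c] the second derivative stays below ddf c / 2 = - 2 k with k = - ddf c / 4. Half of this
   concavity may be lost to the perturbation; the other half remains strict. *)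
have conc (f df ddf : R -> R) c : (forall t : R, is_derive t 1 f (df t)) ->
    (forall t : R, is_derive t 1 df (ddf t)) -> continuous ddf -> ddf c < 0 ->
    exists2 rk : R * R, 0 < rk.1 /\ 0 < rk.2 & forall m h,
    `|m - c| + `|h| < rk.1 ->
    f (m + `|h|) + f (m - `|h|) - 2 * f m <= - (2 * rk.2) * h ^+ 2.
  move=> d1 d2 c2 neg; have e0 : 0 < - ddf c / 2 by lra.
  have /cvgrPdist_lt /(_ _ e0) /nbhs_ballP[d /= d0 hd] := c2 c.
  exists (d, - ddf c / 4) => [/=|m h /= hm]; first by split=> //; lra.
  have -> : h ^+ 2 = `|h| ^+ 2 by rewrite -normrX ger0_norm ?sqr_ge0.
  apply: (second_difference_le d1 d2) => // y /andP[y1 y2].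
  have : `|ddf c - ddf y| < - ddf c / 2.
    apply: hd; rewrite /ball/=; apply: le_lt_trans hm.
    have := ler_norm (m - c); have := ler_norm (c - m); rewrite (distrC c m).
    by move=> h1 h2; rewrite ler_norml; apply/andP; split; lra.
  by move=> /ltr_normlP[h1 _]; lra.
move=> fd1 fd2 f2c f2a gd1 gd2 g2c g2b ax bx ab.
have [[r1 k1] /= [r10 k10] H1] := conc _ _ _ _ fd1 fd2 f2c f2a.
have [[r2 k2] /= [r20 k20] H2] := conc _ _ _ _ gd1 gd2 g2c g2b.
(* The first two terms keep midpoints and half differences inside the concavity ranges. The last
   keeps the two coordinates of each contact point within 1/2 on the line, where [tdist] is the
   modulus of the difference. *)
pose r := Num.min (Num.min (r1 / 2) (r2 / 2)) ((2^-1 - `|a - b|) / 4).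
have r0 : 0 < r by rewrite !lt_min !divr_gt0//= subr_gt0.
have rr1 : r <= r1 / 2 by rewrite /r !ge_min lexx.
have rr2 : r <= r2 / 2 by rewrite /r !ge_min lexx orbT.
have rr3 : r <= (2^-1 - `|a - b|) / 4 by rewrite /r !ge_min lexx !orbT.
exists (r, Num.min k1 k2) => /= [|eta g0 h1 h2 z w gz gw z1 z2 w1 w2].
  by split=> //; rewrite lt_min k10 k20.
rewrite tdist_sym -ax in z1; rewrite tdist_sym -ax in w1.
rewrite tdist_sym -bx in z2; rewrite tdist_sym -bx in w2.
have [a1 a1E] := tdist_rep_at a z.1; have [a2 a2E] := tdist_rep_at a w.1.
have [b1 b1E] := tdist_rep_at b z.2; have [b2 b2E] := tdist_rep_at b w.2.
move=> db2 db1 da2 da1; rewrite da1 in z1; rewrite da2 in w1.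
rewrite db1 in z2; rewrite db2 in w2.
have dist1 : tdist z.1 z.2 = `|a1 - b1|.
  rewrite -a1E -b1E tdist_half//.
  have := ler_distD a a1 b1; have := ler_distD b a b1; rewrite (distrC a1 a); lra.
have dist2 : tdist w.1 w.2 = `|a2 - b2|.
  rewrite -a2E -b2E tdist_half//.
  have := ler_distD a a2 b2; have := ler_distD b a b2; rewrite (distrC a2 a); lra.
pose ma := (a1 + a2) / 2; pose ha := (a1 - a2) / 2.
pose mb := (b1 + b2) / 2; pose hb := (b1 - b2) / 2.
have half (c c1 c2 : R) : `|c - c1| < r -> `|c - c2| < r ->
    `|(c1 + c2) / 2 - c| + `|(c1 - c2) / 2| < 2 * r.
  move=> /ltr_normlP[l1 l2] /ltr_normlP[l3 l4].
  by case: (ler0P ((c1 + c2) / 2 - c)) => ?; case: (ler0P ((c1 - c2) / 2)) => ?; lra.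
have c1 : second_diff phi ma `|ha| <= - (2 * k1) * ha ^+ 2.
  by apply: H1; have := half _ _ _ z1 w1; rewrite -/ma -/ha; lra.
have c2 : second_diff psi mb `|hb| <= - (2 * k2) * hb ^+ 2.
  by apply: H2; have := half _ _ _ z2 w2; rewrite -/mb -/hb; lra.
have sdabs (f : T -> R) m h : second_diff f m `|h| = second_diff f m h.
  by case: (ler0P h) => // _; rewrite second_diffN.
rewrite !sdabs in c1 c2.
have /ler_normlP[_ e1] := h1 ma ha; have /ler_normlP[_ e2] := h2 mb hb.
have k1le : Num.min k1 k2 <= k1 by rewrite ge_min lexx.
have k2le : Num.min k1 k2 <= k2 by rewrite ge_min lexx orbT.
have q1 : Num.min k1 k2 * ha ^+ 2 <= k1 * ha ^+ 2 by rewrite ler_wpM2r ?sqr_ge0.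
have q2 : Num.min k1 k2 * hb ^+ 2 <= k2 * hb ^+ 2 by rewrite ler_wpM2r ?sqr_ge0.
have mid : 0 <= second_diff eta.1 ma ha + second_diff eta.2 mb hb.
  have := g0 (tproj ma, tproj mb); move: gz gw; rewrite /gap/= dist1 dist2.
  rewrite /second_diff -a1E -a2E -b1E -b2E.
  have -> : ma + ha = a1 by rewrite /ma /ha; field.
  have -> : ma - ha = a2 by rewrite /ma /ha; field.
  have -> : mb + hb = b1 by rewrite /mb /hb; field.
  have -> : mb - hb = b2 by rewrite /mb /hb; field.
  have := tdist_proj ma mb.
  have -> : ma - mb = (a1 - b1 + (a2 - b2)) / 2 by rewrite /ma /mb; field.
  rewrite normrM (_ : `|2^-1| = 2^-1); last by rewrite ger0_norm.
  have := ler_normD (a1 - b1) (a2 - b2); lra.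
have P1 : 0 <= k1 * ha ^+ 2 by rewrite mulr_ge0 ?sqr_ge0// ltW.
have P2 : 0 <= k2 * hb ^+ 2 by rewrite mulr_ge0 ?sqr_ge0// ltW.
have za : k1 * ha ^+ 2 = 0 by lra.
have zb : k2 * hb ^+ 2 = 0 by lra.
have ha0 : ha = 0 by apply/eqP; rewrite -sqrf_eq0; move/eqP: za;
  rewrite mulf_eq0 (gt_eqF k10).
have hb0 : hb = 0 by apply/eqP; rewrite -sqrf_eq0; move/eqP: zb;
  rewrite mulf_eq0 (gt_eqF k20).
rewrite [z]surjective_pairing [w]surjective_pairing -a1E -a2E -b1E -b2E.
by congr (tproj _, tproj _); move: ha0 hb0; rewrite /ha /hb; lra.
Qed.

End local_contact.

(** * Stability of the dual solution *)

Section minima.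
Context {R : realType}.
Local Notation T := (torus R).
Implicit Types (x z w : T * T).

Lemma min_lip (a b a' b' e : R) : `|a - a'| <= e -> `|b - b'| <= e ->
  `|Num.min a b - Num.min a' b'| <= e.
Proof.
move=> /ler_normlP[h1 h2] /ler_normlP[h3 h4]; rewrite ler_norml.
have [ab|ab] := leP a b; have [ab'|ab'] := leP a' b';
  apply/andP; split; lra.
Qed.

Definition tdist2 z w : R := tdist z.1 w.1 + tdist z.2 w.2.

Lemma tdist2_lip x z w : `|tdist2 z x - tdist2 w x| <= tdist z.1 w.1 + tdist z.2 w.2.
Proof.
have := tdist_triangle w.1 z.1 x.1; have := tdist_triangle w.2 z.2 x.2.
have := tdist_triangle z.1 w.1 x.1; have := tdist_triangle z.2 w.2 x.2.
rewrite (tdist_sym w.1 z.1) (tdist_sym w.2 z.2) /tdist2 ler_norml.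
by move=> h1 h2 h3 h4; apply/andP; split; lra.
Qed.

Lemma finite_lower_bound n (f : 'I_n -> R) : (forall i, 0 < f i) ->
  exists2 e, 0 < e & forall i, e <= f i.
Proof.
move=> f0; exists (\big[Num.min/1]_i f i); last by move=> i; exact: bigmin_le_cond.
by elim/big_ind : _ => // x y x0 y0; rewrite lt_min x0.
Qed.

End minima.

(** * Linear constraints indexed by T x T in an abstract semi-inner product space *)

Section perturbed_dual.
Context {R : realType} {V : lmodType R} (B : semi_inner V).
Local Notation T := (torus R).
Local Notation nrm := (nrm B).
Variables (D : T * T -> V) (L M : R).
Hypotheses (L0 : 0 <= L) (M0 : 0 <= M).
Hypothesis DL : forall z w, nrm (D z - D w) <= L * (tdist z.1 w.1 + tdist z.2 w.2).
Hypothesis DM : forall z, nrm (D z) <= M.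
Implicit Types (p q d y : V) (z w : T * T).

Definition feasible : set V := [set p | forall z, B p (D z) <= 1].

Lemma dot_atom_bound p z : `|B p (D z)| <= nrm p * M.
Proof.
apply: le_trans (dot_cauchy _ _ _) _.
by apply: ler_wpM2l; [exact: nrm_ge0 | exact: DM].
Qed.

Lemma continuous_dot_atom (a b : R) p : continuous (fun z => a + b * B p (D z)).
Proof.
apply: (@lip2_continuous _ (`|b| * (nrm p * L))).
  by rewrite !mulr_ge0 ?nrm_ge0.
move=> z w; rewrite [X in `|X|](_ : _ = b * B p (D z - D w)); last first.
  by rewrite dotDr dotNr; ring.
rewrite normrM -mulrA ler_wpM2l//.
apply: le_trans (dot_cauchy _ _ _) _.
by rewrite -mulrA ler_wpM2l ?nrm_ge0.
Qed.

Lemma feasible_convex : segment_closed feasible.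
Proof.
move=> p q t hp hq /andP[t0 t1] z; rewrite !(dotDl, dotZl, dotNl).
have := hp z; have := hq z => h1 h2.
have : (1 - t) * B p (D z) <= (1 - t) * 1 by rewrite ler_wpM2l// subr_ge0.
have : t * B q (D z) <= t * 1 by rewrite ler_wpM2l.
lra.
Qed.

Lemma feasible_closed : nrm_closed B feasible.
Proof.
move=> u l hu ul z; rewrite leNgt; apply/negP => h.
have e0 : 0 < (B (D z) l - 1) / 2 by rewrite dotC; lra.
have [N /(_ N (leqnn N))] := nrm_cvg_dot (D z) ul e0.
move=> /ler_normlP[h1 _]; have := hu N z; rewrite dotC.
by move=> h2; rewrite dotC in h; lra.
Qed.

Lemma feasible0 : feasible 0.
Proof. by move=> z; rewrite dot0l. Qed.

(* Moving from p along d - delta p stays feasible for a short time, since it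
   strictly decreases the active constraints. *)
Lemma feasible_kkt y p d : is_proj B feasible y p ->
  (forall z, B p (D z) = 1 -> B d (D z) <= 0) -> B d (y - p) <= 0.
Proof.
move=> [fp hp] hd; rewrite leNgt; apply/negP => dq.
have pq : 0 <= B p (y - p).
  by have := hp _ feasible0; rewrite sub0r dotNr dotC; lra.
(* At least half of [B d (y - p)] survives the subtraction of [de *: p]; the added 1 covers B p (y -
   p) = 0. *)
pose de := B d (y - p) / (2 * (B p (y - p) + 1)).
have de0 : 0 < de by rewrite divr_gt0//; lra.
have deE : 2 * (de * B p (y - p)) <= B d (y - p).
  have : de * (2 * (B p (y - p) + 1)) = B d (y - p).
    by rewrite /de divfK// gt_eqF//; lra.
  by lra.
pose d' := d - de *: p.
have Gc : continuous (fun z => B d' (D z)).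
  have := @continuous_dot_atom 0 1 d'.
  by under eq_fun do rewrite add0r mul1r.
have Fc : continuous (fun z => 1 - B p (D z)).
  have := @continuous_dot_atom 1 (- 1) p.
  by under eq_fun do rewrite mulN1r.
(* Where [d'] does not decrease the constraint, compactness leaves a uniform slack [c], which
   determines the step [t]. *)
have [z Gz|c c0 hc] := compact_lower_bound Fc Gc.
  rewrite lt_neqAle subr_ge0 fp andbT; apply/eqP => h.
  have pz : B p (D z) = 1 by lra.
  have := hd _ pz; move: Gz; rewrite /d' dotDl dotNl dotZl pz; lra.
have M1 : 0 < nrm d' * M + 1 by rewrite ltr_wpDl// mulr_ge0 ?nrm_ge0.
pose t := c / (nrm d' * M + 1).
have t0 : 0 < t by rewrite divr_gt0.
have tE : t * (nrm d' * M) <= c.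
  have : t * (nrm d' * M + 1) = c by rewrite /t divfK// gt_eqF.
  by lra.
have f' : feasible (p + t *: d').
  move=> z; rewrite dotDl dotZl; have [Gz|Gz] := leP 0 (B d' (D z)).
    have := hc z Gz; have := dot_atom_bound d' z => /ler_normlP[_ h1] h2.
    have : t * B d' (D z) <= t * (nrm d' * M) by rewrite ler_wpM2l// ltW.
    lra.
  have : t * B d' (D z) <= 0 by rewrite pmulr_rle0// ltW.
  have := fp z; lra.
have := hp _ f'; rewrite (addrC p) addrK dotZr pmulr_rle0// dotC.
rewrite /d' dotDl dotNl dotZl; nra.
Qed.

Section stability.
Variables (n : nat) (x0 : 'I_n -> T * T) (c0 : 'I_n -> R) (y0 p0 : V) (r rho0 : R).
Hypothesis Bcomplete : nrm_complete B.
Hypothesis c0_gt0 : forall i, 0 < c0 i.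
Hypothesis y0E : nrm (y0 - \sum_i c0 i *: D (x0 i)) = 0.
Hypothesis p0_feasible : feasible p0.
Hypothesis p0_max : forall q, feasible q -> B y0 q <= B y0 p0.
Hypothesis p0_min : forall q, feasible q ->
  (forall p, feasible p -> B y0 p <= B y0 q) -> nrm p0 <= nrm q.
Hypothesis contactP : forall z, B p0 (D z) = 1 -> exists i, z = x0 i.
Hypothesis D_free : free_family B (D \o x0).
Hypotheses (r0 : 0 < r) (rho00 : 0 < rho0).
Hypothesis locally_unique : forall p i z w, feasible p -> nrm (p - p0) <= rho0 ->
  B p (D z) = 1 -> B p (D w) = 1 -> tdist2 z (x0 i) < r -> tdist2 w (x0 i) < r ->
  z = w.

Lemma contact_localized s : 0 < s -> exists2 rho, 0 < rho &
  forall p z, nrm (p - p0) <= rho -> B p (D z) = 1 ->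
  exists i, tdist2 z (x0 i) < s.
Proof.
(* [G] is nonnegative exactly at distance at least [s] from all the [x0 i]; the default value [s] of
   the minimum makes this right for n = 0 as well. *)
move=> s0; pose G z : R := \big[Num.min/s]_i tdist2 z (x0 i) - s.
have Gc : continuous G.
  apply: (@lip2_continuous _ 1) => // z w; rewrite mul1r /G opprB addrA subrK.
  have d0 : 0 <= tdist z.1 w.1 + tdist z.2 w.2 by rewrite addr_ge0 ?tdist_ge0.
  apply: (big_ind2 (fun a b : R => `|a - b| <= tdist z.1 w.1 + tdist z.2 w.2)).
  - by rewrite subrr normr0.
  - by move=> a a' b b'; exact: min_lip.
  - by move=> i _; exact: tdist2_lip.
have Fc : continuous (fun z => 1 - B p0 (D z)).
  have := @continuous_dot_atom 1 (- 1) p0.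
  by under eq_fun do rewrite mulN1r.
have [z Gz|c c1 hc] := compact_lower_bound Fc Gc.
  rewrite lt_neqAle subr_ge0 p0_feasible andbT; apply/eqP => h.
  have [|i zi] := @contactP z; first lra.
  have : \big[Num.min/s]_i tdist2 z (x0 i) <= tdist2 z (x0 i) by exact: bigmin_le_cond.
  by move: Gz; rewrite /G {3}zi /tdist2 !tdistxx; lra.
have M1 : 0 < M + 1 by rewrite ltr_wpDl.
exists (c / (2 * (M + 1))) => [|p z pp0 pz]; first by rewrite divr_gt0// mulr_gt0.
have : G z < 0.
  rewrite ltNge; apply/negP => Gz; have := hc z Gz.
  have := dot_atom_bound (p - p0) z => /ler_normlP[_].
  rewrite dotDl dotNl pz => h1.
  have : nrm (p - p0) * M <= c / (2 * (M + 1)) * (M + 1).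
    by apply: ler_pM => //; [exact: nrm_ge0 | rewrite lerDl].
  rewrite (_ : c / (2 * (M + 1)) * (M + 1) = c / 2); last first.
    by field; rewrite gt_eqF.
  lra.
rewrite /G subr_lt0 => h; apply/existsP; rewrite -[X in is_true X]negbK.
apply/negP => /existsPn hn; move: h; rewrite ltNge => /negP; apply.
elim/big_ind : _ => // [a b ha hb|i _]; first by rewrite le_min ha.
by have := hn i; rewrite -leNgt.
Qed.

Lemma stability e : 0 < e -> e <= r -> exists alpha lambda0, [/\ 0 < alpha, 0 < lambda0 &
  forall (lambda : R) (w p : V), 0 < lambda <= lambda0 -> nrm w <= alpha * lambda ->
  is_proj B feasible (lambda^-1 *: (y0 + w)) p ->
  exists (x : 'I_n -> T * T) (c : 'I_n -> R), [/\
    forall i, [/\ tdist2 (x i) (x0 i) < e, B p (D (x i)) = 1, 0 < c i & `|c i - c0 i| <= e],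
    forall z, B p (D z) = 1 -> exists i, z = x i,
    forall i z, tdist2 z (x0 i) < r -> B p (D z) = 1 -> z = x i,
    free_family B (D \o x) &
    nrm (y0 + w - lambda *: p - \sum_i c i *: D (x i)) = 0]].
Proof.
move=> e0 er.
have [pd pdE] := dual_basis D_free.
have [Dc [t [Dc0 t0 hfree]]] := free_perturbation pdE.
have [cm cm0 cmP] := finite_lower_bound c0_gt0.
(* [cm] is a lower bound of the [c0 i], so an error of cm / 2 keeps the new coefficients
   positive. *)
pose e' := Num.min e (cm / 2).
have e'0 : 0 < e' by rewrite lt_min e0 divr_gt0.
have e'e : e' <= e by rewrite /e' ge_min lexx.
have e'c : e' <= cm / 2 by rewrite /e' ge_min lexx orbT.
pose S := \sum_i c0 i.
have S0 : 0 <= S by apply: sumr_ge0 => i _; exact/ltW.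
have L1 : 0 < L + 1 by rewrite ltr_wpDl.
have DSL : 0 < 2 * (Dc * ((S + 1) * (L + 1))).
  by rewrite mulr_gt0// mulr_gt0// mulr_gt0// ltr_wpDl.
(* Points moved by [s] change their atoms by at most L s: the second term keeps this within the
   range [t] of [free_perturbation], the third limits its effect on the coefficients to e' / 2. *)
pose s := Num.min e (Num.min (t / (L + 1)) (e' / (2 * (Dc * ((S + 1) * (L + 1)))))).
have s0 : 0 < s by rewrite !lt_min e0 !divr_gt0.
have se : s <= e by rewrite /s !ge_min lexx.
have st : L * s <= t.
  have : s <= t / (L + 1) by rewrite /s !ge_min lexx !orbT.
  by rewrite ler_pdivlMr//; nra.
have sS : Dc * (S * (L * s)) <= e' / 2.
  have : s <= e' / (2 * (Dc * ((S + 1) * (L + 1)))) by rewrite /s !ge_min lexx !orbT.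
  rewrite ler_pdivlMr// => h.
  have : Dc * (S * (L * s)) <= Dc * ((S + 1) * ((L + 1) * s)).
    rewrite ler_wpM2l ?(ltW Dc0)//; apply: ler_pM => //; [|lra|].
      by rewrite mulr_ge0 ?(ltW s0).
    by rewrite ler_wpM2r ?(ltW s0)//; lra.
  lra.
have [rho1 rho10 hloc] := contact_localized s0.
pose rho := Num.min rho0 rho1.
have rho_gt0 : 0 < rho by rewrite lt_min rho00.
have rhor0 : rho <= rho0 by rewrite /rho ge_min lexx.
have rhor1 : rho <= rho1 by rewrite /rho ge_min lexx orbT.
have rho2 : 0 < rho / 2 by rewrite divr_gt0.
have [l1 l10 hl1] := proj_path_cvg Bcomplete feasible_closed feasible_convex
  p0_feasible p0_max p0_min rho2.
(* Noise and lam |p| move the residual away from [y0] by at most lam (rho / 2 + |p0| + rho).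
   Multiplied by [Dc] this stays below lam K, which may use the other half of [e']. *)
pose K := Dc * (rho / 2 + nrm p0 + rho) + 1.
have K0 : 0 < K.
  by rewrite ltr_wpDl// mulr_ge0 ?(ltW Dc0)// !addr_ge0 ?nrm_ge0 ?(ltW rho2) ?(ltW rho_gt0).
exists (rho / 2), (Num.min l1 (e' / (2 * K))); split => //.
  by rewrite lt_min l10 divr_gt0// mulr_gt0.
move=> lam w p /andP[lam0]; rewrite le_min => /andP[laml1 lamK] wle pP.
have lamK' : lam * K <= e' / 2.
  by move: lamK; rewrite ler_pdivlMr ?mulr_gt0//; lra.
have pp0 : nrm (p - p0) <= rho.
  have [p1 p1P] := proj_exists (lam^-1 *: y0) Bcomplete feasible_closed
    feasible_convex (ex_intro _ _ feasible0).
  have := proj_nonexpansive pP p1P.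
  rewrite -scalerBr addrAC subrr add0r nrmZ gtr0_norm ?invr_gt0// => h1.
  have := hl1 lam p1; rewrite lam0 laml1 => /(_ isT p1P) h2.
  have : lam^-1 * nrm w <= rho / 2 by rewrite ler_pdivrMl// mulrC.
  have := nrm_triangle B p1 p p0; lra.
have fp := pP.1.
pose Q i z := tdist2 z (x0 i) < s /\ B p (D z) = 1.
(* Without a contact point near [x0 i], the default [x0 i] keeps the family close to [x0], hence
   free. Positivity of all the coefficients later shows that the default never occurs. *)
pose x i : T * T := if pselect (exists z, Q i z) is left h then projT1 (cid h) else x0 i.
have xQ i z : Q i z -> Q i (x i).
  by rewrite /x; case: pselect => [h _|h hz]; [case: (cid h) | case: h; exists z].
have xs i : tdist2 (x i) (x0 i) < s.
  rewrite /x; case: pselect => [h|_]; first by case: (cid h) => z [].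
  by rewrite /tdist2 !tdistxx addr0.
have xuniq i z : tdist2 z (x0 i) < r -> B p (D z) = 1 -> B p (D (x i)) = 1 -> z = x i.
  move=> zr pz px; apply: (locally_unique (p := p) (i := i)) => //; first lra.
  by apply: lt_le_trans (xs i) _; lra.
have contact z : B p (D z) = 1 -> exists2 i, z = x i & B p (D (x i)) = 1.
  move=> pz; have [|i zi] := hloc p z _ pz; first lra.
  have [_ px] := xQ i z (conj zi pz).
  by exists i => //; apply: xuniq => //; lra.
have Dx i : nrm (D (x i) - D (x0 i)) <= L * s.
  by apply: le_trans (DL _ _) _; rewrite ler_wpM2l// ltW// xs.
have coef (a : 'I_n -> R) : \sum_i `|a i| <= Dc * nrm (\sum_i a i *: D (x i)).
  by apply: (hfree (D \o x)) => i; apply: le_trans (Dx i) _.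
have xfree : free_family B (D \o x).
  move=> a a0 i; have := coef a; rewrite a0 mulr0 => h.
  have /eqP : \sum_i `|a i| = 0.
    by apply/eqP; rewrite eq_le h sumr_ge0.
  by rewrite psumr_eq0// => /allP/(_ i); rewrite mem_index_enum normr_eq0 => /(_ isT)/eqP.
have hcone d : (forall i, B p (D (x i)) == 1 -> B d ((D \o x) i) <= 0) ->
    B d (lam^-1 *: (y0 + w) - p) <= 0.
  move=> hd; apply: feasible_kkt pP _ => z /contact[i -> px].
  by apply: hd; apply/eqP.
have [a [a0 aP aE]] := cone_generated (P := fun i => B p (D (x i)) == 1) xfree hcone.
pose c i := lam * a i.
have cE : nrm (y0 + w - lam *: p - \sum_i c i *: D (x i)) = 0.
  have -> : y0 + w - lam *: p - \sum_i c i *: D (x i) =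
      lam *: (lam^-1 *: (y0 + w) - p - \sum_i a i *: (D \o x) i).
    rewrite !scalerBr scalerA divff ?gt_eqF// scale1r; congr (_ - _).
    by rewrite scaler_sumr; apply: eq_bigr => i _; rewrite scalerA.
  by rewrite nrmZ aE mulr0.
have tel (a1 a2 a3 a4 a5 : V) :
    a1 - a5 = (a1 - a2) + ((a2 - a3) + ((a3 - a4) + (a4 - a5))).
  by rewrite !addrA !subrK.
have cc0 i : `|c i - c0 i| <= e'.
  apply: (@le_trans _ _ (\sum_j `|c j - c0 j|)).
    by rewrite (bigD1 i)//= lerDl sumr_ge0.
  apply: le_trans (coef (fun j => c j - c0 j)) _.
  set X := y0 + w - lam *: p in cE.
  have -> : \sum_j (c j - c0 j) *: D (x j) = (\sum_j c j *: D (x j) - X) + ((X - y0) +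
      ((y0 - \sum_j c0 j *: D (x0 j)) +
       (\sum_j c0 j *: D (x0 j) - \sum_j c0 j *: D (x j)))).
    rewrite -tel -sumrB; apply: eq_bigr => j _; exact: scalerBl.
  have h1 : nrm (\sum_j c0 j *: D (x0 j) - \sum_j c0 j *: D (x j)) <= S * (L * s).
    rewrite -sumrB; apply: le_trans (nrm_sum _ _ _ _) _; rewrite /S mulr_suml.
    apply: ler_sum => j _; rewrite -scalerBr nrmZ gtr0_norm// ler_wpM2l ?(ltW (c0_gt0 _))//.
    by rewrite nrmB.
  have h2 : nrm p <= nrm p0 + rho.
    have := nrmD B (p - p0) p0; rewrite subrK; lra.
  have h3 : nrm (lam *: p) <= lam * (nrm p0 + rho).
    by rewrite nrmZ gtr0_norm// ler_wpM2l// ltW.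
  have h5 : nrm (X - y0) <= rho / 2 * lam + lam * (nrm p0 + rho).
    rewrite /X addrAC (addrC y0) addrK; apply: le_trans (nrmD _ _ _) _.
    by rewrite nrmN lerD.
  apply: le_trans (ler_wpM2l (ltW Dc0) _) _.
    apply: le_trans (nrmD _ _ _) _; rewrite nrmB cE add0r.
    apply: le_trans (nrmD _ _ _) _; apply: lerD h5 _.
    by apply: le_trans (nrmD _ _ _) _; rewrite y0E add0r; exact: h1.
  by move: lamK'; rewrite /K; lra.
have c_gt0 i : 0 < c i.
  by have := cmP i; have /ler_normlP[h _] := cc0 i; lra.
have px i : B p (D (x i)) = 1.
  apply/eqP; apply: contraT => /aP ai; have := c_gt0 i.
  by rewrite /c ai mulr0 ltxx.
exists x, c; split=> //.
- by move=> i; split=> //; [apply: lt_le_trans (xs i) _ | apply: le_trans (cc0 i) _].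
- by move=> z /contact[i -> _]; exists i.
- by move=> i z zr pz; exact: xuniq.
Qed.

End stability.
End perturbed_dual.

(** * The primal problem *)

Lemma quotient_difference (R : realType) (a b b1 b2 b3 b4 d d' : R) :
  a * (2 + d) = b1 + b2 -> b * (2 + d') = b3 + b4 ->
  (a - b) * (2 + d) = b1 - b3 + (b2 - b4) - b * (d - d').
Proof.
move=> h1 h2; rewrite (_ : _ * _ = a * (2 + d) - b * (2 + d') - b * (d - d')).
  by rewrite h1 h2; ring.
by ring.
Qed.

Section Y_space.
Context {R : realType}.
Local Notation T := (torus R).
Local Notation F2 := ((T -> R) * (T -> R))%type.
Local Notation V := (@tL2 R * @tL2 R)%type.
Implicit Types (f g : @tL2 R) (p q : V) (k : T -> R) (z w : T * T).

Definition Ydot p q : R := tL2inner p.1 q.1 + tL2inner p.2 q.2.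

Fact YdotC p q : Ydot p q = Ydot q p.
Proof. by rewrite /Ydot [tL2inner p.1 _]dotC [tL2inner p.2 _]dotC. Qed.

Fact YdotDl p q r : Ydot (p + q) r = Ydot p r + Ydot q r.
Proof.
by rewrite /Ydot addrACA; congr (_ + _); exact: dotDl.
Qed.

Fact YdotZl (a : R) p q : Ydot (a *: p) q = a * Ydot p q.
Proof.
by rewrite /Ydot mulrDr; congr (_ + _); exact: dotZl.
Qed.

Fact Ydot_ge0 p : 0 <= Ydot p p.
Proof. by rewrite addr_ge0 ?dot_ge0. Qed.

Definition Yinner : semi_inner V := SemiInner YdotC YdotDl YdotZl Ydot_ge0.

Lemma nrm_fst_le p : nrm (@tL2inner R) p.1 <= nrm Yinner p.
Proof. by rewrite ler_wsqrtr// lerDl dot_ge0. Qed.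

Lemma nrm_snd_le p : nrm (@tL2inner R) p.2 <= nrm Yinner p.
Proof. by rewrite ler_wsqrtr// lerDr dot_ge0. Qed.

Lemma nrm_pair_le p : nrm Yinner p <= nrm (@tL2inner R) p.1 + nrm (@tL2inner R) p.2.
Proof.
rewrite -(@ler_pXn2r _ 2)// ?nnegrE ?addr_ge0 ?nrm_ge0//.
rewrite sqr_nrm sqrrD !sqr_nrm.
rewrite [leLHS]/(_ + _) addrAC lerDl mulrn_wge0// mulr_ge0 ?nrm_ge0//.
Qed.

Lemma Y_complete : nrm_complete Yinner.
Proof.
move=> u hu.
pose u1 j : @tL2 R := (u j).1; pose u2 j : @tL2 R := (u j).2.
have h1 : nrm_cauchy (@tL2inner R) u1.
  move=> e /hu[N hN]; exists N => j m Nj Nm.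
  exact: le_trans (nrm_fst_le (u j - u m)) (hN j m Nj Nm).
have h2 : nrm_cauchy (@tL2inner R) u2.
  move=> e /hu[N hN]; exists N => j m Nj Nm.
  exact: le_trans (nrm_snd_le (u j - u m)) (hN j m Nj Nm).
have [l1 hl1] := L2_complete (@tleb_setT R) h1.
have [l2 hl2] := L2_complete (@tleb_setT R) h2.
exists (l1, l2) => e e0; have e2 : 0 < e / 2 by rewrite divr_gt0.
have [N1 {}h1] := hl1 _ e2; have [N2 {}h2] := hl2 _ e2.
exists (maxn N1 N2) => j; rewrite geq_max => /andP[j1 j2].
apply: le_trans (nrm_pair_le _) _.
have := h1 j j1; have := h2 j j2; rewrite /=; lra.
Qed.

Definition toF p : F2 := (p.1 : T -> R, p.2 : T -> R).

Lemma inY_toF p : inY (toF p).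
Proof. by split; exact: LfunP. Qed.

Lemma toF_surj (q : F2) : inY q -> exists p, toF p = q.
Proof.
move=> [h1 h2]; exists (toL q.1, toL q.2).
by rewrite /toF /= !toLK//; case: q {h1 h2}.
Qed.

Lemma normY_toF p : normY (toF p) = nrm Yinner p.
Proof. by []. Qed.

Lemma toFB p q : toF (p - q) = toF p - toF q.
Proof. by []. Qed.

Lemma toF_sum n (a : 'I_n -> R) (p : 'I_n -> V) :
  toF (\sum_i a i *: p i) = \sum_i a i *: toF (p i).
Proof.
elim/big_rec2 : _ => // i x y _ <-; by [].
Qed.

Lemma L2_ae_eq f g : nrm (@tL2inner R) (f - g) = 0 <->
  (f : T -> R) = (g : T -> R) %[ae @tleb R].
Proof.
have mh : measurable_fun setT (fun x => ((f - g : @tL2 R) x ^+ 2)%:E : \bar R).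
  apply/measurable_EFinP; apply: measurable_funX; exact: L2_measurable.
have [h1 h2] := ae_eq_integral_abs (@tleb R) measurableT mh.
have e : (\int[@tleb R]_x `|((f - g : @tL2 R) x ^+ 2)%:E| =
    (nrm (@tL2inner R) (f - g) ^+ 2)%:E)%E.
  rewrite -integral_sqr; apply: eq_integral => x _.
  by rewrite abse_EFin ger0_norm// sqr_ge0.
split=> [h|h].
  have := h1; rewrite e h expr0n => /(_ erefl); apply: filterS => x /(_ I)/= [].
  by move=> /eqP; rewrite sqrf_eq0 => /eqP hx _; apply/eqP; rewrite -subr_eq0; apply/eqP.
apply/eqP; rewrite -sqrf_eq0 -(inj_eq (@EFin_inj _)) -e; apply/eqP/h2.
apply: filterS h => x /(_ I) hx _; congr EFin.
rewrite (_ : (f - g : @tL2 R) x = f x - g x)// hx subrr expr0n//.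
Qed.

Lemma eqY_toF p q : eqY (toF p) (toF q) <-> nrm Yinner (p - q) = 0.
Proof.
rewrite /eqY /= -!L2_ae_eq; split=> [[h1 h2]|h].
  by apply/eqP; rewrite eq_le nrm_ge0 andbT; apply: le_trans (nrm_pair_le _) _; rewrite h1 h2 addr0.
split; apply/eqP; rewrite eq_le nrm_ge0 andbT -h.
  exact: (nrm_fst_le (p - q)).
exact: (nrm_snd_le (p - q)).
Qed.

(** * The operators K and its pre-adjoint on L^2 pairs, and the dual constraint *)

Section kernel_operators.
Variables (k1 k2 : T -> R) (C : R).
Hypotheses (C0 : 0 <= C) (k1C : forall x, `|k1 x| <= C) (k2C : forall x, `|k2 x| <= C).
Hypotheses (k1L : tlip C k1) (k2L : tlip C k2).
Local Notation M := (signed_measure T R).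
Local Notation X := (M * M)%type.
Implicit Types (v : X).

Definition KY v : V := (toL (kconv k1 v.1), toL (kconv k2 v.2)).

Lemma Kop_KY v : smpos2 v -> Kop k1 k2 v = toF (KY v).
Proof.
move=> [v1 v2]; rewrite /toF /= !toL_bmeas//; exact: kconv_bmeas.
Qed.

Lemma inXpre_Kpre p : inXpre (Kpre k1 k2 (toF p)).
Proof. by split; apply: tlip_continuous; exact: kpre_lip. Qed.

Lemma pairing_Kpre p v : smpos2 v ->
  pairing (Kpre k1 k2 (toF p)) v = Yinner p (KY v).
Proof.
move=> [v1 v2]; rewrite /pairing /=; congr (_ + _); exact: kpre_adjoint.
Qed.

Definition KD z : V := KY (Datom z).

Lemma dot_KD p z :
  Yinner p (KD z) = (kpre k1 p.1 z.1 + kpre k2 p.2 z.2) / (2 + tdist z.1 z.2).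
Proof.
rewrite -pairing_Kpre; last exact: Datom_pos.
by rewrite pairing_Datom//; exact/inXpre_bmeas2/inXpre_Kpre.
Qed.

Lemma nrm_dual (x : V) c : 0 <= c ->
  (forall p, `|Yinner p x| <= nrm Yinner p * c) -> nrm Yinner x <= c.
Proof.
move=> c0 /(_ x); rewrite ger0_norm ?dot_ge0// -sqr_nrm expr2.
have := nrm_ge0 Yinner x; rewrite le_eqVlt => /predU1P[<-//|x0].
by rewrite ler_pM2l.
Qed.

Lemma KD_bound z : nrm Yinner (KD z) <= C.
Proof.
apply: nrm_dual => // p; rewrite dot_KD normrM normfV (gtr0_norm (den_gt0 z)).
rewrite ler_pdivrMr ?den_gt0//.
have h1 := kpre_bound p.1 z.1 k1L C0 k1C; have h2 := kpre_bound p.2 z.2 k2L C0 k2C.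
apply: le_trans (ler_normD _ _) _.
have l1 := nrm_fst_le p; have l2 := nrm_snd_le p.
have d0 := tdist_ge0 z.1 z.2; have p0 := nrm_ge0 Yinner p.
have : C * nrm (@tL2inner R) p.1 <= C * nrm Yinner p by rewrite ler_wpM2l.
have : C * nrm (@tL2inner R) p.2 <= C * nrm Yinner p by rewrite ler_wpM2l.
have : 0 <= nrm Yinner p * C * tdist z.1 z.2 by rewrite !mulr_ge0.
lra.
Qed.

(** One [C] comes from the variation of the numerators, the other from that of the denominator; the
    factor 2 + d left over is at least 1. *)
Lemma KD_lip z w : nrm Yinner (KD z - KD w) <=
  2 * C * (tdist z.1 w.1 + tdist z.2 w.2).
Proof.
set t := tdist z.1 w.1 + _.
have t0 : 0 <= t by rewrite addr_ge0 ?tdist_ge0.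
apply: nrm_dual => [|p]; first by rewrite !mulr_ge0.
rewrite dotDr dotNr.
have hz : Yinner p (KD z) * (2 + tdist z.1 z.2) = kpre k1 p.1 z.1 + kpre k2 p.2 z.2.
  by rewrite dot_KD divfK// gt_eqF// den_gt0.
have hw : Yinner p (KD w) * (2 + tdist w.1 w.2) = kpre k1 p.1 w.1 + kpre k2 p.2 w.2.
  by rewrite dot_KD divfK// gt_eqF// den_gt0.
have l1 := nrm_fst_le p; have l2 := nrm_snd_le p.
have h1 := kpre_lip p.1 k1L C0 z.1 w.1; have h2 := kpre_lip p.2 k2L C0 z.2 w.2.
have d1 := tdist_ge0 z.1 w.1; have d2 := tdist_ge0 z.2 w.2.
have p0 := nrm_ge0 Yinner p.
have e1 : `|kpre k1 p.1 z.1 - kpre k1 p.1 w.1| <= C * nrm Yinner p * tdist z.1 w.1.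
  by apply: le_trans h1 _; rewrite ler_wpM2r// ler_wpM2l.
have e2 : `|kpre k2 p.2 z.2 - kpre k2 p.2 w.2| <= C * nrm Yinner p * tdist z.2 w.2.
  by apply: le_trans h2 _; rewrite ler_wpM2r// ler_wpM2l.
have bw : `|Yinner p (KD w)| <= nrm Yinner p * C.
  apply: le_trans (dot_cauchy _ _ _) _; rewrite ler_wpM2l//; exact: KD_bound.
have dt : `|tdist z.1 z.2 - tdist w.1 w.2| <= t.
  exact: tdist_lip.
have den : (Yinner p (KD z) - Yinner p (KD w)) * (2 + tdist z.1 z.2) =
   (kpre k1 p.1 z.1 - kpre k1 p.1 w.1) + (kpre k2 p.2 z.2 - kpre k2 p.2 w.2) -
   Yinner p (KD w) * (tdist z.1 z.2 - tdist w.1 w.2).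
  exact: quotient_difference hz hw.
clear hz hw h1 h2.
have e3 : `|Yinner p (KD w) * (tdist z.1 z.2 - tdist w.1 w.2)| <= nrm Yinner p * C * t.
  by rewrite normrM ler_pM.
have : `|(Yinner p (KD z) - Yinner p (KD w)) * (2 + tdist z.1 z.2)| <=
    nrm Yinner p * (2 * C * t).
  rewrite den; apply: le_trans (ler_normB _ _) _.
  apply: le_trans (lerD (ler_normD _ _) (lexx _)) _.
  apply: le_trans (lerD (lerD e1 e2) e3) _.
  rewrite -mulrDr -/t; move: (nrm Yinner p) => N.
  by rewrite (_ : _ + _ = N * (2 * C * t))//; ring.
rewrite normrM (gtr0_norm (den_gt0 z)); apply: le_trans.
by rewrite ler_peMr// -[leLHS]addr0 lerD ?tdist_ge0// ler1n.
Qed.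

Lemma gap_Kpre p z : gap (Kpre k1 k2 (toF p)) z =
  (2 + tdist z.1 z.2) * (1 - Yinner p (KD z)).
Proof.
have : Yinner p (KD z) * (2 + tdist z.1 z.2) = kpre k1 p.1 z.1 + kpre k2 p.2 z.2.
  by rewrite dot_KD divfK// gt_eqF// den_gt0.
by rewrite mulrBr mulr1 mulrC => ->.
Qed.

Lemma gap_Kpre_ge0 p : feasible Yinner KD p ->
  forall z, 0 <= gap (Kpre k1 k2 (toF p)) z.
Proof.
by move=> hp z; rewrite gap_Kpre mulr_ge0 ?(ltW (den_gt0 z))// subr_ge0.
Qed.

Lemma gap_Kpre_eq0 p z : gap (Kpre k1 k2 (toF p)) z = 0 <-> Yinner p (KD z) = 1.
Proof.
rewrite gap_Kpre; split=> [/eqP|->]; last by rewrite subrr mulr0.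
by rewrite mulf_eq0 gt_eqF ?den_gt0//= subr_eq0 => /eqP <-.
Qed.

Lemma dual_feasibleP p : dual_feasible k1 k2 (toF p) <-> feasible Yinner KD p.
Proof.
rewrite /dual_feasible /= subdiff_Greg0; split=> [[_ [_ h]] z|h].
  have := h z; rewrite gap_Kpre pmulr_rge0 ?den_gt0//; lra.
split; [exact: inY_toF | split; [exact: inXpre_Kpre | exact: gap_Kpre_ge0]].
Qed.

Lemma KY_atoms n (c : 'I_n -> R) (z : 'I_n -> T * T) : (forall i, 0 <= c i) ->
  nrm Yinner (KY (\sum_i c i *: Datom (z i)) - \sum_i c i *: KD (z i)) = 0.
Proof.
move=> c0; apply/nrm_eq0.
set d := _ - \sum_i _; rewrite {2}/d dotDr dotNr -pairing_Kpre; last exact: atoms_pos.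
rewrite pairing_atoms//; last exact/inXpre_bmeas2/inXpre_Kpre.
rewrite dot_sumr; apply/eqP; rewrite subr_eq0; apply/eqP/eq_bigr => i _.
by rewrite dotZr -pairing_Kpre//; exact: Datom_pos.
Qed.

(** * Optimality and uniqueness for the primal problem *)

Section primal.
Variables (n : nat) (y w p : V) (lam : R) (x : 'I_n -> T * T) (c : 'I_n -> R).
Hypotheses (lam0 : 0 < lam) (c_gt0 : forall i, 0 < c i).
Hypothesis p_feasible : feasible Yinner KD p.
Hypothesis px : forall i, Yinner p (KD (x i)) = 1.
Hypothesis contactP : forall z, Yinner p (KD z) = 1 -> exists i, z = x i.
Hypothesis KD_free : free_family Yinner (KD \o x).
Hypothesis residual :
  nrm Yinner (y + w - lam *: p - \sum_i c i *: KD (x i)) = 0.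

Let u : X := \sum_i c i *: Datom (x i).
Let dual_value : R := lam * Yinner p (y + w) - lam ^+ 2 / 2 * Yinner p p.

Lemma u_pos : smpos2 u.
Proof. by apply: atoms_pos => i; exact: ltW. Qed.

Lemma KY_u : nrm Yinner (KY u - (y + w - lam *: p)) = 0.
Proof.
apply/eqP; rewrite eq_le nrm_ge0 andbT.
apply: le_trans (nrm_triangle _ (\sum_i c i *: KD (x i)) _ _) _.
rewrite KY_atoms; last by move=> i; exact: ltW.
by rewrite add0r nrmB residual.
Qed.

Lemma dot_KY_u q : Yinner q (KY u) = \sum_i c i * Yinner q (KD (x i)).
Proof.
rewrite -pairing_Kpre; last exact: u_pos.
rewrite pairing_atoms; last exact/inXpre_bmeas2/inXpre_Kpre.
  by apply: eq_bigr => i _; rewrite pairing_Kpre//; exact: Datom_pos.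
by move=> i; exact: ltW.
Qed.

Lemma Greg_ge_dot v : (Greg v < +oo)%E ->
  exists2 g : R, Greg v = g%:E & Yinner p (KY v) <= g.
Proof.
move=> vy; have [vpos _] := Greg_ltyP vy.
have := Greg_ge v (inXpre_bmeas2 (inXpre_Kpre p)) (gap_Kpre_ge0 p_feasible).
rewrite pairing_Kpre//; case: (Greg v) vy => [g _|//|//].
by rewrite lee_fin => pg; exists g.
Qed.

(** The atoms bound [Greg u] from above and the certificate [p] bounds it from below, with the same
    value because all the [x i] are contact points. *)
Lemma Greg_u : Greg u = (Yinner p (KY u))%:E.
Proof.
have le : (Greg u <= (Yinner p (KY u))%:E)%E.
  rewrite dot_KY_u; under [X in (_ <= X%:E)%E]eq_bigr do rewrite px mulr1.
  by apply: Greg_atoms => i; exact: ltW.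
apply/eqP; rewrite eq_le le /=.
have [g ->] := Greg_ge_dot (le_lt_trans le (ltry _)).
by rewrite lee_fin.
Qed.

Lemma primal_objectiveE v (g : R) : smpos2 v -> Greg v = g%:E ->
  primal_objective k1 k2 lam (toF y) (toF w) v =
  (2^-1 * nrm Yinner (KY v - y - w) ^+ 2 + lam * g)%:E.
Proof.
by move=> vpos vg; rewrite /primal_objective vg Kop_KY// -!toFB normY_toF.
Qed.

(** Completing the square. With k = K v, the objective at [v] exceeds the dual value by half a
    square plus lam times the slack of G(v) >= <p, K v>; both vanish at [u]. *)
Lemma duality_gap (k : V) :
  2^-1 * nrm Yinner (k - y - w) ^+ 2 + lam * Yinner p k =
  2^-1 * nrm Yinner (k - (y + w - lam *: p)) ^+ 2 + dual_value.
Proof.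
rewrite (_ : k - y - w = k - (y + w)); last by rewrite opprD addrA.
rewrite (_ : k - (y + w - lam *: p) = k - (y + w) + lam *: p); last first.
  by rewrite opprB addrCA addrC.
have aE : Yinner p k = Yinner p (k - (y + w)) + Yinner p (y + w) by rewrite -dotDr subrK.
rewrite aE /dual_value; move: (k - (y + w)) (Yinner p (y + w)) => a b {aE}.
rewrite !sqr_nrm !dotE (dotC Yinner a p).
by move: (Yinner a a) (Yinner p a) (Yinner p p) => b1 b2 b3; field.
Qed.

Lemma primal_u : primal_objective k1 k2 lam (toF y) (toF w) u = dual_value%:E.
Proof.
rewrite (primal_objectiveE u_pos Greg_u) duality_gap KY_u.
by rewrite expr0n mulr0 add0r.
Qed.

Lemma primal_lower v (g : R) : smpos2 v -> Greg v = g%:E ->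
  primal_objective k1 k2 lam (toF y) (toF w) v =
  (2^-1 * nrm Yinner (KY v - (y + w - lam *: p)) ^+ 2 +
   lam * (g - Yinner p (KY v)) + dual_value)%:E.
Proof.
move=> vpos vg; rewrite (primal_objectiveE vpos vg); congr EFin.
by have := duality_gap (KY v); lra.
Qed.

Lemma u_primal_solution : primal_solution k1 k2 lam (toF y) (toF w) u.
Proof.
move=> v; rewrite primal_u; have [vy|] := ltP (Greg v) +oo%E; last first.
  rewrite leye_eq => /eqP vy; rewrite /primal_objective vy gt0_muley ?lte_fin//.
  by rewrite addey// leey.
have [vpos _] := Greg_ltyP vy; have [g vg pg] := Greg_ge_dot vy.
rewrite (primal_lower vpos vg) lee_fin lerDr addr_ge0// mulr_ge0 ?sqr_ge0//.
  exact: ltW.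
by rewrite subr_ge0.
Qed.

Lemma primal_solution_saturated v : primal_solution k1 k2 lam (toF y) (toF w) v ->
  [/\ smpos2 v, Greg v = (Yinner p (KY v))%:E & nrm Yinner (KY v - KY u) = 0].
Proof.
move=> /(_ u); rewrite primal_u => vle.
have vy : (Greg v < +oo)%E.
  rewrite ltNge leye_eq; apply/negP => /eqP vy; move: vle.
  by rewrite /primal_objective vy gt0_muley ?lte_fin// addey.
have [vpos _] := Greg_ltyP vy; have [g vg pg] := Greg_ge_dot vy.
move: vle; rewrite (primal_lower vpos vg) lee_fin gerDr => le0.
have h1 : 0 <= lam * (g - Yinner p (KY v)) by rewrite mulr_ge0 ?subr_ge0// ltW.
have h2 := sqr_ge0 (nrm Yinner (KY v - (y + w - lam *: p))).
have h3 : lam * (g - Yinner p (KY v)) = 0 by lra.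
have h4 : nrm Yinner (KY v - (y + w - lam *: p)) ^+ 2 = 0 by lra.
split=> //.
  move/eqP: h3; rewrite mulf_eq0 gt_eqF//= subr_eq0 => /eqP <-; exact: vg.
apply/eqP; rewrite eq_le nrm_ge0 andbT.
apply: le_trans (nrm_triangle _ (y + w - lam *: p) _ _) _.
move/eqP: h4; rewrite sqrf_eq0 => /eqP ->.
by rewrite add0r nrmB KY_u.
Qed.

Lemma lip_sum_continuous A (f g : T -> R) (d : R) : tlip A f -> tlip A g -> 0 <= A ->
  continuous (fun z : T * T => d * (2 + tdist z.1 z.2) + (f z.1 + g z.2)).
Proof.
move=> fA gA A0; apply: (@lip2_continuous _ (`|d| + A)); first by rewrite addr_ge0.
move=> z z'.
rewrite [X in `|X|](_ : _ = d * (tdist z.1 z.2 - tdist z'.1 z'.2) +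
  ((f z.1 - f z'.1) + (g z.2 - g z'.2))); last by ring.
rewrite mulrDl; apply: le_trans (ler_normD _ _) _; apply: lerD.
  by rewrite normrM ler_wpM2l// tdist_lip.
by apply: le_trans (ler_normD _ _) _; rewrite mulrDr lerD.
Qed.

(* Subtracting from eta its interpolation K_* P at the contact points leaves a
   pair that vanishes there, to which complementary slackness applies. *)
Lemma saturated_pairing A (eta : F2) : 0 <= A -> tlip A eta.1 -> tlip A eta.2 ->
  exists P, forall v, smpos2 v -> Greg v = (Yinner p (KY v))%:E ->
  pairing eta v = Yinner P (KY v).
Proof.
move=> A0 e1 e2; have [pd pdE] := dual_basis KD_free.
have beta : bmeas2 eta by split; [exact: tlip_bmeas e1 | exact: tlip_bmeas e2].
pose P : V := \sum_i pairing eta (Datom (x i)) *: pd i.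
have PE j : Yinner P (KD (x j)) = pairing eta (Datom (x j)).
  rewrite dot_suml (bigD1 j)// dotZl [Yinner _ _](pdE j j) eqxx mulr1.
  rewrite big1 => [|i ij]; first exact: addr0.
  by rewrite dotZl [Yinner _ _](pdE i j) (negbTE ij) mulr0.
have bK q : bmeas2 (Kpre k1 k2 (toF q)) by exact/inXpre_bmeas2/inXpre_Kpre.
have lK1 q : tlip (C * nrm Yinner q) (kpre k1 q.1).
  move=> s t; apply: le_trans (kpre_lip q.1 k1L C0 s t) _.
  by rewrite ler_wpM2r ?tdist_ge0// ler_wpM2l// nrm_fst_le.
have lK2 q : tlip (C * nrm Yinner q) (kpre k2 q.2).
  move=> s t; apply: le_trans (kpre_lip q.2 k2L C0 s t) _.
  by rewrite ler_wpM2r ?tdist_ge0// ler_wpM2l// nrm_snd_le.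
have CN q : 0 <= C * nrm Yinner q by rewrite mulr_ge0 ?nrm_ge0.
(* [P] depends on [eta] alone, so the pairing of a saturated measure with [eta] is determined by its
   image under [K]. *)
exists P => v vpos vg; case: (vpos) => v1 v2.
pose eta' : F2 := (fun s => eta.1 s + -1 * kpre k1 P.1 s,
                   fun s => eta.2 s + -1 * kpre k2 P.2 s).
have lsub (f g : T -> R) a b : tlip a f -> tlip b g -> tlip (a + b) (fun s => f s + -1 * g s).
  move=> fa gb s t; rewrite [X in `|X|](_ : _ = (f s - f t) - (g s - g t)); last by ring.
  by apply: le_trans (ler_normB _ _) _; rewrite mulrDl lerD.
have l1 : tlip (A + C * nrm Yinner P) eta'.1 by exact: lsub.
have l2 : tlip (A + C * nrm Yinner P) eta'.2 by exact: lsub.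
have bm (f : T -> R) : bmeas f -> bmeas (fun s : T => -1 * f s).
  by move=> bf; apply: bmeasM => //; exact: bmeas_cst.
have slack : pairing eta' v = 0.
  apply: (@Greg_slackness _ (Kpre k1 k2 (toF p)) eta' v) => //.
  - by split; [exact: tlip_bmeas l1 | exact: tlip_bmeas l2].
  - have hc := @lip_sum_continuous _ (fun s => -1 * kpre k1 p.1 s)
      (fun s => -1 * kpre k2 p.2 s) 1 _ _ (CN p).
    rewrite (_ : gap _ = fun z => 1 * (2 + tdist z.1 z.2) +
      (-1 * kpre k1 p.1 z.1 + -1 * kpre k2 p.2 z.2)).
      apply: hc => s t; rewrite -mulrBr normrM normrN1 mul1r; [exact: lK1|exact: lK2].
    apply/funext => z; change (2 + tdist z.1 z.2 - (kpre k1 p.1 z.1 + kpre k2 p.2 z.2) =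
      1 * (2 + tdist z.1 z.2) + (-1 * kpre k1 p.1 z.1 + -1 * kpre k2 p.2 z.2)).
    by rewrite mul1r !mulN1r opprD.
  - have hc := lip_sum_continuous (d := 0) l1 l2 (addr_ge0 A0 (CN P)).
    rewrite (_ : (fun z => _) = fun z => 0 * (2 + tdist z.1 z.2) + (eta'.1 z.1 + eta'.2 z.2))//.
    by apply/funext => z; rewrite mul0r add0r.
  - exact: gap_Kpre_ge0.
  - by rewrite pairing_Kpre.
  move=> z /gap_Kpre_eq0 /contactP[j ->].
  have := PE j; rewrite dot_KD pairing_Datom//.
  move=> /(congr1 (fun a => a * (2 + tdist (x j).1 (x j).2))).
  rewrite !divfK ?gt_eqF ?den_gt0//= => h; move: h; rewrite /=.
  by move=> h; rewrite addrACA -mulrDr h; ring.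
have [b1 b2] := bK P.
move: slack; rewrite -(pairing_Kpre _ vpos) /pairing /=.
have [b3 b4] := beta; have b5 := bm _ b1; have b6 := bm _ b2.
rewrite !smintDr// !smintZr//.
by move=> h; apply/eqP; rewrite -subr_eq0; apply/eqP; rewrite -[RHS]h; ring.
Qed.

Lemma primal_solution_unique v :
  primal_solution k1 k2 lam (toF y) (toF w) v -> v = u.
Proof.
move=> /primal_solution_saturated[vpos vg vu].
have eqp A eta : 0 <= A -> tlip A eta.1 -> tlip A eta.2 ->
    pairing eta v = pairing eta u.
  move=> A0 e1 e2; have [P hP] := saturated_pairing A0 e1 e2.
  rewrite (hP v vpos vg) (hP u u_pos Greg_u).
  apply/eqP; rewrite -subr_eq0 -dotNr -dotDr dotC; apply/eqP; exact: dot_null.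
have [v1 v2] := vpos; have [u1 u2] := u_pos.
have z0 mu : smpositive mu -> smint mu (fun=> 0) = 0 :> R.
  by move=> mu0; rewrite smint_pos// /Rintegral integral0.
have l0 A : 0 <= A -> tlip A (fun=> 0 : R).
  by move=> A0 s t; rewrite subrr normr0 mulr_ge0 ?tdist_ge0.
have labs L (f : T -> R) : tlip L f -> tlip `|L| f.
  move=> h s t; apply: le_trans (h s t) _.
  by rewrite ler_wpM2r ?tdist_ge0// ler_norm.
rewrite [v]surjective_pairing [u]surjective_pairing; congr pair.
  apply: smpositive_eq => // L f fL0; have {fL0}fL := labs L f fL0.
  have := @eqp `|L| (f, fun=> 0) (normr_ge0 _) fL (l0 _ (normr_ge0 _)).
  by rewrite /pairing /= !z0// !addr0.
apply: smpositive_eq => // L f fL0; have {fL0}fL := labs L f fL0.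
have := @eqp `|L| (fun=> 0, f) (normr_ge0 _) (l0 _ (normr_ge0 _)) fL.
by rewrite /pairing /= !z0// !add0r.
Qed.

End primal.

Lemma dual_objectiveE (lam : R) (y w p : V) : dual_objective lam (toF y) (toF w) (toF p) =
  lam * Yinner (y + w) p - lam ^+ 2 / 2 * Yinner p p.
Proof. by rewrite /dual_objective normY_toF sqr_nrm. Qed.

Lemma proj_dual_maximizer (lam : R) (y w p : V) : 0 < lam ->
  is_proj Yinner (feasible Yinner KD) (lam^-1 *: (y + w)) p ->
  dual_maximizer k1 k2 lam (toF y) (toF w) (toF p) /\
  forall q : F2, dual_maximizer k1 k2 lam (toF y) (toF w) q -> eqY q (toF p).
Proof.
move=> lam0 pP.
have h2 : 0 < lam ^+ 2 / 2 by rewrite divr_gt0// exprn_gt0.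
have key q : feasible Yinner KD q ->
    dual_objective lam (toF y) (toF w) (toF q) + lam ^+ 2 / 2 * nrm Yinner (q - p) ^+ 2 <=
    dual_objective lam (toF y) (toF w) (toF p).
  by rewrite !dual_objectiveE; exact: proj_maximizer.
have fp : dual_feasible k1 k2 (toF p) by apply/dual_feasibleP; case: pP.
split.
  split=> // _ /[dup] [[/toF_surj[q <-] _]] /dual_feasibleP fq.
  apply: le_trans (key q fq); rewrite lerDl mulr_ge0 ?sqr_ge0//; exact: ltW.
move=> _ [/[dup] [[/toF_surj[q <-] _]] /dual_feasibleP fq hq].
apply/eqY_toF; have := key q fq; have := hq _ fp.
move=> h1 h3; have : lam ^+ 2 / 2 * nrm Yinner (q - p) ^+ 2 <= 0.
  by rewrite -(lerD2l (dual_objective lam (toF y) (toF w) (toF q))) addr0; exact: le_trans h3 h1.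
rewrite pmulr_rle0// => h; apply/eqP; rewrite -sqrf_eq0 eq_le h sqr_ge0//.
Qed.

Hypothesis k1S : forall m h, `|second_diff k1 m h| <= C * h ^+ 2.
Hypothesis k2S : forall m h, `|second_diff k2 m h| <= C * h ^+ 2.

(** The second differences of the certificates of [p] and [p0] differ by at most C |p - p0| h^2, so
    the radius k / (C + 1) respects the allowance [k] of [contact_locally_unique]. *)
Lemma contact_isolated (p0 : V) x :
  torusC2 (Kpre k1 k2 (toF p0)).1 -> torusC2 (Kpre k1 k2 (toF p0)).2 ->
  feasible Yinner KD p0 -> Yinner p0 (KD x) = 1 ->
  hessianF_negative_definite (Kpre k1 k2 (toF p0)).1 (Kpre k1 k2 (toF p0)).2 x ->
  exists rr : R * R, [/\ 0 < rr.1, 0 < rr.2 & forall p z w,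
    feasible Yinner KD p -> nrm Yinner (p - p0) <= rr.2 ->
    Yinner p (KD z) = 1 -> Yinner p (KD w) = 1 ->
    tdist2 z x < rr.1 -> tdist2 w x < rr.1 -> z = w].
Proof.
set phi := (Kpre k1 k2 (toF p0)).1; set psi := (Kpre k1 k2 (toF p0)).2.
move=> phiC2 psiC2 fp0 /gap_Kpre_eq0 p0x [a [b [ax bx dx H]]].
have g0 := gap_Kpre_ge0 fp0.
have [f1 [f2 [fd1 fd2 f2c _]]] := torusC2_derive phiC2.
have [g1 [g2 [gd1 gd2 g2c _]]] := torusC2_derive psiC2.
have [f2a g2b] := contact_concave fd1 fd2 gd1 gd2 g0 p0x ax bx dx H.
have [A [_ _ _ phiA]] := torusC2_bound phiC2.
have ab := contact_not_antipodal ax bx phiA g0 p0x dx.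
have [[r k] /= [r0 k0] uniq] := contact_locally_unique fd1 fd2 f2c f2a gd1 gd2 g2c g2b ax bx ab.
have C1 : 0 < C + 1 by rewrite ltr_wpDl.
exists (r, k / (C + 1)); split=> //=; first by rewrite divr_gt0.
move=> p z w fp pp0 /gap_Kpre_eq0 pz /gap_Kpre_eq0 pw zx wx.
have t1 z' : tdist2 z' x < r -> tdist z'.1 x.1 < r.
  by apply: le_lt_trans; rewrite lerDl tdist_ge0.
have t2 z' : tdist2 z' x < r -> tdist z'.2 x.2 < r.
  by apply: le_lt_trans; rewrite lerDr tdist_ge0.
have Ck : C * nrm Yinner (p - p0) <= k.
  have : (C + 1) * nrm Yinner (p - p0) <= k by rewrite mulrC -ler_pdivlMr.
  by have := nrm_ge0 Yinner (p - p0); lra.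
have sd k' (q q0 : @tL2 R) m h : tlip C k' ->
    (forall m h, `|second_diff k' m h| <= C * h ^+ 2) ->
    nrm (@tL2inner R) (q - q0) <= nrm Yinner (p - p0) ->
    `|second_diff (kpre k' q) m h - second_diff (kpre k' q0) m h| <= k * h ^+ 2.
  move=> k'L k'S le.
  have -> : second_diff (kpre k' q) m h - second_diff (kpre k' q0) m h =
      second_diff (kpre k' (q - q0)) m h.
    by rewrite /second_diff !(kpreB _ _ _ k'L C0); ring.
  apply: le_trans (@kpre_second_diff _ C (C * h ^+ 2) _ _ _ _ k'L C0 _ _) _.
  - by rewrite mulr_ge0 ?sqr_ge0.
  - by move=> m'; exact: k'S.
  rewrite mulrAC ler_wpM2r ?sqr_ge0//; apply: le_trans Ck.
  by rewrite ler_wpM2l.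
apply: (uniq (Kpre k1 k2 (toF p)) (gap_Kpre_ge0 fp)) => //; try (by apply: t1); try (by apply: t2).
- by move=> m h; apply: sd => //; exact: (nrm_fst_le (p - p0)).
- by move=> m h; apply: sd => //; exact: (nrm_snd_le (p - p0)).
Qed.

End kernel_operators.
End Y_space.

Lemma tlip_mono {R : realType} (A A' : R) (f : torus R -> R) : A <= A' ->
  tlip A f -> tlip A' f.
Proof. by move=> AA h s t; apply: le_trans (h s t) _; rewrite ler_wpM2r ?tdist_ge0. Qed.

Lemma torusC2_bound2 {R : realType} (k1 k2 : torus R -> R) :
  torusC2 k1 -> torusC2 k2 -> exists2 C : R, 0 <= C & forall k, k = k1 \/ k = k2 ->
  [/\ forall x, `|k x| <= C, tlip C k & forall m h, `|second_diff k m h| <= C * h ^+ 2].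
Proof.
move=> /torusC2_bound[C1 [C10 a1 b1 c1]] /torusC2_bound[C2 [C20 a2 b2 c2]].
have C1C : C1 <= C1 + C2 by rewrite lerDl.
have C2C : C2 <= C1 + C2 by rewrite lerDr.
exists (C1 + C2); first exact: addr_ge0.
move=> k [->|->]; split=> [x||m h].
- exact: le_trans (a1 x) _.
- exact: tlip_mono b1.
- by apply: le_trans (c1 m h) _; rewrite ler_wpM2r ?sqr_ge0.
- exact: le_trans (a2 x) _.
- exact: tlip_mono b2.
- by apply: le_trans (c2 m h) _; rewrite ler_wpM2r ?sqr_ge0.
Qed.

Theorem theorem6p23 (R : realType) (k1 k2 : torus R -> R)
    (n : nat) (c0 : 'I_n -> R) (x0 : 'I_n -> torus R * torus R)
    (u0 : signed_measure (torus R) R * signed_measure (torus R) R)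
    (y0 p0 eta0 : (torus R -> R) * (torus R -> R))
    (dB : signed_measure (torus R) R * signed_measure (torus R) R ->
          signed_measure (torus R) R * signed_measure (torus R) R -> R)
    (k1C2 : torusC2 k1) (k2C2 : torusC2 k2)
    (c0_gt0 : forall i, 0 < c0 i)
    (u0E : u0 = \sum_(i < n) c0 i *: Datom (x0 i))
    (y0E : y0 = Kop k1 k2 u0)
    (p0P : min_norm_dual_solution k1 k2 y0 p0)
    (eta0E : eta0 = Kpre k1 k2 p0)
    (source_condition :
      exists p, inY p /\ subdiff (@Greg R) u0 (Kpre k1 k2 p))
    (contact_set : forall x : torus R * torus R,
      pairing eta0 (Datom x) = 1 <-> exists i, x = x0 i)
    (eta0C2 : torusC2 eta0.1 /\ torusC2 eta0.2)
    (nondegenerate :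
      forall i, hessianF_negative_definite eta0.1 eta0.2 (x0 i))
    (KD_free : linearly_independentY (fun i => Kop k1 k2 (Datom (x0 i))))
    (dB_metrizes : metrizes_weakstar (@Bset R) dB) :
  exists2 eps0 : R, 0 < eps0 & forall eps : R, 0 < eps < eps0 ->
  exists alpha lambda0 : R, [/\ 0 < alpha, 0 < lambda0 &
    forall (lambda : R) (w : (torus R -> R) * (torus R -> R)),
      Nset alpha lambda0 (lambda, w) -> 0 < lambda ->
    exists ut, unique (primal_solution k1 k2 lambda y0 w) ut /\
    exists pt, [/\ dual_maximizer k1 k2 lambda y0 w pt,
      forall q, dual_maximizer k1 k2 lambda y0 w q -> eqY q pt &
      exists! cx : 'I_n -> R * (torus R * torus R),
        ut = \sum_(i < n) (cx i).1 *: Datom (cx i).2 /\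
        forall i, [/\ Bball dB (Datom (x0 i)) eps (Datom (cx i).2),
          pairing (Kpre k1 k2 pt) (Datom (cx i).2) = 1,
          0 < (cx i).1 & `|(cx i).1 - c0 i| <= eps]]].
Proof.
have [C C0 hC] := torusC2_bound2 k1C2 k2C2.
have [k1C k1L k1S] := hC k1 (or_introl erefl).
have [k2C k2L k2S] := hC k2 (or_intror erefl).
have [[[p0Y _] _] _] := p0P; have [q0 q0E] := toF_surj p0Y; subst p0 eta0 => {p0Y}.
pose B := @Yinner R; pose D := KD k1 k2; pose F := feasible B D.
have u0pos : smpos2 u0 by rewrite u0E; apply: atoms_pos => i; exact: ltW.
have y0F : y0 = toF (KY k1 k2 u0) by rewrite y0E (Kop_KY C0 k1L k2L u0pos).
have fP q : dual_feasible k1 k2 (toF q) <-> F q by exact: (dual_feasibleP C0 k1L k2L).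
have fq0 : F q0 by apply/fP; case: p0P => -[].
have q0max q : F q -> B (KY k1 k2 u0) q <= B (KY k1 k2 u0) q0.
  by move=> /fP hq; have [[_ h] _] := p0P; have := h _ hq; rewrite y0F.
have q0min q : F q -> (forall p, F p -> B (KY k1 k2 u0) p <= B (KY k1 k2 u0) q) ->
    nrm B q0 <= nrm B q.
  move=> /fP hq qmax; have [_ h] := p0P; have := h (toF q); apply.
  split=> // p /[dup] -[/toF_surj[{}p <-] _] /fP hp.
  by rewrite y0F; exact: qmax.
have pairD q z : pairing (Kpre k1 k2 (toF q)) (Datom z) = B q (D z).
  by rewrite (pairing_Kpre C0 k1L k2L)//; exact: Datom_pos.
have contact z : B q0 (D z) = 1 <-> exists i, z = x0 i.
  by rewrite -pairD; exact: contact_set.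
have Dfree : free_family B (D \o x0).
  move=> a a0; apply: KD_free.
  rewrite (_ : \sum_i _ = toF (\sum_i a i *: (D \o x0) i)).
    by apply/(eqY_toF _ 0); rewrite subr0.
  rewrite toF_sum; apply: eq_bigr => i _; congr (_ *: _).
  by rewrite (Kop_KY C0 k1L k2L)//; exact: Datom_pos.
have hiso i := contact_isolated C0 k1L k2L k1S k2S (p0 := q0) (x := x0 i).
have {hiso} /choice[rr hrr] i : exists rr : R * R, [/\ 0 < rr.1, 0 < rr.2 & forall p z w,
    F p -> nrm B (p - q0) <= rr.2 -> B p (D z) = 1 -> B p (D w) = 1 ->
    tdist2 z (x0 i) < rr.1 -> tdist2 w (x0 i) < rr.1 -> z = w].
  have [h1 h2] := eta0C2; have h3 : B q0 (D (x0 i)) = 1 by apply/contact; exists i.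
  exact: (hiso i h1 h2 fq0 h3 (nondegenerate i)).
have [i|r r0 rle] := @finite_lower_bound R n (fun i => (rr i).1); first by case: (hrr i).
have [i|rho rho0 rhole] := @finite_lower_bound R n (fun i => (rr i).2).
  by case: (hrr i).
have r2 : 0 < r / 2 by rewrite divr_gt0.
(* This determines [eps0]: atoms in a [dB]-ball of smaller radius around the atom of [x0 i] come
   from the [r]-neighbourhood of [x0 i], where contact points are unique. Uniqueness of the
   representation rests on it. *)
have /choice[es hes] i : exists e, 0 < e /\ forall x,
    dB (Datom x) (Datom (x0 i)) <= e -> tdist2 x (x0 i) < r.
  have [e e0 he] := dB_small_Datom dB_metrizes (x0 i) r2.
  by exists e; split=> // x /he[h1 h2]; rewrite /tdist2; lra.
have [i|eps0 eps00 eps0le] := @finite_lower_bound R n es; first by case: (hes i).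
exists eps0 => // eps /andP[epsgt0 epslt].
have /choice[ss hss] i : exists s, 0 < s /\ forall x,
    tdist2 x (x0 i) < s -> dB (Datom x) (Datom (x0 i)) <= eps.
  have [s s0 hs] := Datom_dB_small dB_metrizes (x0 i) epsgt0.
  exists s; split=> // x xs; apply: hs; apply: le_lt_trans xs.
    by rewrite lerDl tdist_ge0.
  by rewrite lerDr tdist_ge0.
have [i|s s0 sle] := @finite_lower_bound R n ss; first by case: (hss i).
(* [eps] bounds the error of the coefficients, [r] is required by [stability], and [s] places the
   new atoms in the [dB]-balls of radius [eps]. *)
pose e := Num.min eps (Num.min r s).
have e0 : 0 < e by rewrite !lt_min epsgt0 r0.
have eeps : e <= eps by rewrite /e ge_min lexx.
have er : e <= r by rewrite /e !ge_min lexx orbT.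
have es' : e <= s by rewrite /e !ge_min lexx !orbT.
have y0null : nrm B (KY k1 k2 u0 - \sum_i c0 i *: D (x0 i)) = 0.
  by rewrite u0E (KY_atoms C0 k1L k2L)// => i; exact: ltW.
have luniq p i z w : F p -> nrm B (p - q0) <= rho -> B p (D z) = 1 -> B p (D w) = 1 ->
    tdist2 z (x0 i) < r -> tdist2 w (x0 i) < r -> z = w.
  move=> fp pq pz pw zx wx; have [_ _ h] := hrr i.
  by apply: (h p z w fp _ pz pw);
    [exact: le_trans pq _ | exact: lt_le_trans zx _ | exact: lt_le_trans wx _].
have C20 : 0 <= 2 * C by rewrite mulr_ge0.
have [alpha [lambda0 [alpha0 lambda00 hstab]]] := stability C20 C0
  (KD_lip C0 k1C k2C k1L k2L) (KD_bound C0 k1C k2C k1L k2L) (@Y_complete R) c0_gt0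
  y0null fq0 q0max q0min (fun z => (contact z).1) Dfree rho0 luniq e0 er.
exists alpha, lambda0; split=> // lam w [/andP[_ lamle]] /= /toF_surj[v <-] vle lam0.
rewrite normY_toF in vle.
have [p pP] := proj_exists (lam^-1 *: (KY k1 k2 u0 + v)) (@Y_complete R)
  (@feasible_closed R _ B D) (@feasible_convex R _ B D)
  (ex_intro _ _ (@feasible0 R _ B D)).
have lamin : 0 < lam <= lambda0 by rewrite lam0.
have [x [c [hxc contactx xuniq xfree residual]]] := hstab lam v p lamin vle pP.
have c_gt0 i : 0 < c i by case: (hxc i).
have px i : B p (D (x i)) = 1 by case: (hxc i).
have fp : F p by case: pP.
have [dmax duniq] := proj_dual_maximizer C0 k1L k2L lam0 pP.
rewrite y0F; exists (\sum_i c i *: Datom (x i)); split.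
  split.
    exact: (u_primal_solution C0 k1L k2L lam0 c_gt0 fp px residual).
  move=> u hu; apply/esym.
  exact: (primal_solution_unique C0 k1L k2L lam0 c_gt0 fp px contactx xfree residual).
exists (toF p); split=> //; exists (fun i => (c i, x i)); split.
  split=> // i; have [xe _ _ cc] := hxc i; split=> //=.
  - split; first exact: Datom_Bset.
    have [_ h] := hss i; apply: h; apply: lt_le_trans xe _.
    exact: le_trans es' (sle i).
  - by rewrite pairD.
  - exact: le_trans cc eeps.
move=> cx [uE hcx].
have cxx i : (cx i).2 = x i.
  have [[_ ball] contact1 _ _] := hcx i.
  apply: xuniq; last by rewrite -pairD.
  have [_ h] := hes i; apply: h; apply: le_trans ball _.
  exact: le_trans (ltW epslt) (eps0le i).
have cxpos i : 0 <= (cx i).1 by apply: ltW; case: (hcx i).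
apply/funext => i; rewrite [cx i]surjective_pairing cxx; congr pair.
apply/eqP; rewrite -subr_eq0; apply/eqP.
(* Both representations have the same points and the same image under [K], so freeness of the images
   of the atoms equates the coefficients. *)
apply: (xfree (fun i => c i - (cx i).1)).
have n1 := KY_atoms C0 k1L k2L x (fun i => ltW (c_gt0 i)).
have n2 := KY_atoms C0 k1L k2L (fun i => (cx i).2) cxpos.
apply/eqP; rewrite eq_le nrm_ge0 andbT.
rewrite (_ : \sum_i _ = \sum_i c i *: D (x i) - \sum_i (cx i).1 *: D (cx i).2); last first.
  by rewrite -sumrB; apply: eq_bigr => j _; rewrite scalerBl cxx.
rewrite -uE in n2.
apply: le_trans (nrm_triangle B (KY k1 k2 (\sum_i c i *: Datom (x i))) _ _) _.
rewrite [X in X + _](etrans (nrmB _ _ _) n1) [X in _ + X]n2 addr0.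
exact: lexx.
Qed.
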